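(* For every integer $d\ge 3$ and every intensity $u\in(0,\infty)$, the Poisson cylinder model in $\mathbb{R}^d$ with intensity $u$ satisfies $$\mathbb{P}[\operatorname{diam}(\mathcal{C})=d-2]=1.$$
   Context: $A(d,1)$ is the set of all bi-infinite lines in $\mathbb{R}^d$ ($1$-dimensional affine subspaces). For $K\subset\mathbb{R}^d$ let $\mathcal{L}_K=\{L\in A(d,1): L\cap K\neq\emptyset\}$. $\mu_{d,1}$ is the unique Haar measure on $A(d,1)$ (invariant under translations and rotations of $\mathbb{R}^d$) normalized so that $\mu_{d,1}(\mathcal{L}_{B_d(0,1)})=\kappa_{d-1}$, where $B_d(0,1)$ is the unit ball of $\mathbb{R}^d$ and $\kappa_{d-1}$ is the volume of the $(d-1)$-dimensional unit ball. Under $\mathbb{P}$, $\omega$ is a Poisson point process on $A(d,1)$ with intensity measure $u\mu_{d,1}$ (a homogeneous Poisson line process of intensity $u$), i.e. a random locally finite point measure $\omega=\sum_i\delta_{L_i}$; one writes $L\in\omega$ if $L$ is in the support of $\omega$. For a line $L$, $\mathfrak{c}(L)=\{x\in\mathbb{R}^d: d(x,L)\le 1\}$ is the cylinder of base radius $1$ centered around $L$. A cylinder $\mathfrak{c}=\mathfrak{c}(L)$ is said to belong to $\omega$ ($\mathfrak{c}\in\omega$) if $L\in\omega$. The covered region is $\mathcal{C}=\bigcup_{L\in\omega}\mathfrak{c}(L)$. For $\mathfrak{c}_a,\mathfrak{c}_b\in\omega$, the cylinder distance $\operatorname{Cdist}(\mathfrak{c}_a,\mathfrak{c}_b)$ is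 the minimal integer $k\ge 0$ such that there exist cylinders $\mathfrak{c}_1,\dots,\mathfrak{c}_k\in\omega$ for which $\mathfrak{c}_a\cup\mathfrak{c}_b\cup\bigcup_{i=1}^k\mathfrak{c}_i$ is a connected set ($\infty$ if no such $k$ exists). The diameter is $\operatorname{diam}(\mathcal{C})=\sup\{\operatorname{Cdist}(\mathfrak{c}_a,\mathfrak{c}_b):\mathfrak{c}_a,\mathfrak{c}_b\in\omega\}$. *)

(* Defs.v *)
From HB Require Import structures.
From mathcomp Require Import all_boot all_order all_algebra.
From mathcomp Require Import all_classical all_reals all_analysis.
From mathcomp Require Import measurable_realfun.
Import Order.TTheory GRing.Theory Num.Theory.
Import numFieldNormedType.Exports.

Set Implicit Arguments.
Unset Strict Implicit.
Unset Printing Implicit Defensive.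

Local Open Scope classical_set_scope.
Local Open Scope ring_scope.

(* The library's norm on matrices is the sup norm, hence the explicit Euclidean
   norm.  Both norms induce the canonical topology of 'rV[R]_m. *)
Definition enorm (R : realType) (m : nat) (x : 'rV[R]_m) : R :=
  Num.sqrt (\sum_(i < m) x ord0 i ^+ 2).

Definition edist_set (R : realType) (m : nat) (x : 'rV[R]_m)
    (A : set 'rV[R]_m) : R :=
  inf [set enorm (x - y) | y in A].

Definition unit_ball (R : realType) (m : nat) : set 'rV[R]_m :=
  [set x | enorm x <= 1].
Arguments unit_ball : clear implicits.

(* Integral against m-dimensional Lebesgue measure, one coordinate at a time;
   for nonnegative measurable f this is the Lebesgue integral by Tonelli. *)
Fixpoint integral_rV (R : realType) (m : nat) :
    ('rV[R]_m -> \bar R) -> \bar R :=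
  match m with
  | 0 => fun f => f 0
  | k.+1 => fun f =>
      (\int[@lebesgue_measure R]_(t in [set: R])
        integral_rV (fun v : 'rV[R]_k => f (row_mx (const_mx t : 'rV[R]_1) v)))%E
  end.

Definition unit_ball_volume (R : realType) (m : nat) : \bar R :=
  integral_rV (fun x : 'rV[R]_m => (\1_(unit_ball R m) x)%:E).

Definition line_through (R : realType) (m : nat) (p v : 'rV[R]_m) :
    set 'rV[R]_m :=
  [set p + t *: v | t in [set: R]].

(* [line R n] is A(n+1, 1).  A measurableType has to be pointed, and there is no
   line in dimension 0, so the ambient dimension is a successor throughout. *)
Record line (R : realType) (n : nat) := Line {
  line_set : set 'rV[R]_n.+1 ;
  line_setP : exists p v, v != 0 /\ line_set = line_through p v
}.

Lemma line_set_inj (R : realType) (n : nat) : injective (@line_set R n).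
Proof.
move=> [A hA] [B hB] /= AB; move: hA hB; rewrite AB => hA hB.
by rewrite (Prop_irrelevance hA hB).
Qed.

Section line_structures.
Variables (R : realType) (n : nat).
Local Notation V := 'rV[R]_n.+1.

HB.instance Definition _ := gen_eqMixin (line R n).
HB.instance Definition _ := gen_choiceMixin (line R n).

Let point_lineP : exists p v : V,
  v != 0 /\ line_through 0 (const_mx 1) = line_through p v.
Proof.
exists 0, (const_mx 1); split => //; apply/eqP => /matrixP/(_ ord0 ord0).
by rewrite !mxE => /eqP; rewrite oner_eq0.
Qed.

HB.instance Definition _ := isPointed.Build (line R n) (Line point_lineP).

(* Final topology for (p, v) |-> p + R v, defined for v != 0. *)
Definition line_open (U : set (line R n)) : Prop :=
  open [set pv : V * V | pv.2 != 0 /\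
    exists2 L, U L & line_set L = line_through pv.1 pv.2].

Let line_openT : line_open setT.
Proof.
rewrite /line_open.
have -> : [set pv : V * V | pv.2 != 0 /\ exists2 L : line R n, [set: line R n] L &
    line_set L = line_through pv.1 pv.2] = snd @^-1` (~` [set 0]).
  apply/seteqP; split => -[p v] /=; first by case=> /eqP.
  move=> /eqP v0; split => //.
  by exists (Line (ex_intro _ p (ex_intro _ v (conj v0 erefl)))).
apply: open_comp; first by move=> x _; exact: cvg_snd.
apply/closed_openC/accessible_closed_set1/hausdorff_accessible.
exact: norm_hausdorff.
Qed.

Let line_openI : setI_closed line_open.
Proof.
move=> A B oA oB; rewrite /line_open.
have := openI oA oB; congr open; apply/seteqP; split => -[p v] /=.
- move=> [[v0 [L AL eL]] [_ [M BM eM]]]; split => //; exists L => //.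
  by split => //; rewrite (_ : L = M)//; apply: line_set_inj; rewrite eL eM.
- by move=> [v0 [L [AL BL] eL]]; split; split => //; exists L.
Qed.

Let line_open_bigU (I : Type) (f : I -> set (line R n)) :
  (forall i, line_open (f i)) -> line_open (\bigcup_i f i).
Proof.
move=> of_; rewrite /line_open.
have := bigcup_open (fun i (_ : setT i) => of_ i).
congr open; apply/seteqP; split => -[p v] /=.
- by move=> [i _ [v0 [L fL eL]]]; split => //; exists L => //; exists i.
- by move=> [v0 [L [i _ fL] eL]]; exists i => //; split => //; exists L.
Qed.

HB.instance Definition _ := isOpenTopological.Build (line R n)
  line_openT line_openI line_open_bigU.

HB.instance Definition _ :=
  Measurable.copy (line R n) (g_sigma_algebraType (@open (line R n))).

End line_structures.

Section poisson_cylinders.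
Variables (R : realType) (n : nat).
Local Notation V := 'rV[R]_n.+1.
Local Notation lines := (line R n).
Local Open Scope ereal_scope.

Definition hitting (K : set V) : set lines :=
  [set L | line_set L `&` K !=set0].

Definition image_lines (f : V -> V) (A : set lines) : set lines :=
  [set L' | exists2 L, A L & line_set L' = f @` line_set L].

Definition rotation (M : 'M[R]_n.+1) : Prop :=
  M *m M^T = 1%:M /\ (\det M = 1)%R.

(* The normalization makes mu finite on compact sets, so that these conditions
   determine mu. *)
Definition is_haar (mu : {measure set lines -> \bar R}) : Prop :=
  [/\ forall (a : V) (A : set lines), measurable A ->
        mu (image_lines (fun x => x + a)%R A) = mu A,
      forall (M : 'M[R]_n.+1) (A : set lines), rotation M -> measurable A ->
        mu (image_lines (fun x => x *m M) A) = mu A &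
      mu (hitting (unit_ball R n.+1)) = unit_ball_volume R n ].

Definition is_point_measure (m : {measure set lines -> \bar R}) : Prop :=
  (exists (I : set nat) (L : nat -> lines), forall A : set lines,
     measurable A -> m A = \esum_(i in I) \d_(L i) A) /\
  (forall K : set V, compact K -> m (hitting K) < +oo).

Definition support (m : {measure set lines -> \bar R}) : set lines :=
  [set L | forall U : set lines, open U -> U L -> 0 < m U].

Definition mutually_independent (disp : measure_display)
    (T : measurableType disp) (P : probability T R) (k : nat)
    (X : 'I_k -> T -> \bar R) : Prop :=
  forall B : 'I_k -> set (\bar R), (forall i, measurable (B i)) ->
    P (\bigcap_(i in [set: 'I_k]) (X i @^-1` B i)) =
    \prod_(i < k) P (X i @^-1` B i).

(* The second argument of [poisson_prob] is a dummy; rate 0 gives \d_0. *)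
Definition is_poisson_process (disp : measure_display)
    (T : measurableType disp) (P : probability T R)
    (Lambda : set lines -> \bar R)
    (omega : T -> {measure set lines -> \bar R}) : Prop :=
  [/\ forall w, is_point_measure (omega w),
      forall A : set lines, measurable A ->
        measurable_fun [set: T] (fun w => omega w A),
      forall A : set lines, measurable A -> Lambda A < +oo ->
        forall k : nat, P [set w | omega w A = k%:R%:E] =
          poisson_prob (fine (Lambda A)) 0 [set k],
      forall A : set lines, measurable A -> Lambda A = +oo ->
        P [set w | omega w A = +oo] = 1 &
      forall (k : nat) (A : 'I_k -> set lines), (forall i, measurable (A i)) ->
        trivIset [set: 'I_k] A ->
        mutually_independent P (fun i w => omega w (A i)) ].

Definition cylinder (L : lines) : set V :=
  [set x | (edist_set x (line_set L) <= 1)%R].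

Definition cylinders (m : {measure set lines -> \bar R}) : set (set V) :=
  [set cylinder L | L in support m].

(* The infimum of the empty set is +oo. *)
Definition Cdist (m : {measure set lines -> \bar R}) (ca cb : set V) : \bar R :=
  ereal_inf [set k%:R%:E | k in [set k : nat | exists c : 'I_k -> set V,
    (forall i, cylinders m (c i)) /\
    connected (ca `|` cb `|` \bigcup_(i in [set: 'I_k]) c i)]].

Definition cylinder_diam (m : {measure set lines -> \bar R}) : \bar R :=
  ereal_sup [set Cdist m c.1 c.2 | c in cylinders m `*` cylinders m].

End poisson_cylinders.

(* Main.v *)
(* Two cylinders intersect iff some unit ball meets both axes, so the diameter is at
   most [k] iff any two lines of the process are joined by a chain of [k] intermediate
   lines, consecutive lines meeting a common unit ball.  The lines that meet two unit
   balls at distance [r] have measure of order [r^(1 - d)].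

   Lower bound.  The expected number of chains of [l] distinct lines leading from a unit
   ball to another one at distance [r] is an [l]-fold convolution of [|z|^(1 - d)],
   hence of order [r^(l - d)], which tends to 0 if [l < d].  A finite set of balls is
   hit with probability close to 1, and so is a far translate of it, hence chains of at
   most [d - 1] lines, which have at most [d - 3] intermediate lines, do not join all
   pairs.

   Upper bound.  Given two non-parallel lines, a linear map to the plane sends their
   directions to the points of parameters 1 and [d - 1] of the parabola [(t, t^2)].  At
   scale [N], take [N] equally spaced points on a stretch of length of order [N] of each
   of the two lines, and the lattice points of a cube of side [N] over each of the
   [d - 3] intermediate points [N (t, t^2)].  The expected number of chains of [d - 2]
   lines through these [d - 1] sets of points has order
   [N^(2 + d (d - 3) - (d - 1) (d - 2)) = 1], and its second moment is bounded because
   no line meets three of these regions; hence the two lines are joined with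
   probability bounded below, uniformly in [N].  For the same reason distant scales
   involve disjoint sets of lines, so that they are independent and one of them
   succeeds almost surely.  Parallel lines almost surely do not occur. *)

From HB Require Import structures.
From mathcomp Require Import all_boot all_order all_algebra.
From mathcomp Require Import all_classical all_reals all_analysis.
From mathcomp Require Import finmap measurable_realfun ring lra zify.
Require Import Defs.
Import Order.TTheory GRing.Theory Num.Theory.
Import numFieldNormedType.Exports.

Set Implicit Arguments.
Unset Strict Implicit.
Unset Printing Implicit Defensive.

Local Open Scope classical_set_scope.
Local Open Scope ring_scope.

(** * Euclidean geometry *)

Section euclid.
Variables (R : realType) (m : nat).
Local Notation V := 'rV[R]_m.
Implicit Types (x y z : V) (a b : R).

(** The kernel estimate is drawn from invariance alone. Rotations make the measure of the lines
    hitting two equal balls a nonincreasing function of the distance of the centres, so covering and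
    packing arguments with lattice points on the faces of a cube give the two bounds.

    Contact points and ends of segments are rounded to lattices to keep all unions countable.
    Rounding a contact point costs 1, hence the radius 2 in the lower bound; the upper bound has to
    produce actual contacts and keeps radius 1.

    In the upper bound the points of a chain depend on the random lines to be joined. These are
    sorted into finitely many cells that determine the points at all scales. The number of cells
    grows with the number [K] of scales, but each failure bound is [(1 - c) ^+ K] times a bound for
    the probability that both cells are occupied, and the latter bounds have a sum independent of
    [K].

    Estimates are first made through measurable covers; the measurability of the final event is
    obtained separately, by coding lines with binary words. *)

Definition dot x y : R := \sum_(i < m) x ord0 i * y ord0 i.

Lemma dotC x y : dot x y = dot y x.
Proof. by apply: eq_bigr => i _; rewrite mulrC. Qed.

Lemma dotDl x y z : dot (x + y) z = dot x z + dot y z.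
Proof. by rewrite -big_split; apply: eq_bigr => i _; rewrite mxE mulrDl. Qed.

Lemma dotZl a x y : dot (a *: x) y = a * dot x y.
Proof. by rewrite mulr_sumr; apply: eq_bigr => i _; rewrite mxE mulrA. Qed.

Lemma dotNl x y : dot (- x) y = - dot x y.
Proof. by rewrite -scaleN1r dotZl mulN1r. Qed.

Lemma dotDr x y z : dot z (x + y) = dot z x + dot z y.
Proof. by rewrite dotC dotDl !(dotC z). Qed.

Lemma dotZr a x y : dot x (a *: y) = a * dot x y.
Proof. by rewrite dotC dotZl dotC. Qed.

Lemma dotNr x y : dot x (- y) = - dot x y.
Proof. by rewrite dotC dotNl dotC. Qed.

Definition dotE := (dotDl, dotDr, dotZl, dotZr, dotNl, dotNr).

Lemma dot_mul x y : dot x y = (x *m y^T) ord0 ord0.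
Proof. by rewrite mxE; apply: eq_bigr => i _; rewrite mxE. Qed.

Lemma dot_ge0 x : 0 <= dot x x.
Proof. by apply: sumr_ge0 => i _; rewrite -expr2 sqr_ge0. Qed.

Lemma dot_eq0 x : (dot x x == 0) = (x == 0).
Proof.
apply/eqP/eqP => [x0|->]; last by rewrite /dot big1// => i _; rewrite mxE mul0r.
apply/rowP => i; rewrite mxE; apply/eqP.
rewrite -sqrf_eq0; apply/eqP.
apply: (psumr_eq0P (F := fun i => x ord0 i ^+ 2) (P := xpredT)) => //.
by move=> j _; exact: sqr_ge0.
Qed.

Lemma dot_gt0 x : x != 0 -> 0 < dot x x.
Proof. by move=> x0; rewrite lt_def dot_eq0 x0 dot_ge0. Qed.

Lemma enormE x : enorm x = Num.sqrt (dot x x).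
Proof. by []. Qed.

Lemma enorm_ge0 x : 0 <= enorm x.
Proof. exact: sqrtr_ge0. Qed.

Lemma sqr_enorm x : enorm x ^+ 2 = dot x x.
Proof. by rewrite enormE sqr_sqrtr// dot_ge0. Qed.

Lemma enorm_le x a : 0 <= a -> (enorm x <= a) = (dot x x <= a ^+ 2).
Proof. by move=> a0; rewrite -sqr_enorm ler_sqr// nnegrE enorm_ge0. Qed.

Lemma enorm_lt x a : 0 <= a -> (enorm x < a) = (dot x x < a ^+ 2).
Proof. by move=> a0; rewrite -sqr_enorm ltr_sqr// nnegrE enorm_ge0. Qed.

Lemma enormZ a x : enorm (a *: x) = `|a| * enorm x.
Proof.
by rewrite enormE !dotE mulrA -expr2 sqrtrM ?sqr_ge0// sqrtr_sqr.
Qed.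

Lemma enormN x : enorm (- x) = enorm x.
Proof. by rewrite -scaleN1r enormZ normrN1 mul1r. Qed.

Lemma enorm0 : enorm (0 : V) = 0.
Proof. by rewrite -(scale0r 0) enormZ normr0 mul0r. Qed.

Lemma enorm_distC x y : enorm (x - y) = enorm (y - x).
Proof. by rewrite -enormN opprB. Qed.

Lemma dot_le x y : dot x y <= enorm x * enorm y.
Proof.
have [->|y0] := eqVneq y 0.
  by rewrite enorm0 mulr0 -(scale0r 0) dotZr mul0r.
have d0 := dot_gt0 y0; apply: le_trans (ler_norm _) _.
rewrite -ler_sqr ?nnegrE ?mulr_ge0 ?enorm_ge0// exprMn !sqr_enorm real_normK ?num_real//.
have := dot_ge0 (dot y y *: x - dot x y *: y); rewrite !dotE (dotC y x).
set A := dot x x; set B := dot x y; set C := dot y y in d0 *.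
have -> : C * (C * A - B * B) + (C * - (B * B) - B * - (B * C)) =
  C * (A * C - B ^+ 2) by ring.
by rewrite pmulr_rge0// subr_ge0.
Qed.

Lemma enormD x y : enorm (x + y) <= enorm x + enorm y.
Proof.
rewrite enorm_le ?addr_ge0 ?enorm_ge0// !dotE (dotC y x) sqrrD !sqr_enorm.
by have := dot_le x y; lra.
Qed.

Lemma enormB x y : enorm (x - y) <= enorm x + enorm y.
Proof. by rewrite -[enorm y]enormN enormD. Qed.

Lemma coord_le_enorm x i : `|x ord0 i| <= enorm x.
Proof.
rewrite -ler_sqr ?nnegrE ?enorm_ge0// sqr_enorm real_normK ?num_real//.
rewrite /dot (bigD1 i)//= -expr2 lerDl.
by apply: sumr_ge0 => j _; rewrite -expr2 sqr_ge0.
Qed.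

Lemma coord_le_norm x i : `|x ord0 i| <= `|x|.
Proof.
rewrite [leRHS]/Num.norm/= mx_normrE; apply/bigmax_geP; right.
by exists (ord0, i).
Qed.

Lemma norm_le_coord x a : 0 <= a -> (forall i, `|x ord0 i| <= a) -> `|x| <= a.
Proof.
move=> a0 xa; rewrite [leLHS]/Num.norm/= mx_normrE; apply/bigmax_leP; split => //.
by move=> [i j] _ /=; rewrite ord1.
Qed.

Lemma norm_le_enorm x : `|x| <= enorm x.
Proof. by apply: norm_le_coord; [exact: enorm_ge0|move=> i; exact: coord_le_enorm]. Qed.

Lemma enorm_le_coord x a : 0 <= a -> (forall i, `|x ord0 i| <= a) ->
  enorm x <= m%:R * a.
Proof.
move=> a0 xa; rewrite enorm_le ?mulr_ge0//.
rewrite /dot; apply: (@le_trans _ _ (\sum_(i < m) a ^+ 2)).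
  apply: ler_sum => i _; rewrite -expr2 -[leLHS]real_normK ?num_real//.
  by rewrite ler_sqr ?nnegrE.
rewrite sumr_const card_ord -[leLHS]mulr_natl exprMn ler_wpM2r ?sqr_ge0//.
by rewrite -natrX ler_nat; case: (m) => // k; rewrite expnS leq_pmulr// expn_gt0.
Qed.

Lemma enorm_le_norm x : enorm x <= m%:R * `|x|.
Proof. by apply: enorm_le_coord => // i; exact: coord_le_norm. Qed.

Lemma norm_coordP x : (0 < m)%N -> exists i, `|x| = `|x ord0 i|.
Proof.
move=> m0; have [x0|x0] := eqVneq `|x| 0.
  exists (Ordinal m0); apply/eqP; rewrite eq_le coord_le_norm andbT x0.
  exact: normr_ge0.
have /mx_norm_neq0[[i j] /= xij] : mx_norm x != 0 by exact: x0.
by exists j; rewrite [LHS]xij ord1.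
Qed.

Lemma dot_orth (M : 'M[R]_m) x y : M *m M^T = 1%:M ->
  dot (x *m M) (y *m M) = dot x y.
Proof.
by move=> M1; rewrite !dot_mul trmx_mul -mulmxA (mulmxA M) M1 mul1mx.
Qed.

Lemma enorm_orth (M : 'M[R]_m) x : M *m M^T = 1%:M -> enorm (x *m M) = enorm x.
Proof. by move=> M1; rewrite !enormE dot_orth. Qed.

Lemma coord_round (j : nat) (t : R) : (0 < j)%N ->
  `|t - (Num.floor (t * j%:R))%:~R / j%:R| <= j%:R^-1.
Proof.
move=> j0; have j1 : 0 < j%:R :> R by rewrite ltr0n.
have /andP[] := floor_itv (t * j%:R); rewrite intrD.
set f := (Num.floor _)%:~R => h1 h2.
have -> : t - f / j%:R = (t * j%:R - f) / j%:R by field; rewrite gt_eqF.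
rewrite normrM [X in _ * X]gtr0_norm ?invr_gt0// ler_piMl ?invr_ge0 ?ltW//.
by rewrite ger0_norm; lra.
Qed.

End euclid.

Ltac vring := apply/rowP => ?; rewrite !mxE; ring.

Lemma dot_continuous (R : realType) (m : nat) (T : topologicalType)
    (f g : T -> 'rV[R]_m) :
  continuous f -> continuous g -> continuous (fun t => dot (f t) (g t)).
Proof.
move=> cf cg; suff H : forall s : seq 'I_m,
    continuous (fun t => \sum_(i <- s) f t ord0 i * g t ord0 i).
  by move=> t; exact: H.
elim=> [|i s IH] t.
  by under eq_fun do rewrite big_nil; exact: cvg_cst.
under eq_fun do rewrite big_cons.
apply: cvgD; last exact: IH.
apply: cvgM.
  by apply: (@continuous_comp _ _ _ f (fun v : 'rV_m => v ord0 i)); [exact: cf|exact: coord_continuous].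
by apply: (@continuous_comp _ _ _ g (fun v : 'rV_m => v ord0 i)); [exact: cg|exact: coord_continuous].
Qed.

Lemma continuousMfun (R : realType) (T : topologicalType) (f g : T -> R) :
  continuous f -> continuous g -> continuous (fun t => f t * g t).
Proof. by move=> cf cg t; apply: cvgM; [exact: cf|exact: cg]. Qed.

Lemma continuousBfun (R : realType) (T : topologicalType) (V : normedModType R)
    (f g : T -> V) :
  continuous f -> continuous g -> continuous (fun t => f t - g t).
Proof. by move=> cf cg t; apply: cvgB; [exact: cf|exact: cg]. Qed.

Lemma dot0r (R : realType) (m : nat) (x : 'rV[R]_m) : dot x 0 = 0.
Proof. by rewrite -(scale0r 0) dotZr mul0r. Qed.

Section lines.
Variables (R : realType) (n : nat).
Local Notation V := 'rV[R]_n.+1.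
Local Notation lines := (line R n).
Implicit Types (L : lines) (p v x y z : V) (r : R).

Definition hit z r : set lines :=
  [set L | exists2 x, line_set L x & enorm (x - z) <= r].

Definition hito z r : set lines :=
  [set L | exists2 x, line_set L x & enorm (x - z) < r].

Definition mkline p v (v0 : v != 0) : lines :=
  Line (ex_intro _ p (ex_intro _ v (conj v0 erefl))).

(** The squared distance from [z] to the line, multiplied by [dot v v]: a Gram determinant,
    continuous in [(p, v)] also at [v = 0]. *)
Definition disc p v z : R :=
  dot (z - p) (z - p) * dot v v - dot (z - p) v ^+ 2.

(** Completes the square in [t]; the second term vanishes at the foot of the perpendicular. *)
Lemma discE p v z t : dot (p + t *: v - z) (p + t *: v - z) * dot v v =
  disc p v z + (t * dot v v - dot (z - p) v) ^+ 2.
Proof.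
rewrite /disc (_ : p + t *: v - z = t *: v - (z - p)); last by vring.
move: (z - p) => w; rewrite !dotE (dotC v w); ring.
Qed.

Lemma line_through_dir L : exists2 v, v != 0 &
  forall p, line_set L p -> line_set L = line_through p v.
Proof.
have [q [v [v0 Lqv]]] := line_setP L; exists v => // p.
rewrite Lqv => -[s _ <-]; apply/seteqP; split => x /= [t _ <-].
  by exists (t - s) => //; vring.
by exists (s + t) => //; rewrite scalerDl addrA.
Qed.

Lemma line_in_through p v L : line_set L = line_through p v -> line_set L p.
Proof. by move=> ->; exists 0 => //; rewrite scale0r addr0. Qed.

Lemma line_nonempty L : exists p, line_set L p.
Proof. by have [p [v [_ /line_in_through]]] := line_setP L; exists p. Qed.

Lemma line_affine L x y t : line_set L x -> line_set L y ->
  line_set L (x + t *: (y - x)).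
Proof.
have [v _ Lv] := line_through_dir L => Lx.
rewrite (Lv _ Lx) => -[s _ <-]; exists (t * s) => //.
by rewrite addrAC subrr add0r scalerA.
Qed.

Lemma line_two L x y z : line_set L x -> line_set L y -> line_set L z ->
  y != x -> exists t, z = x + t *: (y - x).
Proof.
have [v v0 Lv] := line_through_dir L => Lx; rewrite (Lv _ Lx).
move=> -[s _ <-] [t _ <-]; have [->|s0] := eqVneq s 0.
  by rewrite scale0r addr0 eqxx.
move=> _; exists (t / s).
by rewrite addrAC subrr add0r scalerA -mulrA mulVf ?mulr1.
Qed.

Lemma hit_disc L p v z r : 0 <= r -> v != 0 -> line_set L = line_through p v ->
  hit z r L <-> disc p v z <= r ^+ 2 * dot v v.
Proof.
move=> r0 v0 Lpv; have d0 := dot_gt0 v0; split.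
  rewrite /hit/= Lpv => -[_ [t _ <-]]; rewrite enorm_le// -(ler_pM2r d0) discE.
  by apply: le_trans; rewrite lerDl sqr_ge0.
move=> h; pose t := dot (z - p) v / dot v v.
exists (p + t *: v); first by rewrite Lpv; exists t.
rewrite enorm_le// -(ler_pM2r d0) discE.
by rewrite /t mulfVK ?gt_eqF// subrr expr0n/= addr0.
Qed.

Lemma hito_disc L p v z r : 0 <= r -> v != 0 -> line_set L = line_through p v ->
  hito z r L <-> disc p v z < r ^+ 2 * dot v v.
Proof.
move=> r0 v0 Lpv; have d0 := dot_gt0 v0; split.
  rewrite /hito/= Lpv => -[_ [t _ <-]]; rewrite enorm_lt// -(ltr_pM2r d0) discE.
  by apply: le_lt_trans; rewrite lerDl sqr_ge0.
move=> h; pose t := dot (z - p) v / dot v v.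
exists (p + t *: v); first by rewrite Lpv; exists t.
rewrite enorm_lt// -(ltr_pM2r d0) discE.
by rewrite /t mulfVK ?gt_eqF// subrr expr0n/= addr0.
Qed.

Lemma fst_continuous : continuous (fst : V * V -> V).
Proof. by move=> x; exact: cvg_fst. Qed.

Lemma snd_continuous : continuous (snd : V * V -> V).
Proof. by move=> x; exact: cvg_snd. Qed.

Lemma dot2_continuous : continuous (fun pv : V * V => dot pv.2 pv.2).
Proof. apply: dot_continuous; exact: snd_continuous. Qed.

Lemma disc_continuous z : continuous (fun pv : V * V => disc pv.1 pv.2 z).
Proof.
have c1 : continuous (fun pv : V * V => z - pv.1).
  by move=> x; apply: cvgB; [exact: cvg_cst|exact: fst_continuous].
have c2 := snd_continuous.
by apply: continuousBfun; apply: continuousMfun; exact: dot_continuous.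
Qed.

Lemma hito_open z r : 0 <= r -> open (hito z r).
Proof.
move=> r0; change (line_open (hito z r)); rewrite /line_open.
(* At [v = 0] both terms of the difference vanish, so the strict inequality excludes degenerate
   pairs by itself. *)
have -> : [set pv : V * V | pv.2 != 0 /\ exists2 L : lines, hito z r L &
    line_set L = line_through pv.1 pv.2] =
  (fun pv => r ^+ 2 * dot pv.2 pv.2 - disc pv.1 pv.2 z) @^-1` [set x | 0 < x].
  apply/seteqP; split => -[p v] /=.
    by move=> [v0 [L + Lpv]]; rewrite subr_gt0 => /(hito_disc z r0 v0 Lpv).
  rewrite subr_gt0; have [->|v0 h] := eqVneq v 0.
    by rewrite /disc !dot0r !mulr0 expr0n/= subrr ltxx.
  by split => //; exists (mkline p v0) => //; exact/(hito_disc z r0 v0).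
apply: open_comp => // x _; apply: cvgB; last exact: disc_continuous.
by apply: cvgM; [exact: cvg_cst|exact: dot2_continuous].
Qed.

Lemma hitC_open z r : 0 <= r -> open (~` hit z r).
Proof.
move=> r0; change (line_open (~` hit z r)); rewrite /line_open.
have -> : [set pv : V * V | pv.2 != 0 /\ exists2 L : lines, (~` hit z r) L &
    line_set L = line_through pv.1 pv.2] =
  (fun pv => disc pv.1 pv.2 z - r ^+ 2 * dot pv.2 pv.2) @^-1` [set x | 0 < x].
  apply/seteqP; split => -[p v] /=.
    move=> [v0 [L + Lpv]]; rewrite subr_gt0 ltNge => nh.
    by apply/negP => /(hit_disc z r0 v0 Lpv).
  rewrite subr_gt0; have [->|v0 h] := eqVneq v 0.
    by rewrite /disc !dot0r !mulr0 expr0n/= subrr ltxx.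
  split => //; exists (mkline p v0) => //.
  have e : line_set (mkline p v0) = line_through p v by [].
  by move/(hit_disc z r0 v0 e); apply/negP; rewrite -ltNge.
apply: open_comp => // x _; apply: cvgB; first exact: disc_continuous.
by apply: cvgM; [exact: cvg_cst|exact: dot2_continuous].
Qed.

Lemma hit_measurable z r : 0 <= r -> measurable (hit z r).
Proof.
by move=> r0; rewrite -[X in measurable X]setCK; apply: measurableC;
apply: sub_sigma_algebra; exact: hitC_open.
Qed.

Lemma hito_sub z r : hito z r `<=` hit z r.
Proof. by move=> L [x Lx /ltW]; exists x. Qed.

Lemma hit_le z r s : r <= s -> hit z r `<=` hit z s.
Proof. by move=> rs L [x Lx h]; exists x => //; exact: le_trans rs. Qed.

(** A line contained in another one equals it, since two points determine a line; hence some point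
    of [L] is off [L'], and half its distance to [L'] serves as radius. *)
Lemma line_separate L L' : L <> L' ->
  exists x r, [/\ 0 < r, line_set L x & ~ hit x r L'].
Proof.
move=> LL'; have [x Lx L'x] : exists2 x, line_set L x & ~ line_set L' x.
  apply: contrapT => H; apply: LL'; apply: line_set_inj.
  have sub x : line_set L x -> line_set L' x.
    by move=> Lx; apply: contrapT => L'x; apply: H; exists x.
  have [v v0 Lv] := line_through_dir L; have [p Lp] := line_nonempty L.
  have [v' v'0 Lv'] := line_through_dir L'.
  have Lp' : line_set L (p + v) by rewrite (Lv _ Lp); exists 1; rewrite ?scale1r.
  apply/seteqP; split => // x L'x.
  have pv : p + v != p by rewrite -subr_eq0 addrAC subrr add0r.
  have [t ->] := line_two (sub _ Lp) (sub _ Lp') L'x pv.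
  exact: line_affine.
have [p [v [v0 Lpv]]] := line_setP L'.
have d0 : 0 < disc p v x.
  rewrite ltNge; apply/negP => h; apply: L'x.
  have : hit x 0 L' by apply/(hit_disc x (lexx 0) v0 Lpv); rewrite expr0n mul0r.
  move=> [y L'y]; rewrite le_eqVlt ltNge enorm_ge0 orbF enormE sqrtr_eq0.
  rewrite le_eqVlt ltNge dot_ge0 orbF dot_eq0 subr_eq0 => /eqP <-; exact: L'y.
have dv := dot_gt0 v0.
pose q := disc p v x / dot v v.
have q0 : 0 < q by rewrite divr_gt0.
exists x, (Num.sqrt q / 2); have s0 : 0 < Num.sqrt q by rewrite sqrtr_gt0.
split => //; first by rewrite divr_gt0.
move/(hit_disc x _ v0 Lpv) => /(_ (divr_ge0 (ltW s0) (ler0n _ _))).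
rewrite expr_div_n sqr_sqrtr ?(ltW q0)//.
have -> : q / 2 ^+ 2 * dot v v = disc p v x / 4.
  by rewrite /q; field; rewrite gt_eqF.
by lra.
Qed.

(** The infimum in [edist_set] is attained at the foot of the perpendicular. *)
Lemma cylinderE L : cylinder L = [set x | hit x 1 L].
Proof.
have [p [v [v0 Lpv]]] := line_setP L.
apply/seteqP; split => x; rewrite /cylinder/edist_set/=.
  have [y Ly ymin] : exists2 y, line_set L y &
      forall y', line_set L y' -> enorm (x - y) <= enorm (x - y').
    have dv := dot_gt0 v0.
    exists (p + (dot (x - p) v / dot v v) *: v).
      by rewrite Lpv; exists (dot (x - p) v / dot v v).
    rewrite Lpv => _ [t _ <-]; rewrite enorm_distC [leRHS]enorm_distC.
    rewrite [leLHS]enormE [leRHS]enormE ler_wsqrtr// -(ler_pM2r dv) !discE.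
    by rewrite mulfVK ?gt_eqF// subrr expr0n/= addr0 lerDl sqr_ge0.
  move=> h; exists y => //; rewrite enorm_distC; apply: le_trans h.
  apply: lb_le_inf; first by exists (enorm (x - y)), y.
  by move=> _ [y' Ly' <-]; exact: ymin.
move=> [y Ly xy]; apply: le_trans xy; rewrite enorm_distC.
apply: ge_inf; last by exists y.
by exists 0 => _ [y' _ <-]; exact: enorm_ge0.
Qed.

Lemma hit_closed r L : 0 <= r -> closed [set x : V | hit x r L].
Proof.
move=> r0; have [p [v [v0 Lpv]]] := line_setP L.
have -> : [set x | hit x r L] =
    (fun x => disc p v x - r ^+ 2 * dot v v) @^-1` [set x | x <= 0].
  apply/seteqP; split => x /=; rewrite subr_le0.
    by move/(hit_disc x r0 v0 Lpv).
  by move=> h; apply/(hit_disc x r0 v0 Lpv).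
apply: closed_comp => [x _|]; last exact: closed_le.
have c1 : continuous (fun x : V => x - p).
  apply: (@continuousBfun _ _ _ (fun x : V => x) (fun _ => p)).
    by move=> y; apply: cvg_id.
  exact: cst_continuous.
have c2 : continuous (fun x : V => v) by exact: cst_continuous.
apply: continuousBfun; last exact: cst_continuous.
by apply: continuousBfun; apply: continuousMfun; exact: dot_continuous.
Qed.

Lemma cylinder_closed L : closed (cylinder L).
Proof. by rewrite cylinderE; exact: hit_closed. Qed.

Lemma hit_segment L x y r t : 0 <= t <= 1 -> hit x r L -> hit y r L ->
  hit (x + t *: (y - x)) r L.
Proof.
move=> /andP[t0 t1] [a La ax] [b Lb bY]; exists (a + t *: (b - a)).
  exact: line_affine.
have -> : a + t *: (b - a) - (x + t *: (y - x)) =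
  (1 - t) *: (a - x) + t *: (b - y) by vring.
apply: le_trans (enormD _ _) _; rewrite !enormZ (ger0_norm t0) ger0_norm ?subr_ge0//.
have := ler_wpM2l t0 bY; have : (1 - t) * enorm (a - x) <= (1 - t) * r.
  by rewrite ler_wpM2l// subr_ge0.
lra.
Qed.

(** Star-shaped around a point of the axis, by convexity. *)
Lemma cylinder_connected L : connected (cylinder L).
Proof.
have [p Lp] := line_nonempty L.
have hp : hit p 1 L by exists p => //; rewrite subrr enorm0.
have -> : cylinder L = \bigcup_(y in cylinder L)
    ((fun t : R => p + t *: (y - p)) @` `[0, 1]).
  apply/seteqP; split => [y hy|z [y + [t +] <-]].
    exists y => //; exists 1; first by rewrite /= in_itv/= ler01 lexx.
    by rewrite scale1r addrC subrK.
  rewrite cylinderE/= in_itv/= => hy t01.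
  exact: hit_segment.
apply: bigcup_connected.
  exists p => y _; exists 0; first by rewrite /= in_itv/= ler01 lexx.
  by rewrite scale0r addr0.
move=> y _; apply: connected_continuous_connected.
  by apply/connected_intervalP; exact: interval_is_interval.
apply: continuous_subspaceT => t.
apply: cvgD; first exact: cvg_cst.
by apply: cvgZr_tmp; exact: cvg_id.
Qed.

End lines.

(** * Chains of lines *)

Section touching.
Variables (R : realType) (n : nat).
Local Notation V := 'rV[R]_n.+1.
Local Notation lines := (line R n).
Implicit Types (S : set lines) (L : lines) (k : nat).

Definition touch L L' : Prop := exists z, hit z 1 L /\ hit z 1 L'.

Lemma touch_refl L : touch L L.
Proof.
have [p Lp] := line_nonempty L; exists p; split; exists p => //;
by rewrite subrr enorm0.
Qed.

Lemma touch_cylinder L L' : touch L L' <-> cylinder L `&` cylinder L' !=set0.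
Proof. by rewrite !cylinderE; split. Qed.

(* [k] is the number of intermediate lines, as in [Cdist]. *)
Fixpoint reach S k L L' : Prop :=
  if k is k'.+1 then exists L'', [/\ S L'', reach S k' L L'' & touch L'' L']
  else touch L L'.

Lemma reachS S k L L' : S L' -> reach S k L L' -> reach S k.+1 L L'.
Proof. by move=> SL' h; exists L'; split => //; exact: touch_refl. Qed.

Lemma reach_le S k k' L L' : (k <= k')%N -> S L' -> reach S k L L' ->
  reach S k' L L'.
Proof.
move=> /subnK <- SL' h; elim: (k' - k)%N => //= j IH.
exact: reachS.
Qed.

Definition all_reach S k : Prop :=
  forall L L', S L -> S L' -> reach S k L L'.

Lemma reach_connected S k L L' : reach S k L L' ->
  exists2 c : 'I_k -> lines, (forall i, S (c i)) &
  connected (cylinder L `|` cylinder L' `|` \bigcup_(i in [set: 'I_k]) cylinder (c i)).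
Proof.
elim: k L' => [|k IH] L'.
  move=> /touch_cylinder LL'; exists (fun i : 'I_0 => L); first by case.
  rewrite (_ : \bigcup_(i in _) _ = set0) ?setU0; last first.
    by rewrite -subset0 => x [[]].
  by apply: connectedU => //; exact: cylinder_connected.
move=> [L'' [SL'' /IH [c Sc cc] /touch_cylinder LL'']].
exists (fun i : 'I_k.+1 => if unlift ord_max i is Some j then c j else L'').
  by move=> i; case: (unlift ord_max i).
have -> : cylinder L `|` cylinder L' `|` \bigcup_(i in [set: 'I_k.+1])
      cylinder (if unlift ord_max i is Some j then c j else L'') =
    (cylinder L `|` cylinder L'' `|` \bigcup_(i in [set: 'I_k]) cylinder (c i)) `|`
    cylinder L'.
  apply/seteqP; split => x.
    move=> [[|]|[i _]]; [by left; left; left|by right|].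
    case: unliftP => [j _|_]; first by move=> ?; left; right; exists j.
    by left; left; right.
  move=> [[[|]|[j _]]|]; [by left; left| | |by left; right].
    by move=> ?; right; exists ord_max => //; rewrite unlift_none.
  by move=> ?; right; exists (lift ord_max j) => //; rewrite liftK.
apply: connectedU => //; last exact: cylinder_connected.
by case: LL'' => x [? ?]; exists x; split => //; left; right.
Qed.

(** The last element of [p] is the end of the chain, not an intermediate line, hence the
    predecessor. *)
Lemma path_reach S (L : lines) (p : seq lines) : (forall L', L' \in p -> S L') ->
  path (fun L L' => `[< touch L L' >]) L p -> reach S (size p).-1 L (last L p).
Proof.
elim/last_ind: p => [_ _|p L' IH Sp]; first exact: touch_refl.
rewrite rcons_path last_rcons size_rcons => /andP[pp /asboolP LL'] /=.
have {}IH : reach S (size p).-1 L (last L p).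
  by apply: IH => // M MP; apply: Sp; rewrite mem_rcons inE MP orbT.
case: p => [|L1 p] in IH Sp pp LL' *; first exact: LL'.
exists (last L (L1 :: p)); split => //.
by apply: Sp; rewrite mem_rcons [last _ _]/= inE (mem_last L1 p) orbT.
Qed.

(** The cylinders in the component of [a] in the contact graph and the remaining ones have closed
    disjoint unions, so connectedness leaves a single component. A simple path from [a] to [b]
    visits at most [#|I|] indices, two of which are its ends. *)
Lemma connected_reach S (I : finType) (g : I -> lines) (a b : I) :
  (forall i, S (g i)) -> connected (\bigcup_(i in [set: I]) cylinder (g i)) ->
  reach S (#|I| - 2) (g a) (g b).
Proof.
move=> Sg cg; pose e : rel I := fun i j => `[< touch (g i) (g j) >].
have ecl (Q : pred I) : closed (\bigcup_(i in [set i | Q i]) cylinder (g i)).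
  apply: closed_bigcup => [|i _]; last exact: cylinder_closed.
  exact: finite_finset.
have /connectP[p ep bp] : connect e a b.
  pose A := \bigcup_(i in [set i | connect e a i]) cylinder (g i).
  pose B := \bigcup_(i in [set i | ~~ connect e a i]) cylinder (g i).
  have AB : A `&` B = set0.
    rewrite -subset0 => x [[i /= ai xi] [j /= /negP aj xj]]; apply: aj.
    apply: connect_trans ai (connect1 _); apply/asboolP/touch_cylinder.
    by exists x.
  have UAB : \bigcup_(i in [set: I]) cylinder (g i) = A `|` B.
    apply/seteqP; split => [x [i _ xi]|x [[i _ xi]|[i _ xi]]]; [|by exists i|by exists i].
    by case: (boolP (connect e a i)) => ai; [left|right]; exists i.
  have ne i : exists x, cylinder (g i) x.
    by have [p Lp] := line_nonempty (g i); exists p; rewrite cylinderE /=; exists p;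
      rewrite ?subrr ?enorm0.
  have AE : A = \bigcup_(i in [set: I]) cylinder (g i).
    apply: cg.
    - by have [x xa] := ne a; exists x, a => //=.
    - exists (~` B); first exact/closed_openC/ecl.
      rewrite UAB setIUl setICr setU0; apply/esym/setIidPl.
      by apply/disjoints_subset.
    - exists A; first exact: ecl.
      by rewrite UAB setIUl setIid (setIC B) AB setU0.
  have [x xb] := ne b.
  have [i /= ai xi] : A x by rewrite AE; exists b.
  apply: connect_trans ai (connect1 _); apply/asboolP/touch_cylinder.
  by exists x.
move: ep bp => /shortenP[p' ep' up' _ ->].
have sp' : (size p' <= #|I|.-1)%N.
  by have := uniq_leq_size up' (fun x _ => mem_enum I x); rewrite -cardE /=; case: #|I|.
have : reach S (size p').-1 (g a) (last (g a) (map g p')).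
  rewrite -(size_map g); apply: path_reach; last by rewrite path_map.
  by move=> _ /mapP[i _ ->].
rewrite last_map; apply: reach_le => //.
by rewrite -subn1 -subn1 in sp' *; rewrite -(addn1 1) subnDA leq_sub2r.
Qed.

End touching.

(** * Support, cylinder distance and diameter of a point measure *)

Section point_measures.
Variables (R : realType) (n : nat) (m : {measure set (line R n) -> \bar R}).
Local Notation V := 'rV[R]_n.+1.
Local Notation lines := (line R n).
Hypothesis mpt : is_point_measure m.
Local Open Scope ereal_scope.

Lemma hitting_ball (z : V) (r : R) :
  hit z r = hitting [set x | (enorm (x - z) <= r)%R].
Proof. by apply/seteqP; split => L [x]; [exists x|case; exists x]. Qed.

Lemma ball_compact (z : V) (r : R) : compact [set x : V | (enorm (x - z) <= r)%R].
Proof.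
apply: bounded_closed_compact.
  exists (r + `|z|)%R; split; first exact: num_real.
  move=> M rM x /= xz; apply: le_trans (ltW rM); rewrite -lerBlDr.
  by apply: le_trans xz; apply: le_trans (norm_le_enorm _); rewrite lerB_normD// || exact: lerB_dist.
have [r0|r0] := leP 0%R r; last first.
  rewrite (_ : [set _ | _] = set0); first exact: closed0.
  by rewrite -subset0 => x /= /le_lt_trans/(_ r0); rewrite ltNge enorm_ge0.
have -> : [set x : V | (enorm (x - z) <= r)%R] =
  (fun x : V => dot (x - z) (x - z)) @^-1` [set y | (y <= r ^+ 2)%R].
  by apply/seteqP; split => x /=; rewrite enorm_le.
apply: closed_comp => [x _|]; last exact: closed_le.
apply: dot_continuous; apply: (@continuousBfun _ _ _ (fun x : V => x) (fun _ => z)).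
all: try exact: cst_continuous.
all: by move=> y; apply: cvg_id.
Qed.

Lemma open_avoid (s : seq lines) (L : lines) (H : set lines) :
  open H -> H L -> L \notin s ->
  exists U, [/\ open U, U L, U `<=` H & forall L', L' \in s -> ~ U L'].
Proof.
move=> oH HL; elim: s => [|L' s IH].
  by move=> _; exists H; split.
rewrite inE negb_or => /andP[/eqP LL' /IH [U [oU UL UH Us]]].
have [x [r [r0 Lx nL']]] := line_separate LL'.
exists (U `&` hito x r); split.
- by apply: openI => //; exact/hito_open/ltW.
- by split => //; exists x => //; rewrite subrr enorm0.
- by move=> M [/UH].
- move=> M; rewrite inE => /orP[/eqP ->|/Us nU] []; last by move=> /nU.
  by move=> _ /hito_sub.
Qed.

Lemma esum_ge_term (I : set nat) (a : nat -> \bar R) (i : nat) : I i ->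
  a i <= \esum_(j in I) a j.
Proof.
move=> Ii; apply: esum_ge; exists [set i]; first by split => // _ ->.
by rewrite fsbig_set1.
Qed.

(** Infinitely many atoms meeting a ball would give infinite measure to the lines that hit a compact
    set. *)
Lemma atoms_finite (I : set nat) (Ls : nat -> lines) (z : V) (r : R) :
  (0 <= r)%R ->
  (forall A : set lines, measurable A -> m A = \esum_(i in I) \d_(Ls i) A) ->
  finite_set [set i | I i /\ hit z r (Ls i)].
Proof.
move=> r0 mE; have [_ mK] := mpt.
apply: contrapT => /infinite_set_fset inf.
have := mK _ (@ball_compact z r); rewrite -hitting_ball.
have Hm : measurable (hit z r : set lines) by exact: hit_measurable.
suff -> : m (hit z r) = +oo by [].
apply/eqyP => M M0; have [J JI Jr] := inf (Num.trunc M).+1.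
rewrite mE//; apply: esum_ge; exists [set` J].
  by split => // i /JI [].
rewrite fsbig_finite//= set_fsetK (eq_big_seq (fun=> (1%R)%:E)); last first.
  by move=> i iJ; have [_ hi] := JI _ iJ; rewrite diracE mem_set.
rewrite sumEFin lee_fin big_const_seq count_predT iter_addr_0.
apply: le_trans (ltW (truncnS_gt M)) _.
by rewrite ler_nat.
Qed.

(** Only finitely many atoms come near [L]; if [L] is not among them, a neighbourhood of [L] avoids
    them all and has measure 0. *)
Lemma support_atoms : exists (I : set nat) (Ls : nat -> lines),
  (forall A : set lines, measurable A -> m A = \esum_(i in I) \d_(Ls i) A) /\
  forall L : lines, support m L <-> exists2 i, I i & Ls i = L.
Proof.
have [[I [Ls mE]] _] := mpt; exists I, Ls; split => // L; split; last first.
  move=> [i Ii <-] U oU UL; rewrite mE; last exact: sub_sigma_algebra.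
  apply: lt_le_trans (esum_ge_term (fun i => \d_(Ls i) U) Ii).
  by rewrite diracE mem_set// lte_fin.
move=> Ls_supp; apply: contrapT => nL.
have [p Lp] := line_nonempty L.
have fin := atoms_finite p ler01 mE.
have [s sE] : exists s : seq nat, [set i | I i /\ hit p 1 (Ls i)] = [set` s].
  exact/finite_seqP.
have Ls_s : L \notin map Ls s.
  apply/negP => /mapP[i si Li]; apply: nL; exists i => //.
  by have : [set` s] i by []; rewrite -sE => -[].
have Hp : hito p 1 L by exists p; rewrite // subrr enorm0.
have [U [oU UL UH Us]] := open_avoid (@hito_open _ _ p 1%R ler01) Hp Ls_s.
have := Ls_supp _ oU UL; rewrite mE; last exact: sub_sigma_algebra.
rewrite esum1 ?ltxx// => i Ii; rewrite diracE memNset// => Ui.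
have : [set` s] i by rewrite -sE; split => //; exact/hito_sub/UH.
by move=> si; apply: (Us (Ls i)) => //; exact: map_f.
Qed.

Lemma pm_gt0P (A : set lines) : measurable A ->
  0 < m A <-> exists2 L, support m L & A L.
Proof.
have [I [Ls [mE sE]]] := support_atoms => mA; rewrite mE//; split.
  move=> h; apply: contrapT => nh; move: h; rewrite esum1 ?ltxx// => i Ii.
  rewrite diracE memNset// => AL; apply: nh; exists (Ls i) => //.
  by apply/sE; exists i.
move=> [L /sE [i Ii <-] AL].
apply: lt_le_trans (esum_ge_term (fun i => \d_(Ls i) A) Ii).
by rewrite diracE mem_set// lte_fin.
Qed.

Lemma support_hit_finite (z : V) (r : R) : (0 <= r)%R ->
  finite_set (support m `&` hit z r).
Proof.
move=> r0; have [I [Ls [mE sE]]] := support_atoms.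
apply: sub_finite_set (finite_image Ls (atoms_finite z r0 mE)).
by move=> L [/sE[i Ii <-] h]; exists i.
Qed.

Lemma CdistP (k : nat) (L L' : lines) : support m L -> support m L' ->
  Cdist m (cylinder L) (cylinder L') <= k%:R%:E <-> reach (support m) k L L'.
Proof.
move=> SL SL'; split; last first.
  move=> /reach_connected[c Sc cc]; apply: ge_ereal_inf.
  exists k%:R%:E => //; exists k => //; exists (fun i => cylinder (c i)); split => //.
  by move=> i; exists (c i).
(* Comparing strictly with [k + 1] yields a witness [j <= k] without discussing whether the infimum
   is attained. *)
move=> h; have : Cdist m (cylinder L) (cylinder L') < k.+1%:R%:E.
  by apply: le_lt_trans h _; rewrite lte_fin ltr_nat.
move=> /ereal_inf_lt[_ [j [c [cS cc]] <-]]; rewrite lte_fin ltr_nat ltnS => jk.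
have /choice[g gP] : forall i, exists L, support m L /\ cylinder L = c i.
  by move=> i; have [M SM ME] := cS i; exists M.
(* The two ends are [None] and [Some None]; the index type has [j + 2] elements, which
   [connected_reach] turns into [j] intermediate lines. *)
pose g' (o : option (option 'I_j)) : lines :=
  match o with None => L | Some None => L' | Some (Some i) => g i end.
have := @connected_reach _ _ (support m) _ g' None (Some None).
rewrite !card_option card_ord !subSS subn0 /= => H.
apply: (reach_le jk) => //; apply: H.
  by case=> [[i|]|] //=; case: (gP i).
move: cc; congr connected; apply/seteqP; split => x.
  move=> [[xL|xL]|[i _ xi]]; [by exists None|by exists (Some None)|].
  by exists (Some (Some i)) => //=; have [_ ->] := gP i.
move=> [[[i|]|] _ /= xi]; [right; exists i => //|by left; right|by left; left].
by have [_ <-] := gP i.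
Qed.

Lemma cylinder_diam_le (k : nat) :
  cylinder_diam m <= k%:R%:E <-> all_reach (support m) k.
Proof.
split => [h L L' SL SL'|h].
  apply/CdistP => //; apply: le_trans h; apply: ereal_sup_ubound.
  by exists (cylinder L, cylinder L') => //; split => /=; [exists L|exists L'].
apply: ge_ereal_sup => _ [[c c'] /= [[L SL <-] [L' SL' <-]] <-].
by apply/CdistP => //; exact: h.
Qed.

Lemma cylinder_diam_eq (k : nat) : cylinder_diam m = k.+1%:R%:E <->
  all_reach (support m) k.+1 /\ ~ all_reach (support m) k.
Proof.
split => [h|[/cylinder_diam_le h1 h2]].
  split; first by apply/cylinder_diam_le; rewrite h.
  by move=> /cylinder_diam_le; rewrite h lee_fin ler_nat ltnn.
apply/eqP; rewrite eq_le h1/=.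
have /existsNP[L /existsNP[L' /not_implyP[SL /not_implyP[SL' nr]]]] := h2.
apply: (@le_trans _ _ (Cdist m (cylinder L) (cylinder L'))); last first.
  apply: ereal_sup_ubound; exists (cylinder L, cylinder L') => //.
  by split => /=; [exists L|exists L'].
apply: le_ereal_inf_tmp => _ [j hj <-]; rewrite lee_fin ler_nat leqNgt ltnS.
apply/negP => jk; apply: nr; apply: (reach_le jk) => //; apply/CdistP => //.
by apply: ereal_inf_lbound; exists j.
Qed.

End point_measures.

Lemma measure_mono d (T : measurableType d) (R : realType)
    (m : {measure set T -> \bar R}) (A B : set T) :
  measurable A -> measurable B -> A `<=` B -> (m A <= m B)%E.
Proof. by move=> mA mB AB; apply: le_measure => //; exact: mem_set. Qed.

(** * The invariant measure on lines *)

Section ball_volume.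
Variable R : realType.
Local Open Scope ereal_scope.

(** Compares the suprema over simple functions below [f] and [g], because the inner integrals of
    [integral_rV] come without a proof of measurability. *)
Lemma le_integralT (f g : R -> \bar R) : (forall t, 0 <= f t) ->
  (forall t, f t <= g t) ->
  \int[@lebesgue_measure R]_(t in [set: R]) f t <=
  \int[@lebesgue_measure R]_(t in [set: R]) g t.
Proof.
move=> f0 fg; have g0 t : 0 <= g t by exact: le_trans (fg t).
rewrite !ge0_integralTE//; apply: ereal_sup_le => _ [h hf <-].
by exists h => // t; exact: le_trans (fg t).
Qed.

Lemma integral_rV_ge0 (m : nat) (f : 'rV[R]_m -> \bar R) : (forall x, 0 <= f x) ->
  0 <= integral_rV f.
Proof.
elim: m f => [|m IH] f f0 /=; first exact: f0.
by apply: integral_ge0 => t _; apply: IH => v.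
Qed.

Lemma integral_rV0 (m : nat) : integral_rV (cst 0 : 'rV[R]_m -> \bar R) = 0.
Proof.
elim: m => //= m IH; under eq_integral do rewrite [X in integral_rV X](_ : _ = cst 0)// IH.
by rewrite integral0.
Qed.

Lemma integral_centered (c a : R) : (0 <= a)%R -> (0 <= c)%R ->
  \int[@lebesgue_measure R]_(t in [set: R]) (c%:E * (\1_(`[(- a)%R, a]%classic : set R) t)%:E) =
  (c * (2 * a))%:E.
Proof.
move=> a0 c0; rewrite ge0_integralZl_EFin//.
  rewrite integral_indic// setIT.
  have E := lebesgue_measure_itv `[(- a)%R, a]%R; rewrite [X in _ * X]E /= lte_fin {E}.
  have [aa|aa] := ltP (- a)%R a.
    by rewrite EFinM; congr (_ * _); rewrite -EFinB; congr _%:E; ring.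
  have -> : a = 0%R by apply/eqP; rewrite eq_le a0 andbT; move: aa; lra.
  by rewrite mulr0 mulr0 mule0.
by apply/measurable_EFinP; exact: measurable_indic.
Qed.

(** Applied to an inscribed cube, as [integral_rV_upper] is to a circumscribed one: the volume of
    the ball matters only through being positive and finite. *)
Lemma integral_rV_lower (m : nat) (a : R) (f : 'rV[R]_m -> \bar R) :
  (0 <= a)%R -> (forall x, 0 <= f x) ->
  (forall x : 'rV_m, (forall i : 'I_m, `|x ord0 i| <= a)%R -> 1 <= f x) ->
  ((2 * a) ^+ m)%:E <= integral_rV f.
Proof.
move=> a0; elim: m f => [|m IH] f f0 f1 /=; first by rewrite expr0 f1// => -[].
rewrite exprSr -integral_centered ?exprn_ge0 ?mulr_ge0//.
apply: le_integralT => t.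
  by rewrite mule_ge0// lee_fin ?exprn_ge0 ?mulr_ge0// indicE.
rewrite indicE; case: (boolP (t \in _)) => [|_]; last first.
  by rewrite mule0; apply: integral_rV_ge0.
move=> /set_mem; rewrite /= in_itv/= => /andP[t1 t2]; rewrite mule1; apply: IH => // x xa.
apply: f1 => i; rewrite mxE; case: splitP => j _; last exact: xa.
by rewrite mxE ler_norml t1 t2.
Qed.

Lemma integral_rV_upper (m : nat) (a : R) (f : 'rV[R]_m -> \bar R) :
  (0 <= a)%R -> (forall x, 0 <= f x <= 1) ->
  (forall x, f x != 0 -> forall i : 'I_m, (`|x ord0 i| <= a)%R) ->
  integral_rV f <= ((2 * a) ^+ m)%:E.
Proof.
move=> a0; elim: m f => [|m IH] f f0 f1 /=.
  by rewrite expr0; have /andP[] := f0 0%R.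
have fge0 x : 0 <= f x by have /andP[] := f0 x.
rewrite exprSr -integral_centered ?exprn_ge0 ?mulr_ge0//.
apply: le_integralT => t; first exact: integral_rV_ge0.
rewrite indicE; case: (boolP (t \in _)) => [_|].
  rewrite mule1; apply: IH => // x /f1 h i.
  by have := h (rshift 1 i); rewrite (@row_mxEr _ 1 1 m).
move=> tn; have {tn} := tn; rewrite notin_setE /= in_itv/= => /negP.
rewrite -ler_norml => ta; rewrite mule0.
rewrite (_ : (fun v : 'rV_m => _) = cst 0) ?integral_rV0//.
apply/funext => v /=; apply/eqP; apply: contraNT ta => /f1/(_ (lshift m (ord0 : 'I_1))).
by rewrite (@row_mxEl _ 1 1 m) mxE.
Qed.

End ball_volume.

Section grid.
Variables (R : realType) (m : nat).
Local Notation V := 'rV[R]_m.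

Definition gridv (h : R) (K : nat) (f : {ffun 'I_m -> 'I_(K.*2.+1)}) : V :=
  \row_i (h * ((f i)%:R - K%:R)).

(** Rounds down to mesh [1 / j]. The second clause keeps points of an upper face on that face, which
    the discretization of directions relies on. *)
Lemma grid_round (j K : nat) (x : V) : (0 < j)%N ->
  (forall i, `|x ord0 i| * j%:R <= K%:R) ->
  exists f : {ffun 'I_m -> 'I_(K.*2.+1)},
    (forall i, `|x ord0 i - gridv j%:R^-1 f ord0 i| <= j%:R^-1) /\
    (forall i, x ord0 i * j%:R = K%:R -> f i = ord_max).
Proof.
move=> j0 xK; have j1 : 0 < j%:R :> R by rewrite ltr0n.
pose k i := Num.floor (x ord0 i * j%:R).
have xK' i : - K%:R <= x ord0 i * j%:R <= K%:R.
  by rewrite -ler_norml normrM (gtr0_norm j1).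
have kK i : (- K%:Z <= k i <= K%:Z)%R.
  have /andP[h1 h2] := xK' i; rewrite /k; apply/andP; split.
    by rewrite floor_ge_int intrN.
  by rewrite -ltzD1 floor_lt_int intrD; apply: le_lt_trans h2 _; rewrite ltrDl.
have kn i : (absz (k i + K%:Z)%R < K.*2.+1)%N by have := kK i; lia.
exists [ffun i => Ordinal (kn i)]; split => [i|i xi].
  rewrite !mxE ffunE /=.
  have -> : (absz (k i + K%:Z)%R)%:R - K%:R = (k i)%:~R :> R.
    rewrite -[(_)%:R]/((Posz _)%:~R) gez0_abs; last by have := kK i; lia.
    by rewrite intrD addrK.
  by rewrite mulrC; exact: coord_round.
rewrite ffunE; apply: val_inj => /=.
have -> : k i = K%:Z by rewrite /k xi; exact: (intrKfloor K%:Z).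
by lia.
Qed.

Lemma enorm_grid_round (e : nat) (x y : V) : (0 < m)%N -> (0 < e)%N ->
  (forall i, `|x ord0 i - y ord0 i| <= (m * e)%:R^-1) ->
  enorm (x - y) <= e%:R^-1.
Proof.
move=> m0 e0 h; apply: le_trans (@enorm_le_coord _ _ _ (m * e)%:R^-1 _ _) _.
- by rewrite invr_ge0.
- by move=> i; rewrite !mxE.
- by rewrite natrM invfM mulrA divff ?mul1r// pnatr_eq0 -lt0n.
Qed.

Lemma gridv_coord (h : R) K f i : 0 <= h -> `|@gridv h K f ord0 i| <= h * K%:R.
Proof.
move=> h0; rewrite mxE normrM (ger0_norm h0) ler_wpM2l// ler_norml.
have := ltn_ord (f i); move: (nat_of_ord (f i)) => k kK.
rewrite lerBlDr -mulr2n -mulrnA.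
rewrite muln2 ler_nat -ltnS kK andbT lerBrDr addNr; exact: ler0n.
Qed.

End grid.

(** * Rotations as products of two reflections *)

Section reflection.
Variables (R : realType) (m : nat).
Local Notation V := 'rV[R]_m.
Implicit Types x y h : V.

(** Twice the projection to the line of [h] minus the identity, that is, the negative of the usual
    reflection: it fixes [h], and for [h = x + y] it exchanges [x] and [y] of equal length. *)
Definition refl h : 'M[R]_m := (2 / dot h h) *: (h^T *m h) - 1%:M.

Lemma mulmx_refl x h : x *m refl h = (2 * dot x h / dot h h) *: h - x.
Proof.
rewrite mulmxBr mulmx1 -scalemxAr mulmxA; congr (_ - _).
have -> : x *m h^T = (dot x h)%:M.
  by apply/matrixP => i j; rewrite !ord1 -dot_mul !mxE mulr1n.
by rewrite mul_scalar_mx scalerA mulrAC.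
Qed.

Lemma refl_invol h : h != 0 -> refl h *m refl h = 1%:M.
Proof.
move=> /dot_gt0 h0; apply/row_matrixP => i; rewrite !rowE mulmxA mulmx1.
rewrite !mulmx_refl [dot (_ - _) h]dotDl dotZl dotNl mulfVK ?gt_eqF//.
set a := dot _ h; apply/rowP => j; rewrite !mxE; field; exact: lt0r_neq0.
Qed.

Lemma refl_sym h : (refl h)^T = refl h.
Proof. by rewrite /refl linearB/= linearZ/= trmx_mul trmxK trmx1. Qed.

Lemma reflZ a h : a != 0 -> refl (a *: h) = refl h.
Proof.
move=> a0; rewrite /refl; congr (_ - _); apply/matrixP => i j.
rewrite !dotE !mxE !big_ord1 !mxE.
have [->|h0] := eqVneq (dot h h) 0; first by rewrite !mulr0 invr0 !(mulr0, mul0r).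
by field; rewrite h0.
Qed.

Lemma refl_swap x y : dot x x = dot y y -> x + y != 0 -> x *m refl (x + y) = y.
Proof.
move=> xy s0; rewrite mulmx_refl !dotE (dotC y x) -xy.
have := dot_gt0 s0; rewrite !dotE (dotC y x) -xy => h.
have -> : 2 * (dot x x + dot x y) / (dot x x + dot x y + (dot x y + dot x x)) = 1.
  by field; rewrite lt0r_neq0//; move: h; lra.
by rewrite scale1r addrC addKr.
Qed.

(** After rescaling [y] to the length of [x], the two maps are conjugate by the one that exchanges
    both vectors; this identifies the determinants without computing them. *)
Lemma det_refl x y : x != 0 -> y != 0 -> \det (refl x) = \det (refl y).
Proof.
move=> x0 y0; pose c := enorm x / enorm y.
have ey : 0 < enorm y by rewrite sqrtr_gt0 dot_gt0.
have ex : 0 < enorm x by rewrite sqrtr_gt0 dot_gt0.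
have c0 : c != 0 by rewrite gt_eqF// divr_gt0.
rewrite -(reflZ y c0); set z := c *: y.
have xz : dot x x = dot z z.
  rewrite -!sqr_enorm enormZ ger0_norm ?divr_ge0 ?enorm_ge0//.
  by rewrite mulfVK// gt_eqF.
have [s0|s0] := eqVneq (x + z) 0.
  have -> : z = -1 *: x by apply/eqP; rewrite scaleN1r -addr_eq0 addrC s0.
  by rewrite reflZ// oppr_eq0 oner_eq0.
have xQ := refl_swap xz s0; have QQ := refl_invol s0; have Qs := refl_sym (x + z).
move: (refl (x + z)) xQ QQ Qs => Q xQ QQ Qs.
have zQ : z *m Q = x by rewrite -xQ -mulmxA QQ mulmx1.
have -> : refl z = Q *m refl x *m Q.
  apply/row_matrixP => i; rewrite !rowE; set e := delta_mx 0 i.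
  rewrite !mulmxA !mulmx_refl mulmxBl -scalemxAl xQ -mulmxA QQ mulmx1.
  have -> : dot (e *m Q) x = dot e z by rewrite -zQ dot_orth // Qs QQ.
  by rewrite -xz.
have : \det (Q *m Q) = 1 by rewrite QQ det1.
by rewrite !det_mulmx mulrAC => ->; rewrite mul1r.
Qed.

(** The first factor fixes [x] and the second sends it to [y]. Both have the same determinant, whose
    square is 1 because the maps are involutions. *)
Lemma rotation_exists x y : dot x x = dot y y -> x + y != 0 -> x != 0 ->
  exists M : 'M[R]_m, [/\ M *m M^T = 1%:M, \det M = 1 & x *m M = y].
Proof.
move=> xy s0 x0; exists (refl x *m refl (x + y)); split.
- by rewrite trmx_mul !refl_sym mulmxA -(mulmxA (refl x)) refl_invol// mulmx1 refl_invol.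
- by rewrite det_mulmx (det_refl s0 x0) -det_mulmx refl_invol// det1.
- rewrite mulmxA -[X in _ = X](refl_swap xy s0); congr (_ *m _).
  rewrite mulmx_refl mulfK ?gt_eqF ?dot_gt0//.
  by rewrite -[2%:R]/(1 + 1) scalerDl scale1r addrK.
Qed.

End reflection.

(** * Consequences of invariance *)

Section haar.
Variables (R : realType) (n : nat) (mu : {measure set (line R n) -> \bar R}).
Hypothesis hmu : is_haar mu.
Local Notation V := 'rV[R]_n.+1.
Local Notation lines := (line R n).

Definition two_hit (r : R) (x y : V) : set lines := hit x r `&` hit y r.

Lemma two_hit_measurable r x y : 0 <= r -> measurable (two_hit r x y).
Proof. by move=> r0; apply: measurableI; exact: hit_measurable. Qed.

Lemma image_two_hit (f g : V -> V) (r : R) x y : cancel g f ->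
  (forall L : lines, exists L' : lines, line_set L' = f @` line_set L) ->
  (forall L : lines, exists L' : lines, line_set L' = g @` line_set L) ->
  (forall x y, enorm (f x - f y) = enorm (x - y)) ->
  image_lines f (two_hit r x y) = two_hit r (f x) (f y).
Proof.
move=> gf Lf Lg fi; have fiso z L L' : line_set L' = f @` line_set L ->
    hit z r L -> hit (f z) r L'.
  by move=> LE [p Lp pz]; exists (f p); rewrite ?fi// LE; exists p.
apply/seteqP; split => [L' [L [h1 h2] LE]|L' [h1 h2]].
  by split; exact: fiso LE _.
have [L LE] := Lg L'.
have giso z : hit (f z) r L' -> hit z r L.
  move=> [p Lp pz]; exists (g p); first by rewrite LE; exists p.
  by rewrite -fi gf.
exists L; first by split; exact: giso.
rewrite LE image_comp (_ : f \o g = id) ?image_id//.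
by apply/funext => z /=; rewrite gf.
Qed.

Lemma image_line (f : V -> V) : (forall p v t, f (p + t *: v) = f p + t *: (f (p + v) - f p)) ->
  injective f -> forall L : lines, exists L' : lines, line_set L' = f @` line_set L.
Proof.
move=> fa fI L; have [p [v [v0 ->]]] := line_setP L.
have w0 : f (p + v) - f p != 0.
  rewrite subr_eq0; apply: contra v0 => /eqP/fI/eqP.
  by rewrite -subr_eq0 addrAC subrr add0r.
exists (mkline (f p) w0); apply/seteqP; split => x /=.
  by move=> [t _ <-]; exists (p + t *: v); [exists t|rewrite fa].
by move=> [_ [t _ <-] <-]; exists t.
Qed.

Lemma two_hit_translate r x y a : 0 <= r ->
  mu (two_hit r (x + a) (y + a)) = mu (two_hit r x y).
Proof.
move=> r0; have [H _ _] := hmu.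
rewrite -[RHS](H a); last exact (two_hit_measurable x y r0).
congr (mu _); apply/esym.
apply: (@image_two_hit (fun x => x + a) (fun x => x - a)).
- by move=> z; rewrite subrK.
- by apply: image_line => [p v t|z w /addIr//]; vring.
- by apply: image_line => [p v t|z w /addIr//]; vring.
- by move=> z w; congr enorm; vring.
Qed.

Lemma two_hit_sphere r x y : 0 <= r -> dot x x = dot y y ->
  mu (two_hit r 0 x) = mu (two_hit r 0 y).
Proof.
(* For [y = - x] the vector of the reflection vanishes; translation and the symmetry between the two
   balls take the place of the rotation. *)
move=> r0 xy; have [s0|s0] := eqVneq (x + y) 0.
  have -> : y = - x by apply/eqP; rewrite -addr_eq0 addrC s0.
  by rewrite -(@two_hit_translate r 0 (- x) x r0) add0r addNr /two_hit setIC.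
have [x0|x0] := eqVneq x 0.
  have -> // : y = x.
  by apply/eqP; rewrite x0 -dot_eq0 -xy x0 dot0r.
have [M [M1 M2 xM]] := rotation_exists xy s0 x0.
have M3 : M^T *m M = 1%:M by apply: mulmx1C.
have [_ H _] := hmu.
rewrite -[LHS](H M)//; last exact (two_hit_measurable 0 x r0).
congr (mu _).
rewrite (@image_two_hit (fun x => x *m M) (fun x => x *m M^T)).
- by rewrite mul0mx xM.
- by move=> z; rewrite -mulmxA M3 mulmx1.
- apply: image_line => [p v t|].
    by rewrite !mulmxDl -scalemxAl addrAC subrr add0r.
  by apply: (can_inj (g := fun x => x *m M^T)) => z; rewrite -mulmxA M1 mulmx1.
- apply: image_line => [p v t|].
    by rewrite !mulmxDl -scalemxAl addrAC subrr add0r.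
  by apply: (can_inj (g := fun x => x *m M)) => z; rewrite -mulmxA M3 mulmx1.
- by move=> z w; rewrite -mulmxBl enorm_orth.
Qed.

(** By rotation [y] may be placed on the segment from 0 to [x], and a line close to both ends of a
    segment is close to each of its points. *)
Lemma two_hit_anti r x y : 0 <= r -> enorm y <= enorm x ->
  (mu (two_hit r 0 x) <= mu (two_hit r 0 y))%E.
Proof.
move=> r0 yx; have [x0|x0] := eqVneq x 0.
  have /eqP : enorm y = 0.
    by apply/eqP; rewrite eq_le enorm_ge0 andbT; move: yx; rewrite x0 enorm0.
  rewrite enormE sqrtr_eq0 => y0; have : dot y y == 0 by rewrite eq_le y0 dot_ge0.
  by rewrite dot_eq0 => /eqP ->; rewrite x0.
have ex : 0 < enorm x by rewrite sqrtr_gt0 dot_gt0.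
have t0 : 0 <= enorm y / enorm x by rewrite divr_ge0 ?enorm_ge0.
rewrite (@two_hit_sphere r y ((enorm y / enorm x) *: x))//; last first.
  rewrite -!sqr_enorm enormZ ger0_norm//.
  by rewrite mulfVK// gt_eqF.
apply: measure_mono; [exact (two_hit_measurable _ _ r0)|
  exact (two_hit_measurable _ _ r0)|].
move=> L [h0 hx]; split => //.
have := @hit_segment _ _ L 0 x r (enorm y / enorm x).
rewrite add0r subr0; apply => //; rewrite t0/=.
by rewrite ler_pdivrMr// mul1r.
Qed.

Lemma two_hit_dist r x y x' y' : 0 <= r -> enorm (x' - y') <= enorm (x - y) ->
  (mu (two_hit r x y) <= mu (two_hit r x' y'))%E.
Proof.
move=> r0 h.
rewrite -(@two_hit_translate r x y (- x))// -(@two_hit_translate r x' y' (- x'))//.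
by rewrite !subrr; apply: two_hit_anti; rewrite // enorm_distC [leRHS]enorm_distC.
Qed.

Lemma hit_translate r x y : 0 <= r -> mu (hit x r) = mu (hit y r).
Proof.
move=> r0; have := @two_hit_translate r x x (y - x) r0.
by rewrite addrC subrK /two_hit !setIid => ->.
Qed.

Lemma hit_unit x : (0 < mu (hit x 1) < +oo)%E.
Proof.
have [_ _] := hmu; rewrite (@hit_translate 1 x 0)//.
have -> : hitting (unit_ball R n.+1) = hit (0 : V) 1.
  by apply/seteqP; split => L; [move=> [p [Lp /= hp]]; exists p; rewrite ?subr0|
    move=> [p Lp]; rewrite subr0; exists p].
move=> ->; apply/andP; split.
  apply: lt_le_trans (@integral_rV_lower R n (n.+1%:R^-1) _ _ _ _).
  - by rewrite lte_fin exprn_gt0// mulr_gt0// invr_gt0.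
  - by rewrite invr_ge0.
  - by move=> x0; rewrite lee_fin indicE.
  - move=> v vn; rewrite lee_fin indicE mem_set//= /unit_ball/=.
    apply: le_trans (enorm_le_coord _ vn) _; first by rewrite invr_ge0.
    by rewrite ler_pdivrMr// mul1r ler_nat.
apply: le_lt_trans (@integral_rV_upper R n 1 _ _ _ _) _ => //.
- by move=> v; rewrite !lee_fin indicE; case: (_ \in _); rewrite ?lexx ?ler01.
- move=> v; rewrite eqe indicE; case: (boolP (v \in _)); last by rewrite eqxx.
  by move=> /set_mem; rewrite /unit_ball/= => h _ i; exact: le_trans (coord_le_enorm _ _) h.
- exact: ltry.
Qed.

End haar.

Section finite_families.
Context d (T : measurableType d) (R : realType) (m : {measure set T -> \bar R}).
Local Open Scope ereal_scope.

Lemma measure_cover (I : eqType) (s : seq I) (A : set T) (B : I -> set T) :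
  measurable A -> (forall i, measurable (B i)) ->
  A `<=` [set x | exists2 i, i \in s & B i x] ->
  m A <= \sum_(i <- s) m (B i).
Proof.
move=> mA mB; elim: s A mA => [|i s IH] A mA AB.
  rewrite big_nil (_ : A = set0) ?measure0//.
  by rewrite -subset0 => x /AB[].
rewrite big_cons; have mD : measurable (A `\` B i) by exact: measurableD.
apply: (@le_trans _ _ (m (B i `|` (A `\` B i)))).
  apply: measure_mono => //; first exact: measurableU.
  by move=> x Ax; have [?|?] := pselect (B i x); [left|right].
apply: le_trans (measureU2 _ _ _) _ => //.
rewrite leeD2l// IH// => x [/AB[j]]; rewrite inE => /orP[/eqP ->|js] //.
by move=> Bj _; exists j.
Qed.

(** Integrates the pointwise bound of the number of sets [B i] containing a point by [K] times the
    indicator of [A]. *)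
Lemma measure_multiplicity (I : finType) (A : set T) (B : I -> set T) (K : nat) :
  measurable A -> (forall i, measurable (B i)) -> (forall i, B i `<=` A) ->
  (forall x, A x -> (#|[set i | x \in B i]%SET| <= K)%N) ->
  \sum_i m (B i) <= K%:R%:E * m A.
Proof.
move=> mA mB BA AK.
have mind (C : set T) : measurable C -> measurable_fun [set: T] (fun x => (\1_C x : R)%:E).
  by move=> mC; apply/measurable_EFinP; exact: measurable_indic.
have intE (C : set T) : measurable C -> m C = \int[m]_x (\1_C x : R)%:E.
  by move=> mC; rewrite integral_indic// setIT.
rewrite intE// (eq_bigr (fun i => \int[m]_x (\1_(B i) x : R)%:E)); last first.
  by move=> i _; exact: intE.
have ind0 (C : set T) x : (0 : \bar R) <= (\1_C x : R)%:E by rewrite lee_fin indicE.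
rewrite -ge0_integral_sum//; last by move=> i; exact: mind.
rewrite -ge0_integralZl_EFin//; last exact: mind.
apply: ge0_le_integral => //.
- by move=> x _; apply: sume_ge0 => i _; rewrite lee_fin indicE.
- by apply: emeasurable_sum => i; exact: mind.
- by apply: emeasurable_funM; [exact: measurable_cst|exact: mind].
move=> x _; rewrite sumEFin -EFinM lee_fin.
under eq_bigr do rewrite indicE.
rewrite -natr_sum -natrM ler_nat.
have -> : (\sum_i (x \in B i) = #|[set i | x \in B i]%SET|)%N.
  rewrite -sum1dep_card [RHS]big_mkcond; apply: eq_bigr => i _.
  by case: (x \in B i).
case: (boolP (x \in A)) => [/set_mem Ax|/negP nAx]; first by rewrite muln1 AK.
rewrite muln0 leqn0 cards_eq0; apply/eqP/setP => i; rewrite !inE.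
by apply/negP => /set_mem/BA Ax; apply: nAx; exact: mem_set.
Qed.

End finite_families.

(** * Two-sided bounds for the measure of the lines hitting two balls *)

Section kernel.
Variables (R : realType) (n : nat) (mu : {measure set (line R n) -> \bar R}).
Hypothesis hmu : is_haar mu.
Local Notation V := 'rV[R]_n.+1.
Local Notation lines := (line R n).
Implicit Types x y z : V.

(** Carries positivity and finiteness from radius 1, where the normalization provides them, to
    radius 1/2 and to integer radii. *)
Lemma ball_cover_half (r : nat) : exists s : seq V,
  hit 0 r%:R `<=` [set L : lines | exists2 a, a \in s & hit a (2^-1) L].
Proof.
pose K := (n.+1 * 2 * r)%N.
exists [seq gridv (n.+1 * 2)%:R^-1 f | f : {ffun 'I_n.+1 -> 'I_(K.*2.+1)}].
move=> L [p Lp]; rewrite subr0 => pr.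
have pK i : `|p ord0 i| * (n.+1 * 2)%:R <= K%:R.
  rewrite /K (natrM R _ r) mulrC ler_wpM2l//.
  exact: le_trans (coord_le_enorm p i) pr.
have [//|f [fp _]] := grid_round _ pK.
exists (gridv (n.+1 * 2)%:R^-1 f); first by apply: map_f; rewrite mem_enum.
by exists p => //; exact: enorm_grid_round.
Qed.

Lemma hit_half_gt0 x : (0 < mu (hit x (2^-1)))%E.
Proof.
rewrite lt_neqAle measure_ge0 andbT; apply/eqP => h0.
have [s sc] := ball_cover_half 1.
have /andP[+ _] := hit_unit hmu 0; apply/negP; rewrite -leNgt.
have H := @measure_cover _ _ _ mu _ s (hit 0 1) (fun a => hit a 2^-1).
apply: le_trans (H _ _ _) _.
- exact: (@hit_measurable _ _ 0 1).
- by move=> a; apply: (@hit_measurable _ _ a 2^-1); rewrite invr_ge0.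
- exact: sc.
- rewrite big1// => a _; rewrite (@hit_translate _ _ _ hmu _ a x) ?invr_ge0//.
Qed.

Lemma hit_lty x (r : nat) : (mu (hit x r%:R) < +oo)%E.
Proof.
rewrite (@hit_translate _ _ _ hmu _ x 0)//.
have [s sc] := ball_cover_half r.
have H := @measure_cover _ _ _ mu _ s (hit 0 r%:R) (fun a => hit a 1).
apply: le_lt_trans (H _ _ _) _.
- exact: (@hit_measurable _ _ 0 r%:R).
- by move=> a; apply: (@hit_measurable _ _ a 1).
- move=> L /sc[a sa h]; exists a => //; apply: hit_le h.
  by rewrite invf_le1// ler1n.
- apply: lte_sum_pinfty => a _; by have /andP[] := hit_unit hmu a.
Qed.

(* Directions are discretized by the faces of the cube of side [2N]: every line
   through the origin meets such a face within distance 1/2 of a lattice point,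
   and there are only [O(N^n)] lattice points on the faces. *)
Definition face_ext (K : nat) (i : 'I_n.+1) (f : {ffun 'I_n -> 'I_(K.*2.+1)}) :
    {ffun 'I_n.+1 -> 'I_(K.*2.+1)} :=
  [ffun j => if unlift i j is Some j' then f j' else ord_max].

Definition face_point (N : nat)
    (e : 'I_n.+1 * {ffun 'I_n -> 'I_((n.+1 * 2 * N).*2.+1)}) : V :=
  gridv (n.+1 * 2)%:R^-1 (face_ext e.1 e.2).

Lemma face_point_norm N e : `|@face_point N e| = N%:R.
Proof.
have hN : ((n.+1 * 2)%:R^-1 * (n.+1 * 2 * N)%:R : R) = N%:R.
  by rewrite (natrM R _ N) mulKf// pnatr_eq0.
apply/eqP; rewrite eq_le; apply/andP; split.
  by apply: norm_le_coord => // i; rewrite -[leRHS]hN gridv_coord.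
apply: le_trans (coord_le_norm _ e.1).
rewrite mxE ffunE unlift_none/= -mul2n (natrM R 2).
rewrite (_ : 2 * _ - _ = (n.+1 * 2 * N)%:R); last by ring.
by rewrite hN ger0_norm.
Qed.

Lemma face_point_direction N (v : V) : v != 0 ->
  exists t e, enorm (t *: v - @face_point N e) <= 2^-1.
Proof.
move=> v0; have [i vi] := norm_coordP v (ltn0Sn n).
have vi0 : v ord0 i != 0 by rewrite -normr_eq0 -vi normr_eq0.
(* Brings the largest coordinate to [+N], with [t < 0] if that coordinate is negative, so that the
   faces [x_i = N] represent all directions. *)
pose t := N%:R / v ord0 i; exists t.
have tv j : `|(t *: v) ord0 j| * (n.+1 * 2)%:R <= (n.+1 * 2 * N)%:R.
  rewrite (natrM R _ N) [leRHS]mulrC ler_wpM2r// !mxE /t normrM normrM normfV -vi normr_nat.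
  rewrite -mulrA ler_piMr// ler_pdivrMl ?mulr1 ?normr_gt0//.
  exact: coord_le_norm.
have [//|f [ft fi]] := grid_round _ tv.
have fmax : f i = ord_max.
  by apply: fi; rewrite mxE mulfVK// (natrM R _ N) mulrC.
exists (i, [ffun j => f (lift i j)]); rewrite /face_point/=.
have -> : face_ext i [ffun j => f (lift i j)] = f.
  by apply/ffunP => j; rewrite ffunE; case: unliftP => [k ->|->]; rewrite ?ffunE.
exact: enorm_grid_round.
Qed.

Definition nu (r : R) x y : R := fine (mu (two_hit r x y)).

Lemma two_hit_lty (r : nat) x y : (mu (two_hit r%:R x y) < +oo)%E.
Proof.
apply: le_lt_trans (hit_lty x r).
by apply: measure_mono; [exact (@two_hit_measurable _ _ _ x y (ler0n R r))|
  exact (@hit_measurable _ _ x _ (ler0n R r))|move=> L []].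
Qed.

Lemma nuE (r : nat) x y : mu (two_hit r%:R x y) = (nu r%:R x y)%:E.
Proof. by rewrite fineK// ge0_fin_numE ?measure_ge0// two_hit_lty. Qed.

(** Covering: a line through the ball of radius 1/2 at 0 also hits the unit ball around one of the
    face points, of which there are of order [N ^ n]. As [N] is at least [n.+1] times the sup norm
    of [x - y], every face point is at least as far from 0 as [x] from [y], so each class of lines
    has measure at most [nu 1 x y]. *)
Lemma nu_lower : exists2 c : R, 0 < c &
  forall x y, 1 <= `|x - y| -> c <= nu 1 x y * `|x - y| ^+ n.
Proof.
pose k := fine (mu (hit 0 2^-1)).
have k_fin : (mu (hit 0 2^-1) < +oo)%E.
  apply: le_lt_trans (hit_lty 0 1); apply: measure_mono.
  - by apply: (@hit_measurable _ _ 0 2^-1); rewrite invr_ge0.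
  - exact (@hit_measurable _ _ 0 _ ler01).
  - by apply: hit_le; rewrite invf_le1// ler1n.
have kE : mu (hit 0 2^-1) = k%:E by rewrite fineK// ge0_fin_numE.
have k0 : 0 < k by rewrite -lte_fin -kE; exact: hit_half_gt0.
pose D : R := (n.+1 * 4 * n.+2 + 1)%:R.
have D0 : 0 < D by rewrite ltr0n addn1.
exists (k / (n.+1%:R * D ^+ n)); first by rewrite divr_gt0// mulr_gt0// exprn_gt0.
move=> x y xy1; set s := `|x - y| in xy1 *.
pose N := (Num.trunc (n.+1%:R * s)).+1.
have Ns : n.+1%:R * s <= N%:R by exact/ltW/truncnS_gt.
have Ns2 : N%:R <= n.+2%:R * s.
  rewrite /N -addn1 natrD -[n.+2]addn1 natrD mulrDl mul1r.
  apply: lerD => //; rewrite truncn_le mulr_ge0//; exact: le_trans xy1.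
have cover : hit 0 2^-1 `<=` [set L : lines | exists2 e,
    e \in index_enum ('I_n.+1 * {ffun 'I_n -> 'I_((n.+1 * 2 * N).*2.+1)})%type &
    two_hit 1 0 (face_point e) L].
  move=> L [p Lp]; rewrite subr0 => p1; have [v v0 Lv] := line_through_dir L.
  have [t [e te]] := face_point_direction N v0.
  exists e; first exact: mem_index_enum.
  split; first by exists p => //; rewrite subr0; apply: le_trans p1 _; rewrite invf_le1// ler1n.
  exists (p + t *: v); first by rewrite (Lv _ Lp); exists t.
  rewrite -addrA; apply: le_trans (enormD _ _) _; move: p1 te; lra.
have mh : measurable (hit (0 : V) 2^-1).
  by apply: (@hit_measurable _ _ 0 2^-1); rewrite invr_ge0.
have := measure_cover mu mh
  (fun e => @two_hit_measurable R n 1 0 (face_point e) ler01) cover.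
rewrite kE => h.
have {h} : (k%:E <= \sum_(e : 'I_n.+1 * {ffun 'I_n -> 'I_((n.+1 * 2 * N).*2.+1)})
    (nu 1 x y)%:E)%E.
  apply: le_trans h _; apply: lee_sum => e _.
  have -> : (nu 1 x y)%:E = mu (two_hit 1 x y) by rewrite -(nuE 1).
  apply: two_hit_dist => //; rewrite sub0r enormN.
  apply: le_trans (enorm_le_norm _) _; apply: le_trans Ns _.
  rewrite -(@face_point_norm N e); exact: norm_le_enorm.
rewrite sumEFin lee_fin sumr_const card_prod card_ffun !card_ord.
set M := (_.*2.+1)%N; rewrite -[X in _ <= X -> _]mulr_natr natrM natrX => h.
have nu0 : 0 <= nu 1 x y by rewrite fine_ge0.
rewrite ler_pdivrMr ?mulr_gt0 ?exprn_gt0//; apply: le_trans h _.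
rewrite -mulrA ler_wpM2l// [leRHS]mulrCA ler_wpM2l// -exprMn.
rewrite lerXn2r ?nnegrE ?mulr_ge0 ?(ltW D0) ?normr_ge0//.
have -> : M%:R = (n.+1 * 4)%:R * N%:R + 1 :> R.
  by rewrite /M -addn1 natrD -muln2 !natrM; ring.
have : (n.+1 * 4)%:R * N%:R <= (n.+1 * 4)%:R * (n.+2%:R * s) by rewrite ler_wpM2l.
rewrite /D natrD (natrM R _ n.+2) mulrDr mulr1 (mulrC s) -mulrA.
by move: xy1; lra.
Qed.

(* The lattice points with first coordinate [N = 17 K] of the face of a cube are
   so far apart that no line through the ball of radius 2 around the origin comes
   within distance 2 of two of them. *)
Definition far_point (K : nat) (f : {ffun 'I_n -> 'I_K}) : V :=
  \row_j (17%:R * (if unlift ord0 j is Some j' then (f j')%:R else K%:R)).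

Lemma far_point0 K f : @far_point K f ord0 ord0 = 17%:R * K%:R.
Proof. by rewrite mxE unlift_none. Qed.

Lemma far_point_norm K f : `|@far_point K f| <= 17%:R * K%:R.
Proof.
apply: norm_le_coord => [|j]; first by rewrite mulr_ge0.
rewrite mxE normrM !ger0_norm//; last by case: unlift.
by rewrite ler_wpM2l//; case: unlift => // j'; rewrite ler_nat ltnW.
Qed.

(** From [q] to the hyperplane of first coordinate [17 K] the line moves by at most
    [2 (17 K + 4) / (17 K - 4) <= 6]; with the 2 for [q] this makes 8. *)
Lemma far_point_crossing (K : nat) (f : {ffun 'I_n -> 'I_K}) p q :
  (0 < K)%N -> enorm p <= 2 -> enorm (q - far_point f) <= 2 ->
  exists t, [/\ p ord0 ord0 < q ord0 ord0,
    (p + t *: (q - p)) ord0 ord0 = 17%:R * K%:R &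
    `|p + t *: (q - p) - far_point f| <= 8].
Proof.
move=> K0 p2 q2.
have K1 : 1 <= K%:R :> R by rewrite ler1n.
have p0 := le_trans (coord_le_enorm p ord0) p2.
have := le_trans (coord_le_enorm _ ord0) q2.
rewrite mxE [X in _ + X]mxE far_point0 => q0.
move: p0 q0; rewrite !ler_norml => /andP[p01 p02] /andP[q01 q02].
have pq : 0 < q ord0 ord0 - p ord0 ord0 by lra.
pose t := (17%:R * K%:R - p ord0 ord0) / (q ord0 ord0 - p ord0 ord0).
exists t; split; first by rewrite -subr_gt0.
  by rewrite !mxE mulfVK ?gt_eqF// addrC subrK.
have -> : p + t *: (q - p) - far_point f = (t - 1) *: (q - p) + (q - far_point f).
  by vring.
apply: le_trans (ler_normD _ _) _.
have h2 : `|q - far_point f| <= 2 by apply: le_trans (norm_le_enorm _) q2.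
have h3 : `|q - p| <= 17%:R * K%:R + 4.
  have -> : q - p = (q - far_point f) + far_point f - p by vring.
  apply: le_trans (ler_normB _ _) _; apply: le_trans (lerD (ler_normD _ _) (lexx _)) _.
  have := le_trans (norm_le_enorm p) p2; have := far_point_norm f.
  by move: h2; lra.
suff : `|(t - 1) *: (q - p)| <= 6 by move: h2; lra.
rewrite normrZ.
have -> : t - 1 = (17%:R * K%:R - q ord0 ord0) / (q ord0 ord0 - p ord0 ord0).
  by rewrite /t; field; rewrite gt_eqF.
rewrite normrM normfV (gtr0_norm pq) mulrAC ler_pdivrMr//.
have h4 : `|17%:R * K%:R - q ord0 ord0| <= 2 by rewrite ler_norml; lra.
apply: le_trans (ler_pM _ _ h4 h3) _ => //.
by lra.
Qed.

(** The line crosses the hyperplane in one point, within 8 of both far points; these are at distance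
    at most 16, less than the spacing 17. *)
Lemma far_point_disjoint (K : nat) (f g : {ffun 'I_n -> 'I_K}) (L : lines) :
  (0 < K)%N -> two_hit 2 0 (far_point f) L -> two_hit 2 0 (far_point g) L -> f = g.
Proof.
move=> K0 [[p Lp] + [q Lq qf]] [_ [q' Lq' qg]]; rewrite subr0 => p2.
have [t [pq t0 tf]] := far_point_crossing K0 p2 qf.
have [t' [_ t'0 tg]] := far_point_crossing K0 p2 qg.
have qp : q != p by apply: contraTneq pq => ->; rewrite ltxx.
have [s qs] := line_two Lp Lq Lq' qp.
have pq0 : q ord0 ord0 - p ord0 ord0 != 0 by rewrite subr_eq0 gt_eqF.
have ts : t' * s = t.
  apply: (mulIf pq0); move: t'0; rewrite qs -t0 !mxE; lra.
have e : p + t' *: (q' - p) = p + t *: (q - p) by rewrite qs -ts; vring.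
rewrite e in tg.
have fg : `|far_point f - far_point g| <= 16.
  have -> : far_point f - far_point g =
    (p + t *: (q - p) - far_point g) - (p + t *: (q - p) - far_point f) by vring.
  apply: le_trans (ler_normB _ _) _; move: tf tg; lra.
apply/ffunP => j; apply: val_inj => /=.
have := le_trans (coord_le_norm _ (lift ord0 j)) fg.
rewrite !mxE liftK -mulrBr normrM ger0_norm//.
case: (ltngtP (f j) (g j)) => // h.
- have fg1 : (f j)%:R + 1 <= (g j)%:R :> R by rewrite natr1 ler_nat.
  by move=> hh; exfalso; move: hh; rewrite ler0_norm; lra.
- have fg1 : (g j)%:R + 1 <= (f j)%:R :> R by rewrite natr1 ler_nat.
  by move=> hh; exfalso; move: hh; rewrite ger0_norm; lra.
Qed.

(** Packing: the [K ^ n] far points define disjoint sets of lines through the ball of radius 2 at 0,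
    each of measure at least [nu 2 x y] because the far points have Euclidean norm at most
    [17 n.+1 K = E K / 2 <= s]. For [s <= E] the trivial bound by [k] suffices. *)
Lemma nu_upper : exists2 C : R, 0 < C &
  forall x y, 1 <= `|x - y| -> nu 2 x y * `|x - y| ^+ n <= C.
Proof.
pose k := fine (mu (hit (0 : V) 2%:R)).
have kE : mu (hit (0 : V) 2%:R) = k%:E by rewrite fineK// ge0_fin_numE// hit_lty.
have k0 : 0 <= k by rewrite fine_ge0.
pose E : R := (34 * n.+1)%:R.
have E0 : 0 < E by rewrite ltr0n.
exists ((k + 1) * E ^+ n); first by rewrite mulr_gt0 ?exprn_gt0//; lra.
move=> x y; set s := `|x - y| => s1.
have nuk : nu 2 x y <= k.
  rewrite -lee_fin -kE (@hit_translate _ _ _ hmu _ 0 x)// -(nuE 2).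
  by apply: measure_mono; [exact (@two_hit_measurable _ _ _ x y (ler0n R 2))|
    exact (@hit_measurable _ _ x _ (ler0n R 2))|move=> L []].
have nu0 : 0 <= nu 2 x y by rewrite fine_ge0.
have [sE|sE] := leP s E.
  apply: ler_pM => //; first by rewrite exprn_ge0//; lra.
    by lra.
  by rewrite lerXn2r ?nnegrE//; lra.
pose K := Num.trunc (2 * (s / E)).
have sE0 : 0 <= s / E by rewrite divr_ge0//; lra.
have K2 : K%:R <= 2 * (s / E) by rewrite truncn_le mulr_ge0.
have K1 : s / E <= K%:R.
  have := truncnS_gt (2 * (s / E)); rewrite -/K -(natr1 K).
  have : 1 < s / E by rewrite ltr_pdivlMr// mul1r.
  by move: (s / E) (K%:R) => a b; lra.
have K0 : (0 < K)%N.
  rewrite -(ltr0n R); apply: lt_le_trans K1; rewrite divr_gt0//; lra.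
have mh : measurable (hit (0 : V) 2%:R) by exact (@hit_measurable _ _ 0 _ (ler0n R 2)).
have := @measure_multiplicity _ _ _ mu {ffun 'I_n -> 'I_K} _
  (fun f => two_hit 2%:R 0 (far_point f)) 1 mh
  (fun f => @two_hit_measurable R n 2%:R 0 (far_point f) (ler0n R 2)).
move=> H; have {H} : (\sum_(f : {ffun 'I_n -> 'I_K}) mu (two_hit 2%:R 0 (far_point f))
    <= 1%:R%:E * mu (hit (0 : V) 2%:R))%E.
  apply: H; first by move=> f L [].
  move=> L _; apply/card_le1_eqP => f g; rewrite !inE => /set_mem h1 /set_mem h2.
  exact: far_point_disjoint K0 h2 h1.
rewrite kE mul1e => H.
have {}H : (\sum_(f : {ffun 'I_n -> 'I_K}) (nu 2 x y)%:E <= k%:E)%E.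
  apply: le_trans H; apply: lee_sum => f _; rewrite -(nuE 2).
  apply: two_hit_dist => //; rewrite sub0r enormN.
  apply: le_trans (enorm_le_norm _) _.
  apply: le_trans (norm_le_enorm (x - y)); rewrite -/s.
  apply: (@le_trans _ _ (n.+1%:R * (17%:R * K%:R))).
    by rewrite ler_wpM2l// far_point_norm.
  have : E * K%:R <= 2 * s by rewrite mulrC -ler_pdivlMr// -mulrA.
  rewrite /E natrM; lra.
move: H; rewrite sumEFin lee_fin sumr_const card_ffun !card_ord -[X in X <= k -> _]mulr_natr natrX => H.
apply: (@le_trans _ _ (nu 2 x y * (K%:R * E) ^+ n)).
  rewrite ler_wpM2l// lerXn2r ?nnegrE ?mulr_ge0 ?(ltW E0)//; first lra.
  by rewrite -ler_pdivrMr.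
rewrite exprMn mulrA ler_wpM2r ?exprn_ge0 ?(ltW E0)//; lra.
Qed.

End kernel.

(** * Poisson line processes *)

Section outer_bounds.
Context (disp : measure_display) (T : measurableType disp) (R : realType)
  (P : probability T R).
Local Open Scope ereal_scope.

(** Outer probability: most of the events below are existential statements about lines of the
    process, not known to be measurable when they are estimated. *)
Definition outer_le (X : set T) (b : R) : Prop :=
  exists E, [/\ measurable E, X `<=` E & P E <= b%:E].

Lemma outer_le_sub (X Y : set T) (a b : R) : X `<=` Y -> (a <= b)%R ->
  outer_le Y a -> outer_le X b.
Proof.
move=> XY ab [E [mE YE Ea]]; exists E; split => //; first exact: subset_trans YE.
by apply: le_trans Ea _; rewrite lee_fin.
Qed.

Lemma outer_le_cover (I : eqType) (s : seq I) (X : set T) (Y : I -> set T) (b : I -> R) :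
  X `<=` [set w | exists2 i, i \in s & Y i w] ->
  (forall i, i \in s -> outer_le (Y i) (b i)) ->
  outer_le X (\sum_(i <- s) b i)%R.
Proof.
elim: s X => [|i s IH] X Xs Yb.
  rewrite big_nil; exists set0; split => //; last by rewrite measure0.
  by move=> w /Xs[].
have [E [mE YE Eb]] : outer_le (Y i) (b i) by apply: Yb; rewrite inE eqxx.
have [|j js|F [mF XF Fb]] := IH [set w | exists2 i, i \in s & Y i w]; first exact.
  by apply: Yb; rewrite inE js orbT.
exists (E `|` F); split; first exact: measurableU.
  move=> w /Xs[j]; rewrite inE => /orP[/eqP ->|js] Yw; first by left; exact: YE.
  by right; apply: XF; exists j.
rewrite big_cons EFinD; apply: le_trans (measureU2 _ _ _) _ => //.
exact: leeD.
Qed.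

Lemma outer_le_geometric (X : nat -> set T) (b : R) : (0 <= b)%R ->
  (forall j, outer_le (X j) (b / 2 ^+ j)) -> outer_le (\bigcup_j X j) (2 * b)%R.
Proof.
move=> b0 /choice[E EP]; exists (\bigcup_j E j); split.
- by apply: bigcupT_measurable => j; case: (EP j).
- by apply: subset_bigcup => j _; case: (EP j).
apply: le_trans (measure_sigma_subadditive P _ _ (@subset_refl _ _)) _.
- by move=> j; case: (EP j).
- by apply: bigcupT_measurable => j; case: (EP j).
apply: lime_le; first exact: is_cvg_nneseries.
apply: nearW => k; apply: (@le_trans _ _ (\sum_(0 <= j < k) (b / 2 ^+ j)%:E)).
  by apply: lee_sum => j _; case: (EP j).
rewrite sumEFin lee_fin.
suff -> : (\sum_(0 <= j < k) b / 2 ^+ j = 2 * b - 2 * b / 2 ^+ k)%R.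
  by rewrite gerBl divr_ge0 ?mulr_ge0// exprn_ge0.
elim: k => [|k IH]; first by rewrite big_nil expr0 divr1 subrr.
rewrite big_nat_recr//= IH exprS.
have : (2 ^+ k != 0 :> R)%R by rewrite expf_neq0.
by move: (2 ^+ k)%R => q q0; field.
Qed.

Lemma outer_le_nondecreasing (X : nat -> set T) (b : R) :
  (forall j, measurable (X j)) -> nondecreasing_seq X ->
  (forall j, P (X j) <= b%:E) -> outer_le (\bigcup_j X j) b.
Proof.
move=> mX ndX Xb; exists (\bigcup_j X j); split => //.
  exact: bigcupT_measurable.
have c := @nondecreasing_cvg_mu _ _ _ P X mX (bigcupT_measurable _ mX) ndX.
rewrite -(cvg_lim _ c)//; apply: lime_le; first by apply/cvg_ex; eexists; exact: c.
exact: nearW.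
Qed.

Lemma outer_le_negligible (X : set T) :
  (forall e : R, (0 < e)%R -> outer_le X e) -> P.-negligible X.
Proof.
move=> H; have /choice[E EP] : forall k : nat, exists E,
    [/\ measurable E, X `<=` E & P E <= (k.+1%:R^-1)%:E].
  by move=> k; apply: H; rewrite invr_gt0.
have mE : measurable (\bigcap_k E k).
  by apply: bigcapT_measurable => k; case: (EP k).
exists (\bigcap_k E k); split => //; last by move=> w Xw k _; case: (EP k) => _ + _; apply.
apply/eqP; rewrite eq_le measure_ge0 andbT; apply/lee_addgt0Pr => e e0; rewrite add0e.
have [k ke] : exists k : nat, (k.+1%:R^-1 <= e :> R)%R.
  exists (Num.trunc e^-1); rewrite invf_ple ?posrE//; exact/ltW/truncnS_gt.
apply: (@le_trans _ _ (P (E k))).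
  by apply: measure_mono => //; [case: (EP k)|exact: bigcap_inf].
by case: (EP k) => _ _ h; apply: le_trans h _; rewrite lee_fin.
Qed.

End outer_bounds.

(** * The second moment method *)

Section second_moment.
Context (disp : measure_display) (T : measurableType disp) (R : realType)
  (P : probability T R).

(** Integrates [2 t f <= t ^+ 2 1_U + f ^+ 2], where [f] counts the events that occur: on [U] this
    is [(t - f) ^+ 2 >= 0], and off [U] all terms vanish. *)
Lemma second_moment (I : eqType) (s : seq I) (E : I -> set T) (t : R) : 0 <= t ->
  (forall i, measurable (E i)) ->
  2 * t * (\sum_(i <- s) fine (P (E i))) <=
  t ^+ 2 * fine (P [set w | exists2 i, i \in s & E i w]) +
  \sum_(i <- s) \sum_(j <- s) fine (P (E i `&` E j)).
Proof.
move=> t0 mE; set U := [set w | _].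
have mU : measurable U.
  rewrite /U; elim: (s) => [|i s' IH].
    rewrite (_ : [set w | _] = set0)//.
    by rewrite -subset0 => w [].
  rewrite (_ : [set w | _] = E i `|` [set w | exists2 i, i \in s' & E i w]).
    exact: measurableU.
  apply/seteqP; split => w.
    by move=> [j]; rewrite inE => /orP[/eqP ->|js] Ew; [left|right; exists j].
  move=> [Ew|[j js Ew]]; first by exists i; rewrite // inE eqxx.
  by exists j; rewrite // inE js orbT.
have ind (C : set T) : measurable C -> (\int[P]_w (\1_C w)%:E)%E = (fine (P C))%:E.
  by move=> mC; rewrite integral_indic// setIT fineK// fin_num_measure.
have mind (C : set T) : measurable C ->
    measurable_fun [set: T] (fun w => (\1_C w : R)%:E).
  by move=> mC; apply/measurable_EFinP; exact: measurable_indic.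

have sums (J : Type) (r : seq J) (C : J -> set T) : (forall j, measurable (C j)) ->
    (\int[P]_w (\sum_(j <- r) \1_(C j) w)%:E)%E = (\sum_(j <- r) fine (P (C j)))%:E.
  move=> mC; under eq_integral do rewrite -sumEFin.
  rewrite ge0_integral_sum//; last by move=> j; exact: mind.
  by rewrite -sumEFin; apply: eq_bigr => j _; exact: ind.
have ge0 (J : Type) (r : seq J) (C : J -> set T) w : 0 <= \sum_(j <- r) (\1_(C j) w : R).
  by apply: sumr_ge0 => j _; rewrite indicE.
have msum (J : Type) (r : seq J) (C : J -> set T) : (forall j, measurable (C j)) ->
    measurable_fun [set: T] (fun w => (\sum_(j <- r) \1_(C j) w : R)%:E).
  move=> mC; under eq_fun do rewrite -sumEFin.
  by apply: emeasurable_sum => j; exact: mind.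
pose C2 (ij : I * I) := E ij.1 `&` E ij.2.
pose s2 := [seq (i, j) | i <- s, j <- s].
have mC2 ij : measurable (C2 ij) by exact: measurableI.
have -> : \sum_(i <- s) \sum_(j <- s) fine (P (E i `&` E j)) =
    \sum_(ij <- s2) fine (P (C2 ij)) by rewrite big_allpairs.
have : (\int[P]_w ((2 * t)%:E * (\sum_(i <- s) (\1_(E i) w : R))%:E) <=
    \int[P]_w ((t ^+ 2)%:E * (\1_U w : R)%:E + (\sum_(ij <- s2) (\1_(C2 ij) w : R))%:E))%E.
  apply: ge0_le_integral => //.
  - by move=> w _; rewrite mule_ge0// lee_fin ?ge0// mulr_ge0.
  - by apply: emeasurable_funM; [exact: measurable_cst|exact: msum].
  - apply: emeasurable_funD; last exact: msum.
    by apply: emeasurable_funM; [exact: measurable_cst|exact: mind].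
  move=> w _; rewrite -!EFinM -EFinD lee_fin.
  have -> : \sum_(ij <- s2) (\1_(C2 ij) w : R) = (\sum_(i <- s) (\1_(E i) w : R)) ^+ 2.
    rewrite big_allpairs expr2 big_distrlr/=; apply: eq_bigr => i _.
    by apply: eq_bigr => j _; rewrite /C2/= indicI.
  have [wU|wU] := boolP (w \in U).
    rewrite [X in _ * X + _]indicE wU mulr1.
    set f := \sum_(i <- s) _; have := sqr_ge0 (t - f); rewrite sqrrB; lra.
  rewrite big_seq big1 ?mulr0 ?expr0n ?addr0 ?mulr_ge0 ?sqr_ge0 ?indicE//.
  move=> i si; rewrite indicE; case: (boolP (w \in E i)) => // /set_mem Ew.
  by move: wU; rewrite mem_set//; exists i.
rewrite ge0_integralZl_EFin//; last 3 first.
- by move=> w _; rewrite lee_fin ge0.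
- exact: msum.
- by rewrite mulr_ge0.
rewrite ge0_integralD//; last 4 first.
- by move=> w _; rewrite mule_ge0// lee_fin ?sqr_ge0 ?indicE.
- by apply: emeasurable_funM; [exact: measurable_cst|exact: mind].
- by move=> w _; rewrite lee_fin ge0.
- exact: msum.
have -> : (\int[P]_w ((t ^+ 2)%:E * (\1_U w : R)%:E))%E = (t ^+ 2 * fine (P U))%:E.
  rewrite (EFinM (t ^+ 2)) -(ind _ mU); apply: ge0_integralZl_EFin => //; last exact: sqr_ge0.
  exact: mind.
by rewrite !sums// -!EFinM -EFinD lee_fin.
Qed.

End second_moment.

(** * Occupation events: probabilities, independence, several distinct lines *)

Section poisson_process.
Variables (R : realType) (n : nat).
Local Notation lines := (line R n).
Variables (Lam : {measure set lines -> \bar R}).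
Context (disp : measure_display) (T : measurableType disp) (P : probability T R).
Variable omega : T -> {measure set lines -> \bar R}.
Hypothesis homega : is_poisson_process P Lam omega.
Local Open Scope ereal_scope.
Implicit Types A B : set lines.

Definition occ A : set T := [set w | 0 < omega w A].

Lemma occP A w : measurable A ->
  occ A w <-> exists2 L, support (omega w) L & A L.
Proof. by move=> mA; apply: pm_gt0P => //; case: homega. Qed.

Lemma voidE A : ~` occ A = [set w | omega w A = 0].
Proof.
apply/seteqP; split => w /=; rewrite /occ/= lt_neqAle measure_ge0 andbT.
  by move=> /negP; rewrite negbK => /eqP.
by move=> ->; rewrite eqxx.
Qed.

Lemma void_measurable A : measurable A -> measurable (~` occ A).
Proof.
have [_ H _ _ _] := homega => mA; rewrite voidE.
have := H A mA measurableT [set 0] (emeasurable_set1 _).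
by rewrite setTI.
Qed.

Lemma occ_measurable A : measurable A -> measurable (occ A).
Proof. by move=> /void_measurable/measurableC; rewrite setCK. Qed.

Lemma occU A B : measurable A -> measurable B -> occ (A `|` B) = occ A `|` occ B.
Proof.
move=> mA mB; apply/seteqP; split => w.
  by move=> /(occP _ (measurableU _ _ mA mB))[L SL [h|h]]; [left|right];
    apply/occP => //; exists L.
by move=> [|] /occP[]// L SL h; apply/(occP _ (measurableU _ _ mA mB));
  exists L => //; [left|right].
Qed.

Lemma void_prob A : measurable A -> Lam A < +oo ->
  P (~` occ A) = (expR (- fine (Lam A)))%:E.
Proof.
move=> mA fA; have [_ _ H _ _] := homega.
have := H A mA fA 0%N; rewrite voidE => ->.
rewrite /poisson_prob; case: ifPn => [l0|].
  rewrite esum_set1 ?lee_fin ?poisson_pmf_ge0//.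
  by rewrite /poisson_pmf l0 expr0 fact0 invr1 !mul1r.
rewrite -leNgt => l0; have -> : fine (Lam A) = 0%R.
  by apply/eqP; rewrite eq_le l0 fine_ge0.
by rewrite diracE mem_set// oppr0 expR0.
Qed.

Lemma occ_prob A : measurable A -> Lam A < +oo ->
  P (occ A) = (1 - expR (- fine (Lam A)))%:E.
Proof.
move=> mA fA; rewrite -(setCK (occ A)) probability_setC ?void_prob//.
exact: void_measurable.
Qed.

Lemma occ_prob_le A : measurable A -> P (occ A) <= Lam A.
Proof.
move=> mA; have [fA|] := ltP (Lam A) +oo; last first.
  by rewrite leye_eq => /eqP ->; rewrite leey.
rewrite occ_prob// -[leRHS]fineK ?ge0_fin_numE// lee_fin.
by have := expR_ge1Dx (- fine (Lam A)); lra.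
Qed.

(** On [[0, 1]], [1 - expR (- a) >= a / (1 + a) >= a / 2]. *)
Lemma occ_prob_ge A (a : R) : measurable A -> Lam A < +oo -> (0 <= a <= 1)%R ->
  a%:E <= Lam A -> (a / 2)%:E <= P (occ A).
Proof.
move=> mA fA /andP[a0 a1] aA; rewrite occ_prob// lee_fin.
have {}aA : (a <= fine (Lam A))%R by rewrite -lee_fin fineK// ge0_fin_numE.
have h1 : (expR (- fine (Lam A)) <= expR (- a))%R by rewrite ler_expR lerN2.
have h2 : (1 + a <= expR a)%R := expR_ge1Dx a.
have h3 : (expR (- a) * expR a = 1)%R by rewrite -expRD addNr expR0.
by have h4 := expR_gt0 (- a); nra.
Qed.

Lemma void_indep2 A B : measurable A -> measurable B -> A `&` B = set0 ->
  P (~` occ A `&` ~` occ B) = P (~` occ A) * P (~` occ B).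
Proof.
move=> mA mB AB; have [_ _ _ _ H] := homega.
pose C (i : 'I_2) := if val i == 0%N then A else B.
have mC i : measurable (C i) by rewrite /C; case: ifP.
have tC : trivIset [set: 'I_2] C.
  apply/trivIsetP => -[[|[|//]] hi] [[|[|//]] hj] _ _; rewrite /C//= => ij.
  by rewrite setIC.
have := H 2%N C mC tC (fun _ => [set 0]) (fun _ => emeasurable_set1 _).
rewrite big_ord_recl big_ord1 /= !voidE => <-; congr (P _).
apply/seteqP; split => w /=; first by move=> [h1 h2] [[|[|//]] hi] _.
move=> h; split.
  exact: (h ord0).
exact: (h (lift ord0 ord0)).
Qed.

(* The events that depend only on the lines of the process lying in [A]; they are
   generated by void events, which form a pi-system. *)
Definition local_events (A : set lines) : set (set T) :=
  <<s [set E | exists B, [/\ measurable B, B `<=` A & E = ~` occ B]] >>.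

Lemma local_measurable A E : local_events A E -> measurable E.
Proof.
apply: smallest_sub; first exact: sigma_algebra_measurable.
by move=> _ [B [mB _ ->]]; exact: void_measurable.
Qed.

Lemma local_mono A B : A `<=` B -> local_events A `<=` local_events B.
Proof.
move=> AB; apply: sub_smallest2r.
  exact: smallest_sigma_algebra.
by move=> _ [C [mC CA ->]]; exists C; split => //; exact: subset_trans AB.
Qed.

Lemma local_occ A B : measurable B -> B `<=` A -> local_events A (occ B).
Proof.
move=> mB BA; rewrite -(setCK (occ B)).
have [_ H _] := smallest_sigma_algebra [set: T]
  [set E | exists B, [/\ measurable B, B `<=` A & E = ~` occ B]].
rewrite -setTD; apply: H; apply: sub_sigma_algebra.
by exists B.
Qed.

Let void_setI A : setI_closed [set E | exists B, [/\ measurable B, B `<=` A & E = ~` occ B]].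
Proof.
move=> _ _ [B [mB BA ->]] [C [mC CA ->]]; exists (B `|` C); split.
- exact: measurableU.
- by move=> L [/BA|/CA].
- by rewrite occU// setCU.
Qed.

Let occ0 : occ set0 = set0.
Proof. by rewrite -subset0 => w; rewrite /occ/= measure0 ltxx. Qed.

(** For fixed [G] the finite measures [E |-> P (E & G)] and [E |-> P E * P G] agree as soon as they
    agree on the pi-system of void events; this is used once for each factor. *)
Lemma local_indep A B E F : A `&` B = set0 -> local_events A E -> local_events B F ->
  P (E `&` F) = P E * P F.
Proof.
move=> AB; have step (G : set T) : measurable G -> forall A',
    (forall C, measurable C -> C `<=` A' -> P (~` occ C `&` G) = P (~` occ C) * P G) ->
    forall E, local_events A' E -> P (E `&` G) = P E * P G.
  move=> mG A' AC E' AE'.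
  have mu1 := fine_ge0 (measure_ge0 P G).
  pose m1 : {measure set T -> \bar R} := mrestr P mG.
  pose m2 : {measure set T -> \bar R} := mscale (NngNum mu1) P.
  have : m1 E' = m2 E'.
    apply: (@g_sigma_algebra_measure_unique _ _ _ _ _ (fun=> setT) _ _ m1 m2 _ _ _ E' AE').
    - by move=> _ [C [mC _ ->]]; exact: void_measurable.
    - move=> _; exists set0; split => //.
      by rewrite occ0 setC0.
    - by rewrite bigcup_const//; exists 0%N.
    - exact: void_setI.
    - move=> _ [C [mC CA ->]]; rewrite /m1 /m2 /= /mrestr /mscale /= AC//.
      by rewrite muleC fineK// fin_num_measure.
    - move=> _; rewrite /m1/= /mrestr setTI; exact: (le_lt_trans (probability_le1 P mG) (ltry _)).
  rewrite /m1 /m2 /= /mrestr /mscale /= => ->.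
  by rewrite fineK 1?muleC// fin_num_measure.
move=> AE BF; apply: (step F (local_measurable BF) A) => // C mC CA.
rewrite setIC muleC; apply: (step _ (void_measurable mC) B) => // D mD DB.
apply: void_indep2 => //; rewrite -subset0 -AB => L [/DB h /CA h']; by split.
Qed.

(** Either one line lies in both sets, or two lines lie in the disjoint differences, which are
    occupied independently. *)
Lemma occ2_prob_le A B : measurable A -> measurable B ->
  P (occ A `&` occ B) <= Lam (A `&` B) + Lam A * Lam B.
Proof.
move=> mA mB; have mAB : measurable (A `&` B) by exact: measurableI.
have mA' : measurable (A `\` B) by exact: measurableD.
have mB' : measurable (B `\` A) by exact: measurableD.
apply: (@le_trans _ _ (P (occ (A `&` B) `|` (occ (A `\` B) `&` occ (B `\` A))))).
  apply: measure_mono.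
  - by apply: measurableI; exact: occ_measurable.
  - apply: measurableU; first exact: occ_measurable.
    by apply: measurableI; exact: occ_measurable.
  - move=> w [/(occP _ mA)[L SL AL] /(occP _ mB)[L' SL' BL']].
    have [BL|nBL] := pselect (B L).
      by left; apply/(occP _ mAB); exists L.
    have [AL'|nAL'] := pselect (A L').
      by left; apply/(occP _ mAB); exists L'.
    by right; split; [apply/(occP _ mA'); exists L|apply/(occP _ mB'); exists L'].
apply: le_trans (measureU2 _ _ _) _.
- exact: occ_measurable.
- by apply: measurableI; exact: occ_measurable.
apply: leeD; first exact: occ_prob_le.
apply: (@le_trans _ _ (P (occ (A `\` B)) * P (occ (B `\` A)))).
  rewrite le_eqVlt; apply/orP; left; apply/eqP; apply: (@local_indep (A `\` B) (B `\` A)).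
  - by rewrite -subset0 => L [[? ?] [? ?]].
  - exact: local_occ.
  - exact: local_occ.
apply: lee_pmul => //.
  by apply: le_trans (occ_prob_le mA') _; apply: measure_mono => // L [].
by apply: le_trans (occ_prob_le mB') _; apply: measure_mono => // L [].
Qed.

Lemma occ_indep (k : nat) (A : 'I_k -> set lines) :
  (forall i, measurable (A i)) -> trivIset setT A ->
  P (\bigcap_(i in [set: 'I_k]) occ (A i)) = \prod_(i < k) P (occ (A i)).
Proof.
move=> mA tA; have [_ _ _ _ H] := homega.
have occE i : occ (A i) = (fun w => omega w (A i)) @^-1` (~` [set 0]).
  by rewrite -[LHS]setCK voidE.
under eq_bigr do rewrite occE.
under eq_bigcapr do rewrite occE.
by apply: H => // i; apply: measurableC; exact: emeasurable_set1.
Qed.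

Section many_lines.
Variables (k : nat) (A : 'I_k -> set lines) (H : nat -> set lines).
Hypothesis mA : forall i, measurable (A i).
Hypothesis fA : forall i, Lam (A i) < +oo.
Hypothesis mH : forall j, measurable (H j).
Hypothesis sepH : forall L L' : lines, L <> L' -> exists j, H j L /\ ~ H j L'.

(** The first [m] sets of the separating family cut the lines into finitely many cells; distinct
    lines are told apart once [m] is large. *)
Definition signature (m : nat) (L : lines) : {ffun 'I_m -> bool} :=
  [ffun j : 'I_m => `[< H j L >]].

Definition cell (m : nat) (b : {ffun 'I_m -> bool}) : set lines :=
  [set L | signature m L = b].

Lemma cell_measurable m b : measurable (@cell m b).
Proof.
have -> : cell b = \bigcap_(j in [set: 'I_m]) (if b j then H j else ~` H j).
  apply/seteqP; split => L.
    move=> <- j _; rewrite ffunE; case: (asboolP (H j L)) => //.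
  move=> h; apply/ffunP => j; rewrite ffunE; have := h j I.
  by case: (b j) => h'; [exact/asboolP|exact/asboolPn].
apply: fin_bigcap_measurable; first exact: finite_finset.
by move=> j _; case: (b j) => //; exact: measurableC.
Qed.

Definition distinct_cells (m : nat) : set T :=
  [set w | exists f : {ffun 'I_k -> {ffun 'I_m -> bool}}, injective f /\
    forall i, occ (A i `&` cell (f i)) w].

Lemma distinct_cellsP m w : distinct_cells m w <->
  exists Ls : 'I_k -> lines, injective (signature m \o Ls) /\
    forall i, support (omega w) (Ls i) /\ A i (Ls i).
Proof.
have mC i b : measurable (A i `&` @cell m b).
  by apply: measurableI => //; exact: cell_measurable.
split => [[f [fI fo]]|[Ls [LI LA]]].
  have /choice[Ls LsP] : forall i, exists L, support (omega w) L /\ (A i `&` cell (f i)) L.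
    by move=> i; have /(occP _ (mC i (f i)))[L SL AL] := fo i; exists L.
  exists Ls; split.
    move=> i j /=; have [_ [_ ->]] := LsP i; have [_ [_ ->]] := LsP j; exact: fI.
  by move=> i; have [? []] := LsP i.
exists [ffun i => signature m (Ls i)]; split.
  by move=> i j; rewrite !ffunE => /LI.
move=> i; apply/(occP _ (mC _ _)); have [? ?] := LA i; exists (Ls i) => //.
by split => //; rewrite /cell/= ffunE.
Qed.

Lemma distinct_cells_measurable m : measurable (distinct_cells m).
Proof.
have -> : distinct_cells m =
    \bigcup_(f in [set f : {ffun 'I_k -> {ffun 'I_m -> bool}} | injective f])
      \bigcap_(i in [set: 'I_k]) occ (A i `&` cell (f i)).
  apply/seteqP; split => w.
    by move=> [f [fI fo]]; exists f.
  by move=> [f fI fo]; exists f; split => // i; exact: fo.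
apply: fin_bigcup_measurable; first exact: finite_finset.
move=> f _; apply: fin_bigcap_measurable; first exact: finite_finset.
by move=> i _; apply: occ_measurable; apply: measurableI => //; exact: cell_measurable.
Qed.

(** Pieces in distinct cells are disjoint, hence occupied independently even where the [A i]
    overlap. Extending the sum from injective to all assignments of cells makes it factorize. *)
Lemma distinct_cells_prob m :
  P (distinct_cells m) <= (\prod_(i < k) fine (Lam (A i)))%:E.
Proof.
have mC i b : measurable (A i `&` @cell m b).
  by apply: measurableI => //; exact: cell_measurable.
have fC i b : Lam (A i `&` @cell m b) < +oo.
  by apply: le_lt_trans (fA i); apply: measure_mono => // L [].
pose a i b := fine (Lam (A i `&` @cell m b)).
have aE i b : Lam (A i `&` cell b) = (a i b)%:E by rewrite fineK// ge0_fin_numE.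
have a0 i b : (0 <= a i b)%R by rewrite fine_ge0.
pose F (f : {ffun 'I_k -> {ffun 'I_m -> bool}}) : set T :=
  if `[< injective f >] then \bigcap_(i in [set: 'I_k]) occ (A i `&` cell (f i)) else set0.
have mF f : measurable (F f).
  rewrite /F; case: ifP => // _; apply: fin_bigcap_measurable.
    exact: finite_finset.
  by move=> i _; exact: occ_measurable.
apply: (@le_trans _ _ (\sum_f P (F f))).
  apply: measure_cover; [exact: distinct_cells_measurable|exact: mF|].
  move=> w [f [fI fo]]; exists f; first exact: mem_index_enum.
  by rewrite /F; case: (asboolP (injective f)) => // _ i _; exact: fo.
apply: (@le_trans _ _ (\sum_(f : {ffun 'I_k -> {ffun 'I_m -> bool}}) (\prod_i a i (f i))%:E)).
  apply: lee_sum => f _; rewrite /F; case: (asboolP (injective f)) => fI; last first.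
    by rewrite measure0 lee_fin prodr_ge0.
  rewrite occ_indep//; last first.
    apply/trivIsetP => i j _ _ ij; rewrite -subset0 => L [[_ h] [_ h']].
    by move/eqP: ij; apply; apply: fI; rewrite -h -h'.
  have pE i : P (occ (A i `&` cell (f i))) = (fine (P (occ (A i `&` cell (f i)))))%:E.
    by rewrite fineK// fin_num_measure//; exact: occ_measurable.
  rewrite (eq_bigr _ (fun i _ => pE i)) prodEFin lee_fin; apply: ler_prod => i _; rewrite fine_ge0//=.
  by rewrite -lee_fin -pE -aE; exact: occ_prob_le.
rewrite sumEFin lee_fin -(bigA_distr_bigA (fun i b => a i b)).
apply: ler_prod => i _; rewrite sumr_ge0//= -lee_fin -sumEFin.
rewrite (eq_bigr (fun b => Lam (A i `&` cell b))); last by move=> b _; rewrite aE.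
rewrite fineK ?ge0_fin_numE// -[leRHS]mul1e.
apply: (@measure_multiplicity _ _ _ Lam _ (A i) (fun b => A i `&` cell b) 1) => //.
move=> L AL; apply/card_le1_eqP => b b'; rewrite !inE => /set_mem[_ h] /set_mem[_ h'].
by rewrite -h -h'.
Qed.

(** A factorial moment bound for overlapping sets, in the limit of finer cells: it is enough that
    [m] exceeds the index of one separating set per pair of lines. *)
Lemma many_lines :
  outer_le P [set w | exists Ls : 'I_k -> lines, injective Ls /\
    forall i, support (omega w) (Ls i) /\ A i (Ls i)]
  (\prod_(i < k) fine (Lam (A i)))%R.
Proof.
have [E [mE DE Eb]] : outer_le P (\bigcup_m distinct_cells m)
    (\prod_(i < k) fine (Lam (A i)))%R.
  apply: outer_le_nondecreasing.
  - exact: distinct_cells_measurable.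
  - move=> m m' mm'; apply/subsetPset => w /distinct_cellsP[Ls [LI LA]].
    apply/distinct_cellsP; exists Ls; split => // i j /= h; apply: LI => /=.
    apply/ffunP => l; have := congr1 (fun g : {ffun 'I_m' -> bool} => g (widen_ord mm' l)) h.
    by rewrite !ffunE.
  - exact: distinct_cells_prob.
exists E; split => //; apply: subset_trans DE => w [Ls [LI LA]].
have /choice[J JP] : forall ij : 'I_k * 'I_k, exists l : nat,
    ij.1 != ij.2 -> H l (Ls ij.1) /\ ~ H l (Ls ij.2).
  move=> [i j]; have [->|ij] := eqVneq i j; first by exists 0%N.
  have : Ls i <> Ls j by move/LI/eqP; apply/negP.
  by move=> /sepH[l h]; exists l.
pose m := (\max_ij J ij).+1; exists m => //; apply/distinct_cellsP.
exists Ls; split => // i j /= h; apply/eqP; apply: contraT => ij.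
have [h1 h2] := JP (i, j) ij.
have lm : (J (i, j) < m)%N by rewrite ltnS; apply: leq_bigmax.
have := congr1 (fun g : {ffun 'I_m -> bool} => g (Ordinal lm)) h.
by rewrite !ffunE/= (asboolT h1) (asboolF h2).
Qed.

End many_lines.

End poisson_process.

(** * Second moment of the number of chains *)

Section chain_sums.
Variables (R : realType) (V : eqType) (v0 : V) (Z : nat -> seq V) (near : V -> V -> V -> bool).
Variables (n : nat) (N : nat) (C : R).
Local Notation m := n.-1.
Local Notation r := (N%:R : R).
Local Notation q := ((r ^+ n)^-1).

(* Chains are listed from their last point to their first one. *)
Fixpoint chains (k : nat) : seq (seq V) :=
  if k is k'.+1 then [seq z :: s | s <- chains k', z <- Z k'.+1]
  else [seq [:: z] | z <- Z 0%N].

(* Up to the factor [(C ^+ 2 * q) ^+ k], [weight s s'] bounds the probability that two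
   chains of [k] lines both occur: at each step either one line serves both chains,
   which forces [near], or two lines are needed, which costs another factor [q]. *)
Fixpoint weight (s s' : seq V) : R :=
  match s, s' with
  | z1 :: ((z0 :: _) as t), y1 :: ((y0 :: _) as t') =>
    ((near z0 z1 y0 && near z0 z1 y1)%:R + q) * weight t t'
  | _, _ => 1
  end.

Lemma chainsP k s : s \in chains k.+1 -> exists z1 z0 t,
  [/\ s = z1 :: z0 :: t, z1 \in Z k.+1, z0 \in Z k & z0 :: t \in chains k].
Proof.
elim: k s => [|k IH] s.
  move=> /allpairsP[[t z1] /= [/mapP[z0 z0Z ->] z1Z ->]].
  by exists z1, z0, [::]; split => //; apply/mapP; exists z0.
move=> /allpairsP[[t z1] /= [tc z1Z ->]].
have [z0 [z [t' [te z0Z zZ t'c]]]] := IH t tc.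
by exists z1, z0, (z :: t'); split; rewrite ?te// -te.
Qed.

Hypothesis n2 : (2 <= n)%N.
Hypothesis N1 : (1 <= N)%N.
Hypothesis C1 : 1 <= C.
Hypothesis size_end : size (Z 0%N) = N /\ size (Z m) = N.
Hypothesis size_mid : forall i, (0 < i < m)%N -> size (Z i) = (N ^ n.+1)%N.
Hypothesis near_start : forall z0 z1, z0 \in Z 0%N -> z1 \in Z 1%N ->
  \sum_(y <- Z 0%N) (near z0 z1 y)%:R <= C.
Hypothesis near_stop : forall z0 z1, z0 \in Z m.-1 -> z1 \in Z m ->
  \sum_(y <- Z m) (near z0 z1 y)%:R <= C.
Hypothesis near_left : forall i z0 z1, (0 < i < m)%N -> z0 \in Z i -> z1 \in Z i.+1 ->
  \sum_(y <- Z i) (near z0 z1 y)%:R <= C * r.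
Hypothesis near_right : forall i z0 z1, (i.+1 < m)%N -> z0 \in Z i -> z1 \in Z i.+1 ->
  \sum_(y <- Z i.+1) (near z0 z1 y)%:R <= C * r.
Hypothesis near_turn : forall i z0 z1 z2, (i.+1 < m)%N ->
  z0 \in Z i -> z1 \in Z i.+1 -> z2 \in Z i.+2 ->
  \sum_(y <- Z i.+1) (near z0 z1 y && near z1 z2 y)%:R <= C.

Let r1 : 1 <= r. Proof. by rewrite ler1n. Qed.
Let r0 : 0 < r. Proof. by rewrite ltr0n. Qed.
Let C0 : 0 <= C. Proof. exact: le_trans C1. Qed.
Let q0 : 0 <= q. Proof. by rewrite invr_ge0 exprn_ge0// ltW. Qed.
Let rnq : r ^+ n * q = 1. Proof. by rewrite mulfV// expf_neq0// gt_eqF. Qed.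
Let rkq k : (k <= n)%N -> r ^+ k * q <= 1.
Proof. move=> kn; apply: (@le_trans _ _ (r ^+ n * q)); last by rewrite rnq.
by apply: ler_wpM2r => //; exact: ler_weXn2l. Qed.

Lemma sum_chainsS k (F : seq V -> R) :
  \sum_(s <- chains k.+1) F s = \sum_(s <- chains k) \sum_(z <- Z k.+1) F (z :: s).
Proof. by rewrite /= big_allpairs_dep. Qed.

Let S k (h : V -> R) := \sum_(y <- Z k) h y.
Let Nr k z0 z1 (h : V -> R) := \sum_(y <- Z k) (near z0 z1 y)%:R * h y.

(** The sum over the last point [y'] of the second chain, as a function of its last but one point
    [y]; it is the new test function in the induction. *)
Let h2 z0 z1 k (h : V -> R) (y : V) : R :=
  \sum_(y' <- Z k) ((near z0 z1 y && near z0 z1 y')%:R + q) * h y'.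

Let h2E z0 z1 k h y : h2 z0 z1 k h y = (near z0 z1 y)%:R * Nr k z0 z1 h + q * S k h.
Proof.
rewrite /h2 /Nr /S !mulr_sumr -big_split; apply: eq_bigr => y' _ /=.
by rewrite mulrDl; congr (_ + _); case: (near z0 z1 y); rewrite /= ?mul1r ?mul0r.
Qed.

(** The test function [h] on the last point makes the induction possible. [r ^+ k * q] is the order
    of the expected number of chains of [k] lines that end at a given point, and [Nr] accounts for
    the points near the last line of the first chain. *)
Lemma weight_sum k z1 z0 t h : (0 < k <= m)%N -> z1 :: z0 :: t \in chains k ->
  (forall y, 0 <= h y) ->
  \sum_(s <- chains k) weight (z1 :: z0 :: t) s * h (head v0 s) <=
  2 ^+ k * C ^+ k * (r ^+ k * q * S k h + Nr k z0 z1 h).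
Proof.
elim: k z1 z0 t h => [//|k IH] z1 z0 t h km sk h0.
have S0 j : 0 <= S j h by exact: sumr_ge0.
have Nr0 j x y : 0 <= Nr j x y h by apply: sumr_ge0 => w _; rewrite mulr_ge0.
have [a [b [c [E z1Z z0Z tc]]]] := chainsP sk; case: E => ? ? ?; subst a b c.
case: k IH km sk z1Z z0Z tc => [|k] IH km sk z1Z z0Z tc.
  rewrite !expr1 sum_chainsS big_map.
  rewrite (eq_bigr (h2 z0 z1 1 h)); last first.
    move=> y _; apply: eq_bigr => y' _ /=; case: (t) => [|? ?]; rewrite mulr1//.
  rewrite (eq_bigr _ (fun y _ => h2E z0 z1 1 h y)) big_split/= -!mulr_suml.
  have -> : \sum_(y <- Z 0%N) q = r * q.
    by rewrite big_const_seq count_predT iter_addr_0 size_end.1 -[LHS]mulr_natl.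
  have := near_start z0Z z1Z; set a := \sum_(y <- _) _ => aC.
  have := ler_wpM2r (Nr0 1%N z0 z1) aC => h1.
  have h3 : 0 <= r * q * S 1 h by rewrite !mulr_ge0// ltW.
  have := ler_wpM2r h3 C1; have := mulr_ge0 C0 (Nr0 1%N z0 z1).
  have := mulr_ge0 C0 h3.
  by rewrite -mulrA mulrDr; lra.
have [a [w0 [t' [E _ w0Z t'c]]]] := chainsP tc; case: E => ? ?; subst a t.
have kn : (k.+2 <= n)%N by move: km n2; clear; lia.
have km1 : (k.+1 < m)%N by move: km; clear; lia.
rewrite sum_chainsS big_seq.
rewrite (eq_bigr (fun s => weight [:: z0, w0 & t'] s * h2 z0 z1 k.+2 h (head v0 s))); last first.
  move=> s sc; have [y1 [y0 [u [-> _ _ _]]]] := chainsP sc.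
  rewrite mulr_sumr; apply: eq_bigr => y' _ /=; ring.
rewrite -big_seq.
have h20 y : 0 <= h2 z0 z1 k.+2 h y.
  by apply: sumr_ge0 => y' _; rewrite mulr_ge0// addr_ge0.
apply: le_trans (IH z0 w0 t' _ _ tc h20) _; first by move: km; clear; lia.
have -> : S k.+1 (h2 z0 z1 k.+2 h) =
    (\sum_(y <- Z k.+1) (near z0 z1 y)%:R) * Nr k.+2 z0 z1 h + r * S k.+2 h.
  rewrite /S (eq_bigr _ (fun y _ => h2E z0 z1 k.+2 h y)) big_split/= -!mulr_suml.
  congr (_ + _); rewrite big_const_seq count_predT iter_addr_0 size_mid ?km1//.
  have -> : q *+ (N ^ n.+1) = r.
    by rewrite -[LHS]mulr_natl natrX exprSr mulrAC rnq mul1r.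
  by [].
have -> : Nr k.+1 w0 z0 (h2 z0 z1 k.+2 h) =
    (\sum_(y <- Z k.+1) (near w0 z0 y && near z0 z1 y)%:R) * Nr k.+2 z0 z1 h +
    (\sum_(y <- Z k.+1) (near w0 z0 y)%:R) * (q * S k.+2 h).
  rewrite {1}/Nr !mulr_suml -big_split; apply: eq_bigr => y _ /=.
  rewrite h2E mulrDr mulrA; congr (_ * _ + _).
  by case: (near w0 z0 y); rewrite /= ?mul1r ?mul0r.
have := near_left (i := k.+1) km1 z0Z z1Z.
have := near_right km1 w0Z z0Z.
have := near_turn km1 w0Z z0Z z1Z.
(* [a1] counts points near both lines through [z0], [a2] those near the line towards [w0], [a3]
   those near the line towards [z1]. The last two, of order [r], are compensated by powers of [q];
   [a1] is not and has to be bounded. *)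
set a1 := \sum_(y <- _) _; set a2 := \sum_(y <- _) _; set a3 := \sum_(y <- _) _.
move=> ha1 ha2 ha3.
have K0 : 0 <= 2 ^+ k.+1 * C ^+ k.+1 by rewrite mulr_ge0// exprn_ge0.
rewrite (exprS 2 k.+1) (exprS C k.+1).
have -> : 2 * 2 ^+ k.+1 * (C * C ^+ k.+1) = 2 ^+ k.+1 * C ^+ k.+1 * (2 * C) by ring.
rewrite -[leRHS]mulrA ler_wpM2l//.
have rk0 : 0 <= r ^+ k.+1 * q by rewrite mulr_ge0// exprn_ge0// ltW.
have b1 : r ^+ k.+1 * q * (a3 * Nr k.+2 z0 z1 h + r * S k.+2 h) <=
    C * Nr k.+2 z0 z1 h + r ^+ k.+2 * q * S k.+2 h.
  have -> : r ^+ k.+2 * q * S k.+2 h = r ^+ k.+1 * q * (r * S k.+2 h).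
    by rewrite (exprSr r k.+1); ring.
  rewrite mulrDr lerD2r mulrA ler_wpM2r//.
  apply: le_trans (ler_wpM2l rk0 ha3) _.
  have -> : r ^+ k.+1 * q * (C * r) = C * (r ^+ k.+2 * q) by rewrite (exprSr r k.+1); ring.
  by rewrite ler_piMr// rkq.
have b2 : a2 * (q * S k.+2 h) <= C * (r ^+ k.+2 * q * S k.+2 h).
  have qS : 0 <= q * S k.+2 h by rewrite mulr_ge0.
  apply: le_trans (ler_wpM2r qS ha2) _.
  rewrite -[X in X <= _]mulrA ler_wpM2l// -mulrA.
  by apply: ler_wpM2r => //; exact: ler_eXnr.
have b3 : a1 * Nr k.+2 z0 z1 h <= C * Nr k.+2 z0 z1 h by rewrite ler_wpM2r.
have b4 : 0 <= r ^+ k.+2 * q * S k.+2 h.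
  by apply: mulr_ge0 => //; apply: mulr_ge0 => //; apply: exprn_ge0.
have b5 := ler_wpM2r b4 C1.
rewrite -[leRHS]mulrA [X in _ <= _ * X]mulrDr; move: b1 b2 b3 b5; rewrite mul1r.
move: (r ^+ k.+2 * q * S k.+2 h) => w1; move: (_ * _ * (a3 * _ + _)) => w2.
move: (a2 * _) => w3; move: (a1 * _) => w4; move: (C * Nr _ _ _ _) => w5.
by move: (C * w1) => w6; lra.
Qed.

Lemma weight_total s : s \in chains m ->
  \sum_(s' <- chains m) weight s s' <= 2 * (2 ^+ m * C ^+ m * C).
Proof.
move=> sm; have mE : m = m.-1.+1 by move: n2; clear; lia.
have [z1 [z0 [t [sE z1Z z0Z _]]]] : exists z1 z0 t,
    [/\ s = z1 :: z0 :: t, z1 \in Z m.-1.+1, z0 \in Z m.-1 & z0 :: t \in chains m.-1].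
  by apply: chainsP; rewrite -mE.
rewrite -mE in z1Z; rewrite sE in sm *.
have m0 : (0 < m <= m)%N by rewrite leqnn andbT; move: n2; clear; lia.
have := weight_sum (h := fun _ => 1) m0 sm (fun _ => ler01).
under eq_bigr do rewrite mulr1.
move=> /le_trans; apply.
have -> : 2 * (2 ^+ m * C ^+ m * C) = 2 ^+ m * C ^+ m * (2 * C) by ring.
rewrite ler_wpM2l ?mulr_ge0 ?exprn_ge0//.
have -> : S m (fun _ => 1) = r.
  by rewrite /S big_const_seq count_predT iter_addr_0 size_end.2.
have -> : Nr m z0 z1 (fun _ => 1) = \sum_(y <- Z m) (near z0 z1 y)%:R.
  by rewrite /Nr; under eq_bigr do rewrite mulr1.
have := near_stop z0Z z1Z.
have -> : r ^+ m * q * r = 1.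
  rewrite mulrAC -exprSr (_ : m.+1 = n) ?rnq//; move: n2; clear; lia.
by move: C1; lra.
Qed.

(** Since [2 + n.+1 * (n - 2) = n * m], this number cancels [q ^+ m]: the expected number of chains
    has order 1. *)
Lemma size_chains : (size (chains m) = N ^ (n * m))%N.
Proof.
have H k : (k < m)%N -> (size (chains k) = N ^ (1 + n.+1 * k))%N.
  elim: k => [_|k IH km]; first by rewrite size_map size_end.1 muln0 expn1.
  have kZ : size (Z k.+1) = (N ^ n.+1)%N by exact: size_mid.
  rewrite [chains k.+1]/= size_allpairs (IH (ltnW km)) kZ.
  by rewrite -expnD; congr (_ ^ _)%N; lia.
have mE : m = m.-1.+1 by move: n2; clear; lia.
have -> : size (chains m) = (size (chains m.-1) * size (Z m))%N.
  by rewrite [in LHS]mE [chains _]/= size_allpairs -mE.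
rewrite H; last by move: n2; clear; lia.
rewrite size_end.2 -expnSr; congr (_ ^ _)%N.
by case: (n) n2 => [//|[//|k]] _ /=; lia.
Qed.

End chain_sums.

Section local_closure.
Variables (R : realType) (n : nat).
Local Notation lines := (line R n).
Context (disp : measure_display) (T : measurableType disp)
  (omega : T -> {measure set lines -> \bar R}).
Implicit Types A : set lines.

Lemma local_setI A E F : local_events omega A E -> local_events omega A F ->
  local_events omega A (E `&` F).
Proof.
exact: (@measurableI _ (g_sigma_algebraType
  [set E | exists B, [/\ measurable B, B `<=` A & E = ~` occ omega B]])).
Qed.

Lemma local_setC A E : local_events omega A E -> local_events omega A (~` E).
Proof.
exact: (@measurableC _ (g_sigma_algebraType
  [set E | exists B, [/\ measurable B, B `<=` A & E = ~` occ omega B]])).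
Qed.

Lemma local_setT A : local_events omega A setT.
Proof.
exact: (@measurableT _ (g_sigma_algebraType
  [set E | exists B, [/\ measurable B, B `<=` A & E = ~` occ omega B]])).
Qed.

Lemma local_seqU A (I : eqType) (s : seq I) (E : I -> set T) :
  (forall i, i \in s -> local_events omega A (E i)) ->
  local_events omega A [set w | exists2 i, i \in s & E i w].
Proof.
elim: s => [|i s IH] h.
  have := @local_setC A _ (@local_setT A); congr (local_events omega A _).
  by apply/seteqP; split => w //= [].
have -> : [set w | exists2 j, j \in i :: s & E j w] =
    ~` (~` E i `&` ~` [set w | exists2 i, i \in s & E i w]).
  apply/seteqP; split => w /=.
    by move=> [j]; rewrite inE => /orP[/eqP ->|js] Ew [h1 h2]; [exact: h1|apply: h2; exists j].
  move=> /not_andP[/contrapT Ew|/contrapT[j js Ew]].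
    by exists i; rewrite // inE eqxx.
  by exists j; rewrite // inE js orbT.
refine (local_setC (local_setI (local_setC _) (local_setC _))).
  by apply: h; rewrite inE eqxx.
by apply: IH => j js; apply: h; rewrite inE js orbT.
Qed.

End local_closure.

(** * Chains realized by lines of the process *)

Section chain_events.
Variables (R : realType) (n : nat).
Local Notation lines := (line R n).
Local Notation V := 'rV[R]_n.+1.
Variables (Lam : {measure set lines -> \bar R}).
Context (disp : measure_display) (T : measurableType disp) (P : probability T R).
Variable omega : T -> {measure set lines -> \bar R}.
Hypothesis homega : is_poisson_process P Lam omega.

Definition near3 (a b c : V) : bool :=
  `[< exists L : lines, [/\ hit a 1 L, hit b 1 L & hit c 1 L] >].

Fixpoint chain_event (s : seq V) : set T :=
  if s is b :: ((a :: _) as t) then occ omega (two_hit 1 a b) `&` chain_event t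
  else setT.

Lemma chain_event_reach s w (L L' : lines) (z : V) : chain_event (z :: s) w ->
  hit (last z s) 1 L -> hit z 1 L' -> reach (support (omega w)) (size s) L L'.
Proof.
elim: s z L' => [|y s IH] z L' /=; first by move=> _ ? ?; exists z.
move=> [/(occP homega _ (@two_hit_measurable _ _ 1 y z ler01))[l Sl [ly lz]] ws] Ll zL'.
exists l; split => //; first exact: (IH y l ws Ll ly).
by exists z.
Qed.

Lemma chain_event_measurable s : measurable (chain_event s).
Proof.
elim: s => [|b [|a t] IH] //=.
apply: measurableI => //; apply: (occ_measurable homega).
exact (@two_hit_measurable _ _ 1 a b ler01).
Qed.

Variables (Z : nat -> seq V) (N : nat) (cls : nat -> set lines) (c C : R).
Local Notation m := n.-1.
Local Notation q := ((N%:R ^+ n)^-1 : R).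
Hypothesis N1 : (1 <= N)%N.
Hypothesis c01 : 0 < c <= 1.
Hypothesis C1 : 1 <= C.
Hypothesis hcls : forall i a b, (i < m)%N -> a \in Z i -> b \in Z i.+1 ->
  two_hit 1 a b `<=` cls i.
Hypothesis dcls : forall i j, (i < j < m)%N -> cls i `&` cls j = set0.
Hypothesis fLam : forall a b : V, (Lam (two_hit 1 a b) < +oo)%E.
Hypothesis hLam : forall i a b, (i < m)%N -> a \in Z i -> b \in Z i.+1 ->
  c * q <= fine (Lam (two_hit 1 a b)) <= C * q.

Let q0 : 0 <= q. Proof. by rewrite invr_ge0 exprn_ge0. Qed.
Let q1 : q <= 1.
Proof. by rewrite invf_le1 ?exprn_gt0 ?ltr0n// exprn_ege1// ler1n. Qed.
Let c0 : 0 <= c. Proof. by case/andP: c01 => /ltW. Qed.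
Let cle1 : c <= 1. Proof. by case/andP: c01. Qed.
Let cup k : set lines := [set L | exists2 i, (i < k)%N & cls i L].
Let mtwo a b : measurable (two_hit 1 a b : set lines).
Proof. exact (@two_hit_measurable _ _ 1 a b ler01). Qed.
Let pr (E : set T) : R := fine (P E).
Let fE (x : R) : fine x%:E = x. Proof. by []. Qed.
Let prE E : measurable E -> P E = (pr E)%:E.
Proof. by move=> mE; rewrite fineK// fin_num_measure. Qed.

Lemma chain_event_local k s : (k <= m)%N -> s \in chains Z k ->
  local_events omega (cup k) (chain_event s).
Proof.
elim: k s => [|k IH] s km.
  by move=> /mapP[z _ ->]; exact: local_setT.
move=> /chainsP[b [a [t [-> bZ aZ tc]]]].
change (local_events omega (cup k.+1) (occ omega (two_hit 1 a b) `&` chain_event (a :: t))).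
apply: local_setI.
  by apply: local_occ => // L /(hcls km aZ bZ); exists k.
apply: local_mono (IH _ (ltnW km) tc) => L [i ik]; exists i => //.
exact: ltnW.
Qed.

Lemma cup_disjoint k : (k < m)%N -> cls k `&` cup k = set0.
Proof.
move=> km; rewrite -subset0 => L [h [i ik h']].
have ikm : (i < k < m)%N by rewrite ik.
by rewrite -(dcls ikm).
Qed.

Lemma chain_event_ge k s : (k <= m)%N -> s \in chains Z k ->
  (c / 2 * q) ^+ k <= pr (chain_event s).
Proof.
elim: k s => [|k IH] s km.
  by move=> /mapP[z _ ->]; rewrite /pr/= probability_setT.
move=> /chainsP[b [a [t [-> bZ aZ tc]]]].
have h : P (occ omega (two_hit 1 a b) `&` chain_event (a :: t)) =
    (P (occ omega (two_hit 1 a b)) * P (chain_event (a :: t)))%E.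
  apply: (local_indep homega (cup_disjoint km)).
    by apply: local_occ => //; exact: hcls.
  exact: chain_event_local (ltnW km) tc.
have mo : measurable (occ omega (two_hit 1 a b)) by exact: (occ_measurable homega).
rewrite /pr [chain_event _]/= h !prE//; last exact: chain_event_measurable.
rewrite -EFinM fE exprS; apply: ler_pM; rewrite ?exprn_ge0 ?mulr_ge0//; last exact: IH (ltnW km) tc.
rewrite -lee_fin -prE// mulrAC; apply: (occ_prob_ge homega) => //.
  by rewrite mulr_ge0//= mulr_ile1.
rewrite -[leRHS]fineK ?ge0_fin_numE// lee_fin.
by have /andP[] := hLam km aZ bZ.
Qed.

(** The last steps of both chains use lines of class [k] and the other steps those of lower classes,
    so they are independent. The two last steps occur with one common line, possible only in the
    [near3] case, or with two lines. *)
Lemma chain_event_pair k s s' : (k <= m)%N -> s \in chains Z k -> s' \in chains Z k ->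
  pr (chain_event s `&` chain_event s') <= (C ^+ 2 * q) ^+ k * weight R near3 n N s s'.
Proof.
elim: k s s' => [|k IH] s s' km.
  move=> /mapP[z _ ->] /mapP[z' _ ->].
  by rewrite /pr/= setIT probability_setT expr0 mulr1.
move=> /chainsP[b [a [t [-> bZ aZ tc]]]] /chainsP[b' [a' [t' [-> bZ' aZ' tc']]]].
set O := occ omega (two_hit 1 a b); set O' := occ omega (two_hit 1 a' b').
have -> : chain_event [:: b, a & t] `&` chain_event [:: b', a' & t'] =
    (O `&` O') `&` (chain_event (a :: t) `&` chain_event (a' :: t')).
  by rewrite /= setIACA.
have h : P ((O `&` O') `&` (chain_event (a :: t) `&` chain_event (a' :: t'))) =
    (P (O `&` O') * P (chain_event (a :: t) `&` chain_event (a' :: t')))%E.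
  apply: (local_indep homega (cup_disjoint km)).
    by apply: local_setI; apply: local_occ => //; exact: hcls.
  by apply: local_setI; apply: chain_event_local => //; exact: ltnW.
have mO : measurable (O `&` O').
  by apply: measurableI; exact: (occ_measurable homega).
have mE : measurable (chain_event (a :: t) `&` chain_event (a' :: t')).
  by apply: measurableI; exact: chain_event_measurable.
rewrite /pr h !prE// -EFinM fE exprS [weight _ _ _ _ _ _]/=.
have -> : C ^+ 2 * q * (C ^+ 2 * q) ^+ k *
    (((near3 a b a' && near3 a b b')%:R + q) * weight R near3 n N (a :: t) (a' :: t')) =
    (C ^+ 2 * q * ((near3 a b a' && near3 a b b')%:R + q)) *
    ((C ^+ 2 * q) ^+ k * weight R near3 n N (a :: t) (a' :: t')).
  by move: (weight _ _ _ _ _ _) => ww; ring.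
apply: ler_pM => //; [by rewrite fine_ge0|by rewrite fine_ge0| |exact: IH (ltnW km) tc tc'].
rewrite -lee_fin -prE//; apply: le_trans (occ2_prob_le homega _ _) _ => //.
have lE x y : Lam (two_hit 1 x y) = (fine (Lam (two_hit 1 x y)))%:E.
  by rewrite fineK// ge0_fin_numE.
have /andP[_ u1] := hLam km aZ bZ; have /andP[_ u2] := hLam km aZ' bZ'.
rewrite mulrDr EFinD; apply: leeD.
  case: (boolP (near3 a b a' && near3 a b b')) => [_|nn].
    apply: (@le_trans _ _ (Lam (two_hit 1 a b))).
      by apply: measure_mono; [exact: measurableI|exact: mtwo|move=> L []].
    rewrite lE lee_fin mulr1; apply: le_trans u1 _.
    by rewrite ler_wpM2r// expr2 ler_peMl// (le_trans _ C1).
  have -> : two_hit 1 a b `&` two_hit 1 a' b' = set0.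
    rewrite -subset0 => L [[h1 h2] [h3 h4]]; move/negP: nn; apply.
    by apply/andP; split; apply/asboolP; exists L.
  by rewrite measure0 mulr0.
rewrite (lE a b) (lE a' b') -EFinM lee_fin; apply: le_trans (ler_pM _ _ u1 u2) _.
- by rewrite fine_ge0.
- by rewrite fine_ge0.
- by rewrite le_eqVlt; apply/orP; left; apply/eqP; ring.
Qed.

Hypothesis n2 : (2 <= n)%N.
Hypothesis size_end : size (Z 0%N) = N /\ size (Z m) = N.
Hypothesis size_mid : forall i, (0 < i < m)%N -> size (Z i) = (N ^ n.+1)%N.
Hypothesis near_start : forall z0 z1, z0 \in Z 0%N -> z1 \in Z 1%N ->
  \sum_(y <- Z 0%N) (near3 z0 z1 y)%:R <= C.
Hypothesis near_stop : forall z0 z1, z0 \in Z m.-1 -> z1 \in Z m ->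
  \sum_(y <- Z m) (near3 z0 z1 y)%:R <= C.
Hypothesis near_left : forall i z0 z1, (0 < i < m)%N -> z0 \in Z i -> z1 \in Z i.+1 ->
  \sum_(y <- Z i) (near3 z0 z1 y)%:R <= C * N%:R.
Hypothesis near_right : forall i z0 z1, (i.+1 < m)%N -> z0 \in Z i -> z1 \in Z i.+1 ->
  \sum_(y <- Z i.+1) (near3 z0 z1 y)%:R <= C * N%:R.
Hypothesis near_turn : forall i z0 z1 z2, (i.+1 < m)%N ->
  z0 \in Z i -> z1 \in Z i.+1 -> z2 \in Z i.+2 ->
  \sum_(y <- Z i.+1) (near3 z0 z1 y && near3 z1 z2 y)%:R <= C.

(** The square of the lower bound of the first moment over the upper bound of the second moment; the
    scale has cancelled. *)
Definition chain_bound : R :=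
  ((c / 2) ^+ m) ^+ 2 / ((C ^+ 2) ^+ m * (2 * (2 ^+ m * C ^+ m * C))).

Definition some_chain : set T :=
  [set w | exists2 s, s \in chains Z m & chain_event s w].

Lemma some_chain_prob : chain_bound <= pr some_chain.
Proof.
pose b : R := (C ^+ 2) ^+ m * (2 * (2 ^+ m * C ^+ m * C)).
pose a : R := (c / 2) ^+ m.
have Cgt0 : 0 < C by exact: lt_le_trans C1.
have b0 : 0 < b by rewrite !mulr_gt0 ?exprn_gt0.
have a0 : 0 < a by rewrite exprn_gt0// divr_gt0//; case/andP: c01.
have sizeq : (size (chains Z m))%:R * q ^+ m = 1 :> R.
  rewrite (size_chains n2 N1 C1 size_end size_mid) natrX exprVn -exprM divff//.
  by rewrite expf_neq0// pnatr_eq0 -lt0n.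
have h1 : a <= \sum_(s <- chains Z m) pr (chain_event s).
  have <- : \sum_(s <- chains Z m) (c / 2 * q) ^+ m = a.
    rewrite big_const_seq count_predT iter_addr_0 -[LHS]mulr_natl exprMn.
    by rewrite mulrCA sizeq mulr1.
  by rewrite big_seq [leRHS]big_seq; apply: ler_sum => s sc; exact: chain_event_ge.
have h2 : \sum_(s <- chains Z m) \sum_(s' <- chains Z m)
    pr (chain_event s `&` chain_event s') <= b.
  have <- : \sum_(s <- chains Z m) (b * q ^+ m) = b.
    rewrite big_const_seq count_predT iter_addr_0 -[LHS]mulr_natl.
    by rewrite mulrCA sizeq mulr1.
  rewrite big_seq [leRHS]big_seq; apply: ler_sum => s sc.
  apply: (@le_trans _ _ (\sum_(s' <- chains Z m)
      (C ^+ 2 * q) ^+ m * weight R near3 n N s s')).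
    by rewrite big_seq [leRHS]big_seq; apply: ler_sum => s' sc'; exact: chain_event_pair.
  rewrite -mulr_sumr exprMn /b [leLHS]mulrAC.
  apply: ler_wpM2r; first exact: exprn_ge0.
  apply: ler_wpM2l; first by apply: exprn_ge0; apply: exprn_ge0; exact: ltW.
  exact: (weight_total 0 n2 N1 C1 size_end size_mid near_start near_stop near_left
    near_right near_turn).
(* [b / a] is the optimal parameter [t] for first moment [a] and second moment [b]. *)
have t0 : 0 <= b / a by rewrite divr_ge0 ?ltW.
have := second_moment P (chains Z m) t0 chain_event_measurable.
rewrite -/some_chain -/(pr _) => h3.
have h4 : 2 * (b / a) * a <= (b / a) ^+ 2 * pr some_chain + b.
  apply: le_trans (le_trans h3 _); first by rewrite ler_wpM2l// mulr_ge0.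
  by rewrite lerD2l.
rewrite /chain_bound -/a -/b.
have -> : a ^+ 2 / b = b / (b / a) ^+ 2 by field; rewrite !gt_eqF.
rewrite ler_pdivrMr ?exprn_gt0 ?divr_gt0//.
have : 2 * (b / a) * a = 2 * b by field; rewrite gt_eqF.
by move: h4; rewrite (mulrC (pr _)); lra.
Qed.

End chain_events.

(** * Regions along a parabola *)

Section plane.
Variables (R : realType) (n : nat).
Local Notation V := 'rV[R]_n.+1.
Variables (p1 p2 : V).
Hypothesis n1 : (1 <= n)%N.
Implicit Types (z w : V) (r : R).

(** The determinant of the images of [z] and [w] in the plane. *)
Definition cross z w : R := dot z p1 * dot w p2 - dot z p2 * dot w p1.

Lemma crossDl z z' w : cross (z + z') w = cross z w + cross z' w.
Proof. by rewrite /cross !dotE; ring. Qed.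

Lemma crossZl a z w : cross (a *: z) w = a * cross z w.
Proof. by rewrite /cross !dotE; ring. Qed.

Lemma crossNl z w : cross (- z) w = - cross z w.
Proof. by rewrite /cross !dotE; ring. Qed.

Lemma crossvv z : cross z z = 0.
Proof. by rewrite /cross; ring. Qed.

Lemma crossZr a z w : cross z (a *: w) = a * cross z w.
Proof. by rewrite /cross !dotE; ring. Qed.

(* Small enough for the parabola points [(t, t ^+ 2)], [t <= n], to stay in convex
   position after a perturbation of size [eta]. *)
Definition eta : R := (32 * n%:R ^+ 2)^-1.

(* At scale [r], the image of [z] in the plane is close to the point of parameter
   [t] of the parabola. *)
Definition near_parabola r (t : nat) z : Prop :=
  `|dot z p1 - r * t%:R| <= eta * r /\ `|dot z p2 - r * t%:R ^+ 2| <= eta * r.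

Let N2 : 1 <= n%:R ^+ 2 :> R.
Proof. by rewrite exprn_ege1// ler1n. Qed.

Lemma eta_gt0 : 0 < eta.
Proof. by rewrite invr_gt0 mulr_gt0//; apply: lt_le_trans N2. Qed.

Lemma eta_n2 : eta * n%:R ^+ 2 = 32^-1.
Proof. by rewrite /eta invfM mulfVK// gt_eqF//; apply: lt_le_trans N2. Qed.

Lemma eta_le : eta <= 32^-1.
Proof. by rewrite -eta_n2 ler_peMr// ltW// eta_gt0. Qed.

Let le_prod (a b A B : R) : `|a| <= A -> `|b| <= B -> `|a * b| <= A * B.
Proof. by move=> h1 h2; rewrite normrM; apply: ler_pM. Qed.

(** The main term is the Vandermonde product [(t - s) (u - s) (u - t) >= 1]. Four first-order errors
    of at most 1/16 and two second-order errors of at most 1/256 leave more than 1/2. *)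
Lemma cross_ge r s t u zs zt zu : 0 < r -> (s < t < u)%N -> (u <= n)%N ->
  near_parabola r s zs -> near_parabola r t zt -> near_parabola r u zu ->
  r ^+ 2 / 2 <= cross (zt - zs) (zu - zs).
Proof.
move=> r0 /andP[st tu] un [s1 s2] [t1 t2] [u1 u2].
have scale k (z p : V) (e : R) : `|dot z p - r * e| <= k * r ->
    exists2 d, `|d| <= k & dot z p = r * (e + d).
  move=> h; exists ((dot z p - r * e) / r); last by field; rewrite gt_eqF.
  by rewrite normrM normfV (gtr0_norm r0) ler_pdivrMr.
have [a1 ha1 e1] := scale _ _ _ _ s1; have [a2 ha2 e2] := scale _ _ _ _ s2.
have [b1 hb1 e3] := scale _ _ _ _ t1; have [b2 hb2 e4] := scale _ _ _ _ t2.
have [c1 hc1 e5] := scale _ _ _ _ u1; have [c2 hc2 e6] := scale _ _ _ _ u2.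
have diff (a b : R) : `|a| <= eta -> `|b| <= eta -> `|a - b| <= 2 * eta.
  by move=> h1 h2; apply: le_trans (ler_normB _ _) _; lra.
have nat_diff (i j k : nat) : (j <= i <= n)%N -> (k <= 2)%N ->
    `|i%:R ^+ k - j%:R ^+ k : R| <= n%:R ^+ 2.
  move=> /andP[ji iN] k2; rewrite ger0_norm; last first.
    by rewrite subr_ge0 lerXn2r ?nnegrE// ler_nat.
  apply: (@le_trans _ _ (i%:R ^+ k)); first by rewrite gerBl exprn_ge0.
  apply: (@le_trans _ _ (n%:R ^+ k)); first by rewrite lerXn2r ?nnegrE// ler_nat.
  by rewrite ler_weXn2l// ler1n.
have su := ltn_trans st tu; have tn := leq_trans (ltnW tu) un.
have d1 : `|t%:R - s%:R : R| <= n%:R ^+ 2.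
  by rewrite -[t%:R]expr1 -[s%:R]expr1; apply: nat_diff => //; rewrite (ltnW st).
have d2 : `|t%:R ^+ 2 - s%:R ^+ 2 : R| <= n%:R ^+ 2.
  by apply: nat_diff => //; rewrite (ltnW st).
have d3 : `|u%:R - s%:R : R| <= n%:R ^+ 2.
  by rewrite -[u%:R]expr1 -[s%:R]expr1; apply: nat_diff => //; rewrite (ltnW su).
have d4 : `|u%:R ^+ 2 - s%:R ^+ 2 : R| <= n%:R ^+ 2.
  by apply: nat_diff => //; rewrite (ltnW su).
have x1 := diff _ _ hb1 ha1; have x2 := diff _ _ hb2 ha2.
have x3 := diff _ _ hc1 ha1; have x4 := diff _ _ hc2 ha2.
have D1 : 1 <= (t%:R - s%:R) * (u%:R - s%:R) * (u%:R - t%:R) :> R.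
  have ge1 (i j : nat) : (i < j)%N -> 1 <= j%:R - i%:R :> R.
    by move=> ij; rewrite lerBrDr addrC natr1 ler_nat.
  by rewrite !mulr_ege1// ge1.
have -> : cross (zt - zs) (zu - zs) = r ^+ 2 * (
    (t%:R - s%:R) * (u%:R - s%:R) * (u%:R - t%:R)
    + (t%:R - s%:R) * (c2 - a2) + (b1 - a1) * (u%:R ^+ 2 - s%:R ^+ 2)
    + (b1 - a1) * (c2 - a2) - (t%:R ^+ 2 - s%:R ^+ 2) * (c1 - a1)
    - (b2 - a2) * (u%:R - s%:R) - (b2 - a2) * (c1 - a1)).
  by rewrite /cross !dotE e1 e2 e3 e4 e5 e6; ring.
rewrite ler_wpM2l ?sqr_ge0//.
have y1 := le_prod d1 x4; have y2 := le_prod x1 d4; have y3 := le_prod x1 x4.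
have y4 := le_prod d2 x3; have y5 := le_prod x2 d3; have y6 := le_prod x2 x3.
have E1 : n%:R ^+ 2 * (2 * eta) = 16^-1.
  by rewrite mulrCA [X in 2 * X]mulrC eta_n2; field.
have E2 : 2 * eta * n%:R ^+ 2 = 16^-1 by rewrite mulrC.
have E3 : 2 * eta * (2 * eta) <= 16^-1 * 16^-1.
  by have := eta_le; have := eta_gt0; nra.
rewrite E1 in y1 y4; rewrite E2 in y2 y5.
move: y1 y2 y3 y4 y5 y6; rewrite !ler_norml.
by move=> /andP[? ?] /andP[? ?] /andP[? ?] /andP[? ?] /andP[? ?] /andP[? ?]; lra.
Qed.

Lemma no_three_regions (L : line R n) r s t u zs zt zu :
  0 < r -> (s < t < u)%N -> (u <= n)%N ->
  near_parabola r s zs -> near_parabola r t zt -> near_parabola r u zu ->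
  line_set L zs -> line_set L zt -> line_set L zu -> False.
Proof.
move=> r0 stu un hs ht hu Ls Lt Lu.
have := cross_ge r0 stu un hs ht hu.
have [v v0 Lv] := line_through_dir L.
move: Lt Lu; rewrite (Lv _ Ls) => -[a _ <-] [b _ <-].
have e w : zs + w - zs = w by vring.
rewrite !e crossZl crossZr crossvv !mulr0 leNgt => /negP; apply.
by rewrite divr_gt0// exprn_gt0.
Qed.

Lemma cross_le z w (a b : R) : enorm p1 <= 1 -> enorm p2 <= 1 ->
  enorm z <= a -> enorm w <= b -> `|cross z w| <= 2 * (a * b).
Proof.
move=> h1 h2 za wb.
have dle (x p : V) : enorm p <= 1 -> `|dot x p| <= enorm x.
  move=> p1'; rewrite ler_norml; apply/andP; split.
    rewrite lerNl -dotNl; apply: le_trans (dot_le _ _) _.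
    by rewrite enormN ler_piMr// enorm_ge0.
  by apply: le_trans (dot_le _ _) _; rewrite ler_piMr// enorm_ge0.
have c (p q : V) : enorm p <= 1 -> enorm q <= 1 -> `|dot z p * dot w q| <= a * b.
  by move=> hp hq; apply: le_prod; [exact: le_trans (dle _ _ hp) za|exact: le_trans (dle _ _ hq) wb].
apply: le_trans (ler_normB _ _) _.
by have := c _ _ h1 h2; have := c _ _ h2 h1; lra.
Qed.

Lemma dot_abs_le (x p : V) (e : R) : 0 <= e -> enorm p <= e -> `|dot x p| <= e * enorm x.
Proof.
move=> e0 pe; rewrite ler_norml; apply/andP; split.
  rewrite lerNl -dotNl; apply: le_trans (dot_le _ _) _.
  by rewrite enormN mulrC ler_wpM2r// enorm_ge0.
by apply: le_trans (dot_le _ _) _; rewrite mulrC ler_wpM2r// enorm_ge0.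
Qed.

End plane.

(** * Lattice points near a line *)

Section near_geometry.
Variables (R : realType) (n : nat).
Local Notation V := 'rV[R]_n.+1.
Implicit Types a b c : V.

Lemma near3_swap a b c : near3 a b c = near3 b a c.
Proof. by apply/asboolP/asboolP => -[L [? ? ?]]; exists L. Qed.

(** The points of [L] near [a] and [b] are at distance at least [l / 2], so the point near [c] has a
    parameter [t] of size at most [2 k + 1]; passing to the line through [a] and [b] amplifies the
    errors at these points by no more than that. *)
Lemma near3_param a b c (l k : R) : 4 <= l -> l <= enorm (b - a) ->
  enorm (c - a) <= k * l -> near3 a b c ->
  exists t, enorm (c - a - t *: (b - a)) <= 2 + 2 * (2 * k + 1).
Proof.
move=> l4 lb kc /asboolP[L [[P LP Pa] [Q LQ Qb] [S LS Sc]]].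
have PQ : l / 2 <= enorm (Q - P).
  have : enorm (b - a) <= enorm (Q - b) + enorm (Q - P) + enorm (P - a).
    have -> : b - a = - (Q - b) + (Q - P) + (P - a) by vring.
    apply: le_trans (enormD _ _) _; rewrite lerD2r.
    by apply: le_trans (enormD _ _) _; rewrite enormN.
  by lra.
have PS : enorm (S - P) <= k * l + 2.
  have -> : S - P = (S - c) + (c - a) - (P - a) by vring.
  apply: le_trans (enormB _ _) _; apply: le_trans (lerD (enormD _ _) (lexx _)) _.
  by lra.
have PQ0 : 0 < enorm (Q - P) by lra.
have QP : Q != P by apply: contraTneq PQ0 => ->; rewrite subrr enorm0 ltxx.
have [t St] := line_two LP LQ LS QP; exists t.
have tk : `|t| <= 2 * k + 1.
  have : `|t| * enorm (Q - P) <= k * l + 2.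
    by rewrite -enormZ; move: PS; rewrite St addrAC subrr add0r.
  have k0 : 0 <= k by have := enorm_ge0 (c - a); nra.
  by have := normr_ge0 t; nra.
have -> : c - a - t *: (b - a) = - (S - c) + (P - a) + t *: ((Q - b) - (P - a)).
  by rewrite St; vring.
apply: le_trans (enormD _ _) _; rewrite enormZ.
apply: lerD.
  by apply: le_trans (enormD _ _) _; rewrite enormN; lra.
rewrite mulrC; apply: ler_pM => //; first exact: enorm_ge0.
by apply: le_trans (enormB _ _) _; lra.
Qed.

End near_geometry.

Section lattice_count.
Variable d : nat.

Lemma card_lattice_box (N D : nat) (Q : pred {ffun 'I_d -> 'I_N}) :
  (forall k k', Q k -> Q k' -> forall i, (k i <= k' i + D)%N) ->
  (#|Q| <= D.*2.+1 ^ d)%N.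
Proof.
move=> QD; have [k0 Qk0|Q0] := pickP Q; last by rewrite eq_card0.
pose f (k : {ffun 'I_d -> 'I_N}) : {ffun 'I_d -> 'I_(D.*2.+1)} :=
  [ffun i => inord (k i + D - k0 i)].
have finj : {in Q &, injective f}.
  move=> k k' Qk Qk' /ffunP e; apply/ffunP => i; apply: val_inj => /=.
  have := e i; rewrite !ffunE => /(congr1 val) /=.
  have h1 := QD _ _ Qk Qk0 i; have h2 := QD _ _ Qk0 Qk i.
  have h3 := QD _ _ Qk' Qk0 i; have h4 := QD _ _ Qk0 Qk' i.
  by rewrite !inordK; lia.
rewrite -(card_in_image finj); apply: leq_trans (max_card _) _.
by rewrite card_ffun !card_ord.
Qed.

(** Counts slice by slice; [j] will be a coordinate in which the axis of the tube is steepest. *)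
Lemma card_lattice_tube (N D : nat) (j : 'I_d) (Q : pred {ffun 'I_d -> 'I_N}) :
  (forall k k', Q k -> Q k' -> k j = k' j -> forall i, (k i <= k' i + D)%N) ->
  (#|Q| <= N * D.*2.+1 ^ d)%N.
Proof.
move=> QD; rewrite -sum1_card (partition_big (fun k : {ffun _ -> _} => k j) predT)//=.
rewrite -[X in (_ <= X * _)%N]card_ord -sum_nat_const; apply: leq_sum => a _.
rewrite sum1_card; apply: card_lattice_box => k k' /andP[Qk /eqP ka] /andP[Qk' /eqP k'a].
by apply: QD; rewrite // ka.
Qed.

Lemma card_interval (N D : nat) (Q : pred 'I_N) :
  (forall k k', Q k -> Q k' -> (k <= k' + D)%N) -> (#|Q| <= D.*2.+1)%N.
Proof.
move=> QD; have [k0 Qk0|Q0] := pickP Q; last by rewrite eq_card0.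
pose f (k : 'I_N) : 'I_(D.*2.+1) := inord (k + D - k0).
have finj : {in Q &, injective f}.
  move=> k k' Qk Qk' /(congr1 val) /= e; apply: val_inj => /=; move: e.
  have h1 := QD _ _ Qk Qk0; have h2 := QD _ _ Qk0 Qk.
  have h3 := QD _ _ Qk' Qk0; have h4 := QD _ _ Qk0 Qk'.
  by rewrite !inordK; lia.
by rewrite -(card_in_image finj) -[leqRHS]card_ord; exact: max_card.
Qed.

Lemma sum_bool_map (R : realType) (I : finType) (V : Type) (f : I -> V) (b : V -> bool) :
  \sum_(y <- [seq f k | k : I]) (b y)%:R = #|[pred k | b (f k)]|%:R :> R.
Proof.
rewrite big_image -sum1_card natr_sum [RHS]big_mkcond/=.
by apply: eq_bigr => k _; rewrite inE; case: (b _).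
Qed.

Lemma leq_real_bound (R : realType) (a b : nat) (x : R) : 0 <= x ->
  `|a%:R - b%:R| <= x -> (a <= b + Num.bound x)%N.
Proof.
move=> x0 h; rewrite -(ler_nat R) natrD -lerBlDl.
by apply: le_trans (ler_norm _) (le_trans h _); rewrite ltW// archi_boundP.
Qed.

End lattice_count.

(** * The points of the chains at a given scale *)

Section scale.
Variables (R : realType) (n : nat).
Local Notation V := 'rV[R]_n.+1.
Local Notation lines := (line R n).
Variables (p1 p2 f1 f2 : V) (A : R).
Local Notation eta := (eta R n).
Local Notation m := n.-1.
Let eps : R := eta / (8 * n.+1%:R).
Hypothesis n2 : (2 <= n)%N.
Hypothesis p1_small : enorm p1 <= eps.
Hypothesis p2_small : enorm p2 <= eps.
Hypothesis f11 : dot f1 p1 = 1.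
Hypothesis f12 : dot f1 p2 = 0.
Hypothesis f21 : dot f2 p1 = 0.
Hypothesis f22 : dot f2 p2 = 1.
Hypothesis A1 : 1 <= A.
Hypothesis f1A : enorm f1 <= A.
Hypothesis f2A : enorm f2 <= A.

Let n1 : (1 <= n)%N := ltnW n2.
Let eta0 : 0 < eta := eta_gt0 R n1.
Let eps0 : 0 < eps. Proof. by rewrite divr_gt0 ?mulr_gt0. Qed.
Let eta32 : eta <= 32^-1 := eta_le R n1.
Let epsn : eps * n.+1%:R = eta / 8.
Proof. by rewrite /eps; field. Qed.
Let eps_eta : eps <= eta / 8.
Proof. by rewrite -epsn ler_peMr ?ler1n// ltW. Qed.
Let eps1 : eps <= 1. Proof. by have := eps_eta; have := eta32; lra. Qed.

(** Relative length of the end segments: the drift [slope * t * N] of the image along such a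
    segment, with [t <= n ^+ 2], stays below [eta / 64 * N]. *)
Definition slope : R := eta / (64 * n%:R ^+ 2).
Let nn0 : 0 < n%:R ^+ 2 :> R. Proof. by rewrite exprn_gt0// ltr0n. Qed.
Let nn1 : 1 <= n%:R ^+ 2 :> R. Proof. by rewrite exprn_ege1// ler1n. Qed.
Let slope0 : 0 < slope. Proof. by apply: divr_gt0 => //; apply: mulr_gt0. Qed.
Let slopen : slope * n%:R ^+ 2 = eta / 64.
Proof. by rewrite /slope; field; rewrite gt_eqF// ltr0n. Qed.
Let slope_le : slope <= eta / 64.
Proof. by rewrite -slopen; apply: ler_peMr => //; exact: ltW. Qed.

(** Its image has parameter [i + 1], as [f1], [f2] are dual to [p1], [p2]. Parameter 0 is left to
    the neighbourhood of the origin, where the given lines start and where all much smaller scales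
    lie. *)
Definition corner (i : nat) : V := i.+1%:R *: f1 + i.+1%:R ^+ 2 *: f2.

Definition intv N (k : {ffun 'I_n.+1 -> 'I_N}) : V := \row_i (k i)%:R.

Definition middle N i : seq V :=
  [seq N%:R *: corner i + intv k | k : {ffun 'I_n.+1 -> 'I_N}].

Definition segment N (p q : V) : seq V :=
  [seq p + (s%:R / N%:R) *: (q - p) | s : 'I_N].

(* The points of [segment N p q] then follow the line through [a] with direction [g]
   within the region of parameter [t]. *)
Definition good_end N (t : nat) p q (a g : V) : Prop :=
  [/\ enorm a <= A /\ enorm g <= A,
      `|dot g p1 - t%:R| <= eta / 8, `|dot g p2 - t%:R ^+ 2| <= eta / 8,
      enorm (p - (a + N%:R *: g)) <= 1 &
      enorm (q - (a + (N%:R * (1 + slope)) *: g)) <= 1].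

Lemma segment_point N t p q a g (s : R) : good_end N t p q a g -> 0 <= s <= 1 ->
  exists2 e, enorm e <= 1 &
    p + s *: (q - p) = a + (N%:R * (1 + slope * s)) *: g + e.
Proof.
move=> [_ _ _ hp hq] /andP[s0 s1].
exists ((1 - s) *: (p - (a + N%:R *: g)) + s *: (q - (a + (N%:R * (1 + slope)) *: g))).
  apply: le_trans (enormD _ _) _; rewrite !enormZ !ger0_norm ?subr_ge0//.
  rewrite -[leRHS](subrK s); apply: lerD; first by rewrite ler_piMr// subr_ge0.
  by rewrite ler_piMr.
by vring.
Qed.

Variable N : nat.
Hypothesis N1 : (1 <= N)%N.
Hypothesis NA : 8 * A <= N%:R.
Let N0 : 0 < N%:R :> R. Proof. by rewrite ltr0n. Qed.

Let dot_eps (x p : V) : enorm p <= eps -> `|dot x p| <= eps * enorm x.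
Proof. by move=> h; apply: dot_abs_le => //; exact: ltW. Qed.

Let end_dot (t : R) (p a g e : V) (s : R) : enorm p <= eps -> 0 <= t <= n%:R ^+ 2 ->
  `|dot g p - t| <= eta / 8 -> enorm a <= A -> enorm e <= 1 -> 0 <= s <= 1 ->
  `|dot (a + (N%:R * (1 + slope * s)) *: g + e) p - N%:R * t| <= eta / 2 * N%:R.
Proof.
move=> hp /andP[t0 tn] hg ha he /andP[s0 s1].
have eA : eps * A <= eta / 64 * N%:R.
  have -> : eta / 64 * N%:R = eta / 8 * (N%:R / 8) by field.
  by apply: ler_pM => //; [exact: ltW|exact: le_trans A1|have := NA; lra].
have ha' : `|dot a p| <= eta / 64 * N%:R.
  by apply: le_trans (dot_eps _ hp) (le_trans _ eA); rewrite ler_wpM2l// ltW.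
have he' : `|dot e p| <= eta / 64 * N%:R.
  apply: le_trans (dot_eps _ hp) (le_trans _ eA).
  by rewrite ler_wpM2l ?(ltW eps0)// (le_trans he).
have -> : dot (a + (N%:R * (1 + slope * s)) *: g + e) p - N%:R * t =
    dot a p + dot e p + N%:R * ((1 + slope * s) * (dot g p - t)) + N%:R * (slope * s * t).
  by rewrite !dotE; ring.
have h3 : `|N%:R * (slope * s * t)| <= eta / 64 * N%:R.
  rewrite normrM (ger0_norm (ltW N0)) mulrC ler_wpM2r ?(ltW N0)//.
  have sl := ltW slope0; rewrite ger0_norm; last by do 2 apply: mulr_ge0 => //.
  rewrite -slopen -mulrA ler_wpM2l//.
  by apply: le_trans tn; rewrite ler_piMl.
have h4 : `|N%:R * ((1 + slope * s) * (dot g p - t))| <= eta / 4 * N%:R.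
  rewrite normrM (ger0_norm (ltW N0)) mulrC ler_wpM2r ?(ltW N0)//.
  have ss : 0 <= slope * s <= 1.
    by rewrite mulr_ge0 ?(ltW slope0)//= mulr_ile1 ?(ltW slope0)//; have := slope_le; have := eta32; lra.
  rewrite normrM ger0_norm ?addr_ge0//; last by case/andP: ss.
  apply: (@le_trans _ _ (2 * (eta / 8))); last by lra.
  by apply: ler_pM => //; [rewrite addr_ge0//; case/andP: ss|case/andP: ss => _; lra].
apply: le_trans (ler_normD _ _) _; apply: le_trans (lerD (ler_normD _ _) h3) _.
apply: le_trans (lerD (lerD (ler_normD _ _) h4) (lexx _)) _.
have : 0 <= eta * N%:R by rewrite mulr_ge0 ?ltW.
by move: ha' he'; lra.
Qed.

(** Half the tolerance of [near_parabola]; the other half absorbs unit balls. *)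
Definition half_near (t : nat) z : Prop :=
  `|dot z p1 - N%:R * t%:R| <= eta / 2 * N%:R /\
  `|dot z p2 - N%:R * t%:R ^+ 2| <= eta / 2 * N%:R.

Lemma segmentP p q z : z \in segment N p q ->
  exists2 s : 'I_N, z = p + (s%:R / N%:R) *: (q - p) & 0 <= (s%:R / N%:R : R) <= 1.
Proof.
move=> /mapP[s _ ->]; exists s => //; rewrite divr_ge0//= ler_pdivrMr// mul1r ler_nat.
exact: ltnW.
Qed.

Lemma segment_near t p q a g z : (t <= n)%N -> good_end N t p q a g ->
  z \in segment N p q -> half_near t z.
Proof.
move=> tn ge /segmentP[s -> s01]; have [e e1 ->] := segment_point ge s01.
have [[ha hg] g1 g2 _ _] := ge; have tn' : t%:R <= n%:R :> R by rewrite ler_nat.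
split; apply: end_dot => //.
  rewrite ler0n/=; apply: le_trans tn' _; rewrite expr2 ler_peMr//.
  by rewrite ler1n.
by rewrite exprn_ge0//= lerXn2r ?nnegrE.
Qed.

Lemma segment_enorm t p q a g z : good_end N t p q a g ->
  z \in segment N p q -> enorm z <= 4 * A * N%:R.
Proof.
move=> ge /segmentP[s -> s01]; have [e e1 ->] := segment_point ge s01.
have [[ha hg] _ _ _ _] := ge.
have s2 : 0 <= 1 + slope * (s%:R / N%:R) <= 2.
  move: s01 => /andP[s0 s1].
  by rewrite addr_ge0 ?mulr_ge0 ?(ltW slope0)//=; have := slope_le; have := eta32; have := slope0; nra.
apply: le_trans (enormD _ _) _; apply: le_trans (lerD (enormD _ _) e1) _.
rewrite enormZ ger0_norm; last by case/andP: s2 => h _; rewrite mulr_ge0// ltW.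
have h : N%:R * (1 + slope * (s%:R / N%:R)) * enorm g <= N%:R * 2 * A.
  apply: ler_pM => //; [|exact: enorm_ge0|].
    by case/andP: s2 => h _; rewrite mulr_ge0// ltW.
  by case/andP: s2 => _ h; rewrite ler_wpM2l// ltW.
have N1' : 1 <= N%:R :> R by rewrite ler1n.
by move: h; have := A1; nra.
Qed.

Lemma intv_enorm (k : {ffun 'I_n.+1 -> 'I_N}) : enorm (intv k) <= n.+1%:R * N%:R.
Proof.
apply: (le_trans (enorm_le_norm _)); rewrite ler_wpM2l//; apply: norm_le_coord => // i.
by rewrite mxE ger0_norm// ler_nat ltnW.
Qed.

Lemma middle_near i z : z \in middle N i -> half_near i.+1 z.
Proof.
move=> /mapP[k _ ->].
have h p : enorm p <= eps -> `|dot (intv k) p| <= eta / 2 * N%:R.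
  move=> hp; apply: le_trans (dot_eps _ hp) _.
  apply: (@le_trans _ _ (eps * (n.+1%:R * N%:R))).
    by rewrite ler_wpM2l ?(ltW eps0)// intv_enorm.
  by rewrite mulrA epsn ler_wpM2r ?(ltW N0)//; have := eta0; lra.
split; rewrite /corner !dotE ?f11 ?f12 ?f21 ?f22.
  by rewrite mulr0 mulr1 addr0 addrAC subrr add0r h.
by rewrite mulr0 mulr1 add0r addrAC subrr add0r h.
Qed.

(** In units of [N], a bound for all points of the chains; [4 * A] covers the end segments and the
    other terms the cubes. *)
Definition radius : R := 2 * n%:R ^+ 2 * A + n.+1%:R + 4 * A.

Lemma middle_enorm i z : (i < n)%N -> z \in middle N i -> enorm z <= radius * N%:R.
Proof.
move=> iN /mapP[k _ ->]; apply: le_trans (enormD _ _) _; rewrite enormZ (ger0_norm (ltW N0)).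
have ci : enorm (corner i) <= 2 * n%:R ^+ 2 * A.
  apply: le_trans (enormD _ _) _; rewrite !enormZ !ger0_norm// ?exprn_ge0//.
  have i1 : i.+1%:R <= n%:R :> R by rewrite ler_nat.
  have i2 : i.+1%:R <= n%:R ^+ 2 :> R.
    by apply: le_trans i1 _; rewrite expr2 ler_peMr// ler1n.
  have i3 : i.+1%:R ^+ 2 <= n%:R ^+ 2 :> R by rewrite lerXn2r ?nnegrE.
  have := ler_pM (ler0n _ _) (enorm_ge0 _) i2 f1A.
  have := ler_pM (exprn_ge0 2 (ler0n _ _)) (enorm_ge0 _) i3 f2A.
  by lra.
have := intv_enorm k; have := ler_wpM2l (ltW N0) ci; rewrite /radius.
by have := A1; have := N0; nra.
Qed.

Lemma half_near_ball t z z' : half_near t z -> enorm (z' - z) <= 1 ->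
  near_parabola p1 p2 N%:R t z'.
Proof.
move=> [h1 h2] zz.
have h p (e : R) : enorm p <= eps -> `|dot z p - e| <= eta / 2 * N%:R ->
    `|dot z' p - e| <= eta * N%:R.
  move=> hp h; have -> : dot z' p - e = dot (z' - z) p + (dot z p - e).
    by rewrite !dotE; ring.
  apply: le_trans (ler_normD _ _) _.
  have : `|dot (z' - z) p| <= eps * 1.
    by apply: le_trans (dot_eps _ hp) _; rewrite ler_wpM2l// ltW.
  have N8 : 8 <= N%:R :> R by have := A1; have := NA; lra.
  have : eps <= eta / 64 * N%:R by have := eps_eta; have := eta0; nra.
  have : 0 <= eta * N%:R by rewrite mulr_ge0 ?ltW.
  by lra.
by split; [exact: h h1|exact: h h2].
Qed.

Lemma near_origin a : enorm a <= A -> near_parabola p1 p2 N%:R 0 a.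
Proof.
move=> aA; have h p : enorm p <= eps -> `|dot a p| <= eta * N%:R.
  move=> hp; apply: le_trans (dot_eps _ hp) _; apply: ler_pM => //.
  - exact: ltW.
  - exact: enorm_ge0.
  - by have := eps_eta; have := eta0; lra.
  - by apply: (le_trans aA); have := NA; have := A1; lra.
by split; rewrite ?expr0n/= mulr0 subr0; exact: h.
Qed.

(** The first plane coordinates differ by almost [N], and [p1] is a contraction. *)
Lemma half_near_dist i z z' : half_near i z -> half_near i.+1 z' ->
  N%:R <= enorm (z' - z).
Proof.
move=> [h1 _] [h2 _].
have h : `|dot (z' - z) p1| <= eps * enorm (z' - z) by exact: dot_eps.
have h3 : N%:R / 2 <= dot (z' - z) p1.
  have -> : dot (z' - z) p1 = N%:R + (dot z' p1 - N%:R * i.+1%:R) - (dot z p1 - N%:R * i%:R).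
    by rewrite !dotE -natr1; ring.
  move: h1 h2; rewrite !ler_norml => /andP[_ h1] /andP[h2 _].
  by have := N0; have := eta32; nra.
have := le_trans (ler_norm _) h; have := eps_eta; have := eta32.
by have := enorm_ge0 (z' - z); nra.
Qed.

Lemma half_near_cross s t u zs zt zu : (s < t < u)%N -> (u <= n)%N ->
  near_parabola p1 p2 N%:R s zs -> near_parabola p1 p2 N%:R t zt ->
  near_parabola p1 p2 N%:R u zu ->
  [/\ N%:R ^+ 2 / 2 <= `|cross p1 p2 (zt - zs) (zu - zs)|,
   N%:R ^+ 2 / 2 <= `|cross p1 p2 (zs - zt) (zu - zt)| &
   N%:R ^+ 2 / 2 <= `|cross p1 p2 (zu - zs) (zt - zs)|].
Proof.
move=> stu un hs ht hu.
have h : N%:R ^+ 2 / 2 <= `|cross p1 p2 (zt - zs) (zu - zs)|.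
  by apply: le_trans (cross_ge n1 N0 stu un hs ht hu) (ler_norm _).
split; rewrite // -normrN; apply: le_trans h _.
  by rewrite le_eqVlt; apply/orP; left; apply/eqP; congr `|_|; rewrite /cross !dotE; ring.
by rewrite le_eqVlt; apply/orP; left; apply/eqP; congr `|_|; rewrite /cross !dotE; ring.
Qed.

Hypothesis NB : 80 * radius <= slope * N%:R.

Definition width : R := 2 + 2 * (2 * (2 * radius) + 1).

Let radius0 : 1 <= radius.
Proof. by rewrite /radius; have := A1; have := nn0; have : 0 <= n.+1%:R :> R by []; nra. Qed.
Let width0 : 0 < width. Proof. by rewrite /width; have := radius0; lra. Qed.
Let N4 : 4 <= N%:R :> R. Proof. by have := NA; have := A1; lra. Qed.

Let diff_enorm (z z' : V) : enorm z <= radius * N%:R -> enorm z' <= radius * N%:R ->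
  enorm (z - z') <= 2 * radius * N%:R.
Proof. by move=> h h'; apply: le_trans (enormB _ _) _; lra. Qed.

Lemma near3_line (z0 z1 y : V) : N%:R <= enorm (z1 - z0) -> enorm z0 <= radius * N%:R ->
  enorm y <= radius * N%:R -> near3 z0 z1 y ->
  exists t, enorm (y - z0 - t *: (z1 - z0)) <= width.
Proof.
by move=> h h0 h1; apply: (near3_param N4 h); exact: diff_enorm.
Qed.

(** Two points of the tube with the same coordinate [j] differ along the direction by at most
    [2 * width] in coordinate [j], hence in all coordinates since [j] is the steepest one; the width
    of the tube adds another [2 * width]. *)
Lemma count_tube i (z0 z1 : V) : (i < n)%N -> N%:R <= enorm (z1 - z0) ->
  enorm z0 <= radius * N%:R ->
  \sum_(y <- middle N i) (near3 z0 z1 y)%:R <=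
  (Num.bound (4 * width)).*2.+1%:R ^+ n.+1 * N%:R :> R.
Proof.
move=> iN h h0; rewrite sum_bool_map -natrX -natrM ler_nat mulnC.
have [j vj] := norm_coordP (z1 - z0) (ltn0Sn n).
apply: (@card_lattice_tube _ _ _ j) => k k' Qk Qk' kj i'.
have line (l : {ffun 'I_n.+1 -> 'I_N}) : near3 z0 z1 (N%:R *: corner i + intv l) ->
    exists t, enorm (N%:R *: corner i + intv l - z0 - t *: (z1 - z0)) <= width.
  apply: near3_line => //; apply: (middle_enorm iN).
  by apply/mapP; exists l; rewrite // mem_enum.
have [t ht] := line _ Qk; have [t' ht'] := line _ Qk'.
set e := N%:R *: corner i + intv k - z0 - t *: (z1 - z0) in ht.
set e' := N%:R *: corner i + intv k' - z0 - t' *: (z1 - z0) in ht'.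
have dE l : (k l)%:R - (k' l)%:R = (t - t') * (z1 - z0) ord0 l + (e - e') ord0 l :> R.
  by rewrite /e /e' !mxE; ring.
have ee l : `|(e - e') ord0 l| <= 2 * width.
  apply: le_trans (coord_le_enorm _ _) _; apply: le_trans (enormB _ _) _; lra.
apply: (@leq_real_bound R); first by rewrite mulr_ge0// ltW.
rewrite dE; apply: le_trans (ler_normD _ _) _.
have -> : 4 * width = 2 * width + 2 * width by ring.
apply: lerD => //; apply: le_trans (ee j); rewrite normrM.
have -> : (e - e') ord0 j = - ((t - t') * (z1 - z0) ord0 j).
  by have := dE j; rewrite kj subrr => /eqP; rewrite eq_sym addrC addr_eq0 => /eqP.
by rewrite normrN normrM -vj ler_wpM2l// coord_le_norm.
Qed.

Lemma cross_small (e z : V) : enorm e <= 2 * width -> enorm z <= 2 * radius * N%:R ->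
  `|cross p1 p2 e z| <= 8 * width * radius * N%:R.
Proof.
move=> he hz; apply: le_trans (cross_le _ _ he hz) _; rewrite ?(le_trans p1_small)//.
  by rewrite (le_trans p2_small).
by rewrite le_eqVlt; apply/orP; left; apply/eqP; ring.
Qed.

Definition turn_radius : R := 32 * width * radius ^+ 2 + width.

(** Writing [y - z1] along both lines and taking [cross] with [z2 - z1] eliminates one parameter.
    The other is of order [1 / N], because the two directions span an area of order [N ^+ 2]. *)
Lemma turn_close (z0 z1 z2 y : V) :
  N%:R ^+ 2 / 2 <= `|cross p1 p2 (z0 - z1) (z2 - z1)| ->
  N%:R <= enorm (z1 - z0) -> N%:R <= enorm (z2 - z1) ->
  enorm z0 <= radius * N%:R -> enorm z1 <= radius * N%:R -> enorm z2 <= radius * N%:R ->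
  enorm y <= radius * N%:R ->
  near3 z0 z1 y -> near3 z1 z2 y -> enorm (y - z1) <= turn_radius.
Proof.
move=> hc h01 h12 h0 h1 h2 hy; rewrite near3_swap => n01 n12.
have h10 : N%:R <= enorm (z0 - z1) by rewrite enorm_distC.
have [t ht] := near3_line h10 h1 hy n01.
have [s hs] := near3_line h12 h1 hy n12.
set e := y - z1 - t *: (z0 - z1) in ht; set e' := y - z1 - s *: (z2 - z1) in hs.
have tc : t * cross p1 p2 (z0 - z1) (z2 - z1) = cross p1 p2 (e' - e) (z2 - z1).
  rewrite -crossZl (_ : e' - e = t *: (z0 - z1) - s *: (z2 - z1)); last first.
    by rewrite /e /e'; vring.
  by rewrite [RHS]crossDl crossNl (crossZl _ _ s) crossvv mulr0 subr0.
have ee : enorm (e' - e) <= 2 * width by apply: le_trans (enormB _ _) _; lra.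
have h := cross_small ee (diff_enorm h2 h1).
rewrite -tc normrM in h.
have tN : `|t| * N%:R <= 16 * width * radius.
  have : `|t| * (N%:R ^+ 2 / 2) <= 8 * width * radius * N%:R.
    by apply: le_trans h; rewrite ler_wpM2l.
  rewrite -(ler_pM2r N0 (`|t| * N%:R)) expr2; lra.
have -> : y - z1 = t *: (z0 - z1) + e by rewrite /e; vring.
apply: le_trans (enormD _ _) _; apply: lerD => //; rewrite enormZ.
apply: (@le_trans _ _ (`|t| * (2 * radius * N%:R))).
  by rewrite ler_wpM2l// diff_enorm.
have : 0 <= 2 * radius by have := radius0; lra.
by move=> /(ler_wpM2l)/(_ _ _ tN); lra.
Qed.

Lemma count_turn i (z0 z1 z2 : V) : (i < n)%N ->
  N%:R ^+ 2 / 2 <= `|cross p1 p2 (z0 - z1) (z2 - z1)| ->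
  N%:R <= enorm (z1 - z0) -> N%:R <= enorm (z2 - z1) ->
  enorm z0 <= radius * N%:R -> enorm z1 <= radius * N%:R -> enorm z2 <= radius * N%:R ->
  \sum_(y <- middle N i) (near3 z0 z1 y && near3 z1 z2 y)%:R <=
  (Num.bound (2 * turn_radius)).*2.+1%:R ^+ n.+1 :> R.
Proof.
move=> iN hc h01 h12 h0 h1 h2; rewrite (sum_bool_map _ _ (fun y => near3 z0 z1 y && near3 z1 z2 y)).
rewrite -natrX ler_nat; apply: card_lattice_box => k k' Qk Qk' j.
have close (l : {ffun 'I_n.+1 -> 'I_N}) :
    near3 z0 z1 (N%:R *: corner i + intv l) && near3 z1 z2 (N%:R *: corner i + intv l) ->
    enorm (N%:R *: corner i + intv l - z1) <= turn_radius.
  move=> /andP[q1 q2]; apply: (turn_close hc) => //; apply: (middle_enorm iN).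
  by apply/mapP; exists l; rewrite // mem_enum.
have hk := close _ Qk; have hk' := close _ Qk'.
have tr0 := le_trans (enorm_ge0 _) hk.
apply: (@leq_real_bound R); first by rewrite mulr_ge0.
set d := N%:R *: corner i + intv k - z1 in hk; set d' := N%:R *: corner i + intv k' - z1 in hk'.
have -> : (k j)%:R - (k' j)%:R = (d - d') ord0 j :> R by rewrite /d /d' !mxE; ring.
apply: le_trans (coord_le_enorm _ _) _; apply: le_trans (enormB _ _) _; lra.
Qed.

(** Transversality of the end segment to the step from [z0] to [z1]: both [q - p] and [z0 - a] are
    almost multiples of [g], and [a], [z0], [z1] are in convex position as points of parameters 0,
    [t] and [t']. *)
Lemma segment_cross t t' (p q a g z0 z1 : V) : (t <= n)%N -> (t' <= n)%N -> (0 < t)%N ->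
  (0 < t')%N -> t != t' -> good_end N t p q a g -> z0 \in segment N p q ->
  half_near t' z1 -> enorm z1 <= radius * N%:R ->
  slope * N%:R ^+ 2 / 8 <= `|cross p1 p2 (q - p) (z1 - z0)|.
Proof.
move=> tn t'n t0 t'0 tt' ge z0S z1n h1.
have a0 : near_parabola p1 p2 N%:R 0 a by apply: near_origin; case: ge => -[].
have h0n := half_near_ball (segment_near tn ge z0S) (z' := z0).
have h1n := half_near_ball z1n (z' := z1).
rewrite !subrr enorm0 in h0n h1n; have {}h0n := h0n ler01; have {}h1n := h1n ler01.
have h0 : enorm z0 <= radius * N%:R.
  apply: le_trans (segment_enorm ge z0S) _; rewrite ler_wpM2r ?(ltW N0)//.
  by rewrite /radius lerDr addr_ge0// mulr_ge0 ?(le_trans _ A1)// mulr_ge0// ltW.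
have big : N%:R ^+ 2 / 2 <= `|cross p1 p2 (z0 - a) (z1 - a)|.
  have [lt|] := ltnP t t'; first by case: (half_near_cross (s := 0) _ t'n a0 h0n h1n); rewrite ?t0.
  rewrite leq_eqVlt eq_sym (negbTE tt')/= => lt.
  by case: (half_near_cross (s := 0) _ tn a0 h1n h0n); rewrite ?t'0.
have [s zE s01] := segmentP z0S; have [e0 he0 zE'] := segment_point ge s01.
set sg := s%:R / N%:R in zE zE' s01.
have [_ _ _ hp hq] := ge.
pose e := (q - (a + (N%:R * (1 + slope)) *: g)) - (p - (a + N%:R *: g)).
have he : enorm e <= 2 by apply: le_trans (enormB _ _) _; lra.
have pq : q - p = (N%:R * slope) *: g + e by rewrite /e; vring.
have hd := diff_enorm h1 h0.
have w1 : enorm e <= 2 * 1 * 1 by lra.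
have c0 := cross_le (le_trans p1_small eps1) (le_trans p2_small eps1) he0 hd.
have c1 := cross_le (le_trans p1_small eps1) (le_trans p2_small eps1) he hd.
have z0a : z0 - a = (N%:R * (1 + slope * sg)) *: g + e0 by rewrite zE zE'; vring.
have cE : (1 + slope * sg) * cross p1 p2 (q - p) (z1 - z0) =
    slope * cross p1 p2 (z0 - a) (z1 - a) - slope * cross p1 p2 e0 (z1 - z0)
    + (1 + slope * sg) * cross p1 p2 e (z1 - z0).
  have -> : cross p1 p2 (z0 - a) (z1 - a) = cross p1 p2 (z0 - a) (z1 - z0).
    by rewrite /cross !dotE; ring.
  by rewrite z0a pq !crossDl !crossZl; ring.
have sl1 : slope <= 1 by have := slope_le; have := eta32; lra.
have ss : 0 <= slope * sg <= 1.
  case/andP: s01 => s0 s1.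
  by rewrite mulr_ge0 ?(ltW slope0)//= mulr_ile1 ?(ltW slope0).
move: (cross p1 p2 (q - p) (z1 - z0)) cE => X cE.
have : slope * (N%:R ^+ 2 / 2) <= 2 * `|X| + 4 * radius * N%:R + 16 * radius * N%:R.
  apply: (@le_trans _ _ (slope * `|cross p1 p2 (z0 - a) (z1 - a)|)).
    by rewrite ler_wpM2l ?(ltW slope0).
  have -> : slope * `|cross p1 p2 (z0 - a) (z1 - a)| =
      `|(1 + slope * sg) * X + slope * cross p1 p2 e0 (z1 - z0)
       - (1 + slope * sg) * cross p1 p2 e (z1 - z0)|.
    rewrite cE -[slope in LHS](ger0_norm (ltW slope0)) -normrM; congr `|_|; ring.
  apply: le_trans (ler_normB _ _) _; apply: lerD; first apply: le_trans (ler_normD _ _) _; first apply: lerD.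
  - by rewrite normrM ler_wpM2r// ger0_norm; lra.
  - rewrite normrM (ger0_norm (ltW slope0)).
    apply: (@le_trans _ _ (1 * (2 * (1 * (2 * radius * N%:R))))); last by lra.
    by apply: ler_pM => //; exact: ltW.
  - rewrite normrM.
    apply: (@le_trans _ _ (2 * (2 * (2 * (2 * radius * N%:R))))); last by lra.
    by apply: ler_pM => //; rewrite ger0_norm; lra.
(* By [NB] the error [20 * radius * N] takes at most half of the main term [slope * N ^+ 2 / 2]. *)
have : 80 * radius * N%:R <= slope * N%:R ^+ 2.
  by rewrite expr2 mulrA ler_wpM2r// ltW.
by lra.
Qed.

Definition end_radius : R := 64 * width * radius / slope.

(** By transversality, [cross] with [z1 - z0] grows linearly with the number [l - s] of steps along
    the segment, whereas it is of order [N] for points near the line. The predicate [b] admits both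
    orders of the ends in [near3]. *)
Lemma count_segment t t' (p q a g z0 z1 : V) (b : V -> bool) : (t <= n)%N -> (t' <= n)%N ->
  (0 < t)%N -> (0 < t')%N -> t != t' -> good_end N t p q a g -> z0 \in segment N p q ->
  half_near t' z1 -> enorm z1 <= radius * N%:R -> N%:R <= enorm (z1 - z0) ->
  (forall y, b y -> near3 z0 z1 y) ->
  \sum_(y <- segment N p q) (b y)%:R <= (Num.bound (2 * end_radius)).*2.+1%:R :> R.
Proof.
move=> tn t'n t0 t'0 tt' ge z0S z1n h1 h01 hb.
have hc := segment_cross tn t'n t0 t'0 tt' ge z0S z1n h1.
have enS z : z \in segment N p q -> enorm z <= radius * N%:R.
  move=> zS; apply: le_trans (segment_enorm ge zS) _; rewrite ler_wpM2r ?(ltW N0)//.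
  by rewrite /radius lerDr addr_ge0// mulr_ge0 ?(le_trans _ A1)// mulr_ge0// ltW.
have [s zE _] := segmentP z0S.
rewrite sum_bool_map ler_nat; apply: card_interval => k k' /hb Qk /hb Qk'.
have close (l : 'I_N) : near3 z0 z1 (p + (l%:R / N%:R) *: (q - p)) ->
    `|l%:R - s%:R| <= end_radius.
  move=> near; set y := _ + _ in near.
  have yS : y \in segment N p q by apply/mapP; exists l; rewrite // mem_enum.
  have [r hr] := near3_line h01 (enS _ z0S) (enS _ yS) near.
  set e := y - z0 - r *: (z1 - z0) in hr.
  have e2 : enorm e <= 2 * width by have := width0; lra.
  have := cross_small e2 (diff_enorm h1 (enS _ z0S)).
  have -> : cross p1 p2 e (z1 - z0) = ((l%:R - s%:R) / N%:R) * cross p1 p2 (q - p) (z1 - z0).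
    have -> : e = ((l%:R - s%:R) / N%:R) *: (q - p) - r *: (z1 - z0) by rewrite /e /y {1}zE; vring.
    by rewrite /cross !dotE; ring.
  rewrite normrM normrM normfV (ger0_norm (ltW N0)) => h.
  have {}h : `|l%:R - s%:R| / N%:R * (slope * N%:R ^+ 2 / 8) <= 8 * width * radius * N%:R.
    by apply: le_trans h; rewrite ler_wpM2l// divr_ge0// ltW.
  rewrite /end_radius ler_pdivlMr// -(ler_pM2r N0).
  have E : `|l%:R - s%:R| / N%:R * (slope * N%:R ^+ 2 / 8) = `|l%:R - s%:R| * slope * N%:R / 8.
    by field; rewrite gt_eqF.
  by rewrite E in h; lra.
have hk := close _ Qk; have hk' := close _ Qk'.
apply: (@leq_real_bound R); first by rewrite mulr_ge0// (le_trans _ hk).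
have -> : k%:R - k'%:R = (k%:R - s%:R) - (k'%:R - s%:R) :> R by ring.
by apply: le_trans (ler_normB _ _) _; lra.
Qed.

End scale.

Lemma chain_bound_gt0 (R : realType) (n : nat) (c C : R) : 0 < c -> 0 < C ->
  0 < chain_bound n c C.
Proof. by move=> c0 C0; rewrite /chain_bound !(divr_gt0, mulr_gt0, exprn_gt0). Qed.

(** * Connections at one scale and at many scales *)

Section scale_event.
Variables (R : realType) (n : nat) (u : R).
Local Notation V := 'rV[R]_n.+1.
Local Notation lines := (line R n).
Variables (mu Lam : {measure set lines -> \bar R}).
Context (disp : measure_display) (T : measurableType disp) (P : probability T R).
Variable omega : T -> {measure set lines -> \bar R}.
Hypothesis u0 : 0 < u.
Hypothesis hmu : is_haar mu.
Hypothesis LamE : forall A, Lam A = (u%:E * mu A)%E.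
Hypothesis homega : is_poisson_process P Lam omega.
Local Notation eta := (eta R n).
Local Notation m := n.-1.

Lemma Lam_lty (r : nat) (x y : V) : (Lam (two_hit r%:R x y) < +oo)%E.
Proof. by rewrite LamE (nuE hmu) -EFinM ltry. Qed.

Lemma Lam_two_hit (r : nat) (x y : V) : fine (Lam (two_hit r%:R x y)) = u * nu mu r%:R x y.
Proof. by rewrite LamE (nuE hmu). Qed.

Lemma nu_le (x y : V) : nu mu 1 x y <= nu mu 2 x y.
Proof.
have h : (mu (two_hit 1 x y) <= mu (two_hit 2 x y))%E.
  apply: measure_mono; [exact (@two_hit_measurable _ _ 1 x y ler01)|
    exact (@two_hit_measurable _ _ 2 x y (ler0n R 2))|].
  by move=> L [h1 h2]; split; [apply: hit_le h1|apply: hit_le h2]; rewrite ler1n.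
by rewrite -lee_fin -(nuE hmu 1) -(nuE hmu 2).
Qed.

(* The hypotheses on [p1] and [p2] make the map [z |-> (dot z p1, dot z p2)]
   contract so much that unit balls are negligible. *)
Variables (p1 p2 f1 f2 : V) (A : R).
Hypothesis n2 : (2 <= n)%N.
Hypothesis p1_small : enorm p1 <= eta / (8 * n.+1%:R).
Hypothesis p2_small : enorm p2 <= eta / (8 * n.+1%:R).
Hypothesis f11 : dot f1 p1 = 1.
Hypothesis f12 : dot f1 p2 = 0.
Hypothesis f21 : dot f2 p1 = 0.
Hypothesis f22 : dot f2 p2 = 1.
Hypothesis A1 : 1 <= A.
Hypothesis f1A : enorm f1 <= A.
Hypothesis f2A : enorm f2 <= A.

Definition meets_regions (r : R) (s t : nat) : set lines :=
  [set L | exists z z', [/\ near_parabola p1 p2 r s z, near_parabola p1 p2 r t z',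
    line_set L z & line_set L z']].

Definition scale_lines (r : R) : set lines :=
  [set L | exists s t, [/\ (0 < s < t)%N, (t <= n)%N & meets_regions r s t L]].

(** A common line would meet the three regions [i.+1], [i.+2] and [j.+2]. *)
Lemma meets_regions_disjoint r i j : 0 < r -> (i < j < m)%N ->
  meets_regions r i.+1 i.+2 `&` meets_regions r j.+1 j.+2 = set0.
Proof.
move=> r0 /andP[ij jm]; rewrite -subset0.
move=> L [[z [z' [hz hz' Lz Lz']]] [_ [w [_ hw _ Lw]]]].
apply: (no_three_regions (ltnW n2) r0 _ _ hz hz' hw Lz Lz' Lw); last by lia.
by rewrite ltnSn/= !ltnS.
Qed.

Variable N : nat.
Hypothesis N1 : (n.+1 <= N)%N.
Hypothesis NA : 8 * A <= N%:R.
Hypothesis NB : 80 * radius n A <= slope R n * N%:R.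
Variables (p q a g p' q' a' g' : V).
Hypothesis end1 : good_end p1 p2 A N 1 p q a g.
Hypothesis end2 : good_end p1 p2 A N n p' q' a' g'.

Let N0 : (0 < N)%N. Proof. exact: leq_trans N1. Qed.
Let mn : m.+1 = n. Proof. by move: n2; clear; lia. Qed.
Let m0 : m != 0%N. Proof. by move: n2; clear; lia. Qed.

Definition stations (i : nat) : seq V :=
  if i == 0%N then segment N p q else if i == m then segment N p' q' else middle f1 f2 N i.

Let stations_mid i : (0 < i < m)%N -> stations i = middle f1 f2 N i.
Proof. by move=> /andP[i0 im]; rewrite /stations gtn_eqF// ltn_eqF. Qed.
Let stations_last : stations m = segment N p' q'.
Proof. by rewrite /stations (negbTE m0) eqxx. Qed.

Lemma stations_near i z : (i <= m)%N -> z \in stations i -> half_near p1 p2 N i.+1 z.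
Proof.
rewrite /stations => im; have [->|i0] := eqVneq i 0%N.
  by apply: (segment_near n2 p1_small p2_small A1 N0 NA _ end1); exact: ltnW.
have [->|_] := eqVneq i m; last exact: middle_near.
by rewrite mn; exact: (segment_near n2 p1_small p2_small A1 N0 NA _ end2).
Qed.

Lemma stations_enorm i z : (i <= m)%N -> z \in stations i -> enorm z <= radius n A * N%:R.
Proof.
have le4 : 4 * A <= radius n A.
  by rewrite /radius lerDr addr_ge0// mulr_ge0 ?(le_trans _ A1)// mulr_ge0// exprn_ge0.
move=> im; rewrite /stations; have [_|i0] := eqVneq i 0%N.
  by move=> /(segment_enorm n2 A1 N0 end1) h; apply: le_trans h _; rewrite ler_wpM2r.
have [_|_] := eqVneq i m.
  by move=> /(segment_enorm n2 A1 N0 end2) h; apply: le_trans h _; rewrite ler_wpM2r.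
by apply: middle_enorm => //; lia.
Qed.

Lemma stations_dist i z z' : (i < m)%N -> z \in stations i -> z' \in stations i.+1 ->
  N%:R <= enorm (z' - z).
Proof.
move=> im zi z'i.
exact: (half_near_dist n2 p1_small N0 (stations_near (ltnW im) zi) (stations_near im z'i)).
Qed.

Lemma stations_lines i z z' : (i < m)%N -> z \in stations i -> z' \in stations i.+1 ->
  two_hit 1 z z' `<=` meets_regions N%:R i.+1 i.+2.
Proof.
move=> im zi z'i L [[w Lw wz] [w' Lw' wz']]; exists w, w'; split => //.
- exact: (half_near_ball n2 p1_small p2_small A1 N0 NA (stations_near (ltnW im) zi) wz).
- exact: (half_near_ball n2 p1_small p2_small A1 N0 NA (stations_near im z'i) wz').
Qed.

Lemma stations_parabola i z : (i <= m)%N -> z \in stations i ->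
  near_parabola p1 p2 N%:R i.+1 z.
Proof.
move=> im /(stations_near im) h.
apply: (half_near_ball n2 p1_small p2_small A1 N0 NA h).
by rewrite subrr enorm0.
Qed.

Variables (c C : R).
Hypothesis c0 : 0 < c.
Hypothesis C0 : 0 < C.
Hypothesis cnu : forall x y : V, 1 <= `|x - y| -> c <= nu mu 1 x y * `|x - y| ^+ n.
Hypothesis Cnu : forall x y : V, 1 <= `|x - y| -> nu mu 2 x y * `|x - y| ^+ n <= C.

Definition low_rate : R := Num.min 1 (u * c / (2 * radius n A) ^+ n).
(** One constant for the rate of a step and for the counts of tubes, turns and ends, hence a sum of
    nonnegative terms. *)
Definition high_rate : R := 1 + u * C * n.+1%:R ^+ n
  + (Num.bound (4 * width n A)).*2.+1%:R ^+ n.+1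
  + (Num.bound (2 * turn_radius n A)).*2.+1%:R ^+ n.+1
  + (Num.bound (2 * end_radius n A)).*2.+1%:R.

Let radius0 : 0 < radius n A.
Proof.
rewrite /radius ltr_pwDr//; first by rewrite mulr_gt0// (lt_le_trans _ A1).
by rewrite addr_ge0// mulr_ge0 ?(le_trans _ A1)// mulr_ge0// exprn_ge0.
Qed.

Lemma low_rateP : 0 < low_rate <= 1.
Proof.
rewrite /low_rate ge_min lexx andbT lt_min ltr01/=.
by rewrite divr_gt0 ?exprn_gt0 ?mulr_gt0.
Qed.

Let high_parts : [/\ 1 <= high_rate, u * C * n.+1%:R ^+ n <= high_rate,
  (Num.bound (4 * width n A)).*2.+1%:R ^+ n.+1 <= high_rate,
  (Num.bound (2 * turn_radius n A)).*2.+1%:R ^+ n.+1 <= high_rate &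
  (Num.bound (2 * end_radius n A)).*2.+1%:R <= high_rate].
Proof.
have h1 : 0 <= u * C * n.+1%:R ^+ n.
  by apply: mulr_ge0; [apply: mulr_ge0; exact: ltW|exact: exprn_ge0].
rewrite /high_rate; set x1 := u * C * _ in h1 *; set x2 := _ ^+ n.+1; set x3 := _ ^+ n.+1.
set x4 := _.*2.+1%:R.
have h2 : 0 <= x2 by exact: exprn_ge0.
have h3 : 0 <= x3 by exact: exprn_ge0.
have h4 : 0 <= x4 by exact: ler0n.
by clearbody x1 x2 x3 x4; split; lra.
Qed.

Lemma high_rate_gt0 : 0 < high_rate.
Proof. by have [h _ _ _ _] := high_parts; exact: lt_le_trans h. Qed.

Lemma stations_rate i z z' : (i < m)%N -> z \in stations i -> z' \in stations i.+1 ->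
  low_rate * (N%:R ^+ n)^-1 <= fine (Lam (two_hit 1 z z')) <= high_rate * (N%:R ^+ n)^-1.
Proof.
move=> im zi z'i; rewrite (Lam_two_hit 1).
have h := stations_dist im zi z'i.
have NR : 0 < N%:R :> R by rewrite ltr0n.
have up : `|z - z'| <= 2 * radius n A * N%:R.
  apply: le_trans (norm_le_enorm _) _; apply: le_trans (enormB _ _) _.
  by have := stations_enorm (ltnW im) zi; have := stations_enorm im z'i; lra.
have lo : N%:R / n.+1%:R <= `|z - z'|.
  rewrite ler_pdivrMr// mulrC; apply: le_trans (enorm_le_norm _).
  by rewrite enorm_distC.
have z1 : 1 <= `|z - z'|.
  by apply: le_trans lo; rewrite ler_pdivlMr// mul1r ler_nat.
have zn : 0 < `|z - z'| ^+ n by rewrite exprn_gt0// (lt_le_trans _ z1).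
have Nn : 0 < N%:R ^+ n :> R by rewrite exprn_gt0.
apply/andP; split.
  rewrite ler_pdivrMr//; apply: (@le_trans _ _ (u * c / (2 * radius n A) ^+ n)).
    by rewrite ge_min lexx orbT.
  rewrite ler_pdivrMr ?exprn_gt0 ?mulr_gt0// -!mulrA ler_wpM2l ?(ltW u0)//.
  apply: le_trans (cnu z1) _; rewrite ler_wpM2l ?fine_ge0//.
  by rewrite -exprMn lerXn2r ?nnegrE ?mulr_ge0 ?(ltW radius0)// mulrC.
have [_ hC _ _ _] := high_parts.
rewrite ler_pdivlMr//; apply: le_trans hC; rewrite -!mulrA ler_wpM2l ?(ltW u0)//.
have hN : N%:R ^+ n <= `|z - z'| ^+ n * n.+1%:R ^+ n.
  rewrite -exprMn lerXn2r ?nnegrE ?mulr_ge0//.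
  by move: lo; rewrite ler_pdivrMr.
apply: (@le_trans _ _ (nu mu 2 z z' * (`|z - z'| ^+ n * n.+1%:R ^+ n))).
  by apply: ler_pM => //; [exact: fine_ge0|exact: nu_le].
by rewrite mulrA; apply: ler_wpM2r; [exact: exprn_ge0|exact: Cnu].
Qed.

Let map_size (I : finType) (f : I -> V) : size [seq f i | i : I] = #|I|.
Proof. by rewrite size_map -cardE. Qed.

(** A line that hits the unit balls at both ends of a segment hits those around all its points, so
    the lines to be joined enter only through four points. *)
Lemma scale_event : exists E, [/\ local_events omega (scale_lines N%:R) E,
  chain_bound n low_rate high_rate <= fine (P E) &
  forall w (L L' : lines), E w -> hit p 1 L -> hit q 1 L -> hit p' 1 L' -> hit q' 1 L' ->
    reach (support (omega w)) m L L'].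
Proof.
have cls i z z' := @stations_lines i z z'.
have [h1 _ h3 h4 h5] := high_parts.
have NR : 1 <= N%:R :> R by rewrite ler1n.
have hN : high_rate <= high_rate * N%:R by rewrite ler_peMr// (le_trans _ h1).
have dist i z z' (im : (i < m)%N) zi z'i := @stations_dist i z z' im zi z'i.
have en i z (im : (i <= m)%N) zi := @stations_enorm i z im zi.
exists (some_chain omega stations); split.
- have := @local_seqU _ _ _ _ omega (scale_lines N%:R) _ (chains stations m)
    (chain_event omega).
  apply => s sc; apply: local_mono (chain_event_local cls (leqnn _) sc).
  move=> L [i im h]; exists i.+1, i.+2; split; rewrite ?ltnSn//.
  by move: im n2; clear; lia.
- apply: (some_chain_prob homega N0 low_rateP h1 cls) => //.
  + by move=> i j ij; apply: meets_regions_disjoint; rewrite ?ltr0n.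
  + by move=> x y; exact: (Lam_lty 1).
  + move=> i z z' im zi z'i.
    exact: (@stations_rate i).
  + by rewrite stations_last !map_size card_ord.
  + by move=> i im; rewrite (stations_mid im) map_size card_ffun !card_ord.
  + move=> z0 z1 z0S z1S; apply: le_trans h5.
    have m0' : (0 < m)%N by rewrite lt0n.
    apply: (count_segment n2 p1_small p2_small A1 N0 NA NB _ _ _ _ _ end1 z0S
      (stations_near m0' z1S) (en _ _ m0' z1S) (dist _ _ _ m0' z0S z1S)) => //.
    exact: ltnW.
  + move=> z0 z1 z0S z1S; apply: le_trans h5.
    have mE : m.-1.+1 = m by rewrite prednK// lt0n.
    have mp : (m.-1 < m)%N by rewrite mE.
    have z1S' : z1 \in segment N p' q' by rewrite -stations_last.
    have z1S2 : z1 \in stations m.-1.+1 by rewrite mE.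
    rewrite stations_last.
    have n0 := stations_near (ltnW mp) z0S; rewrite mE in n0.
    apply: (count_segment n2 p1_small p2_small A1 N0 NA NB _ _ _ _ _ end2 z1S'
      n0 (en _ _ (ltnW mp) z0S)) => //.
    * by move: n2; clear; lia.
    * exact: ltnW.
    * by rewrite lt0n.
    * by rewrite -{1}mn gtn_eqF.
    * by rewrite enorm_distC; exact: (dist _ _ _ mp z0S z1S2).
    * by move=> y; rewrite near3_swap.
  + move=> i z0 z1 im z0S z1S; have /andP[i0 i1] := im; rewrite (stations_mid im).
    apply: le_trans (ler_wpM2r (ler0n R N) h3).
    apply: (count_tube n2 A1 f1A f2A N0 NA _ (dist _ _ _ i1 z0S z1S) (en _ _ (ltnW i1) z0S)).
    by move: i1; clear; lia.
  + move=> i z0 z1 i1 z0S z1S.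
    have im : (0 < i.+1 < m)%N by [].
    rewrite (stations_mid im).
    apply: le_trans (ler_wpM2r (ler0n R N) h3).
    have i1' := ltnW i1.
    apply: (count_tube n2 A1 f1A f2A N0 NA _ (dist _ _ _ i1' z0S z1S) (en _ _ (ltnW i1') z0S)).
    by move: i1; clear; lia.
  + move=> i z0 z1 z2 i1 z0S z1S z2S; have i1' := ltnW i1.
    have im : (0 < i.+1 < m)%N by [].
    rewrite (stations_mid im); apply: le_trans h4.
    have b0 := stations_parabola (ltnW i1') z0S.
    have b1 := stations_parabola i1' z1S; have b2 := stations_parabola i1 z2S.
    have i123 : (i.+1 < i.+2 < i.+3)%N by rewrite !ltnSn.
    have i3 : (i.+3 <= n)%N by move: i1; clear; lia.
    have [_ hc _] := half_near_cross n2 N0 i123 i3 b0 b1 b2.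
    apply: (count_turn n2 p1_small p2_small A1 f1A f2A N0 NA _ hc (dist _ _ _ i1' z0S z1S)
      (dist _ _ _ i1 z1S z2S) (en _ _ (ltnW i1') z0S) (en _ _ i1' z1S) (en _ _ i1 z2S)).
    by move: i1; clear; lia.
- move=> w L L' [s sc sw] pL qL p'L' q'L'.
  have seg (x y z : V) M : hit x 1 M -> hit y 1 M -> z \in segment N x y -> hit z 1 M.
    move=> hx hy /(segmentP N0)[k -> k01].
    by apply: hit_segment.
  have [y [s' [sE yS lastS]]] : exists y s', [/\ s = y :: s', y \in stations m &
      size s' = m /\ last y s' \in stations 0%N].
    elim: m s sc {sw} => [|k IH] s sc.
      by move: sc => /mapP[z zS ->]; exists z, [::].
    have [y [x [t [-> yS xS tc]]]] := chainsP sc.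
    have [y' [s' [e _ [sz ls]]]] := IH _ tc.
    move: e => -[e1 e2]; exists y, (x :: t); split => //=.
    by rewrite e2 e1 sz.
  rewrite sE in sw; have := chain_event_reach homega sw; rewrite lastS.1; apply.
    by apply: seg pL qL _; exact: lastS.2.
  by apply: seg p'L' q'L' _; rewrite -stations_last.
Qed.

End scale_event.

Lemma geometric_small (R : realType) (c M e : R) : 0 < c <= 1 -> 0 < e ->
  exists K : nat, (1 - c) ^+ K * M <= e.
Proof.
move=> /andP[c0 c1] e0.
have [M0|M0] := leP M 0.
  by exists 0%N; rewrite expr0 mul1r (le_trans M0)// ltW.
have r1 : `|1 - c| < 1 by rewrite ger0_norm ?subr_ge0//; lra.
have := @cvg_expr R _ r1; move=> /cvgrPdist_lt/(_ (e / M)).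
rewrite divr_gt0// => /(_ isT)[K _ /(_ K (leqnn K))] /=.
rewrite sub0r normrN => h; exists K; rewrite -ler_pdivlMr//.
by apply: le_trans (ler_norm _) (ltW h).
Qed.

(** * Independent trials and their failure *)

Section repeated_trials.
Variables (R : realType) (n : nat).
Local Notation lines := (line R n).
Variables (Lam : {measure set lines -> \bar R}).
Context (disp : measure_display) (T : measurableType disp) (P : probability T R).
Variable omega : T -> {measure set lines -> \bar R}.
Hypothesis homega : is_poisson_process P Lam omega.

Fixpoint failures (E : nat -> set T) (F : set T) (k : nat) : set T :=
  if k is k'.+1 then failures E F k' `&` ~` E k' else F.

Lemma failuresP E F k w : failures E F k w <-> F w /\ forall j, (j < k)%N -> ~ E j w.
Proof.
elim: k => [|k IH] /=; first by split => [|[]].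
split => [[/IH[Fw h] Ek]|[Fw h]].
  by split => // j; rewrite ltnS leq_eqVlt => /orP[/eqP ->|/h].
by split; [apply/IH; split => // j jk; apply: h; exact: ltnW|exact: h].
Qed.

(* The trials [E k] depend on pairwise disjoint sets of lines. *)
Lemma failures_prob (c : R) (K : nat) (A : set lines) (D : nat -> set lines) E F :
  c <= 1 -> local_events omega A F ->
  (forall k, (k < K)%N -> [/\ local_events omega (D k) (E k), c <= fine (P (E k)),
    A `&` D k = set0 & forall j, (j < k)%N -> D j `&` D k = set0]) ->
  measurable (failures E F K) /\ (P (failures E F K) <= ((1 - c) ^+ K)%:E * P F)%E.
Proof.
move=> c1 AF; pose B k : set lines := A `|` [set L | exists2 j, (j < k)%N & D j L].
elim: K => [|K IH] h.
  by split; [exact: (local_measurable homega AF)|rewrite expr0 mul1e].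
have [k_ k_'] : (forall k, (k < K)%N -> (k < K.+1)%N) /\ (K < K.+1)%N.
  by split => // k kK; exact: ltnW.
have {}IH := IH (fun k kK => h k (k_ k kK)).
have [lE cE AD DD] := h K k_'.
have lF : local_events omega (B K) (failures E F K).
  have H k : (k <= K)%N -> local_events omega (B k) (failures E F k).
    elim: k => [|k IHk] kK.
      by apply: local_mono AF => L AL; left.
    have [lEk _ _ _] := h k (k_ k kK).
    refine (local_setI _ (local_setC _)).
      apply: local_mono (IHk (ltnW kK)) => L [AL|[j jk Dj]]; first by left.
      by right; exists j => //; exact: ltnW.
    by apply: local_mono lEk => L Dk; right; exists k.
  exact: H.
have mE := local_measurable homega lE.
split; first by apply: measurableI; [case: IH|exact: measurableC].
have BD : B K `&` D K = set0.
  rewrite -subset0 => L [[AL|[j jK Dj]] DK]; first by rewrite -AD.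
  by rewrite -(DD j jK).
have -> : P (failures E F K.+1) = (P (failures E F K) * P (~` E K))%E.
  refine (local_indep homega BD lF (local_setC lE)).
rewrite exprSr EFinM muleAC; apply: lee_pmul => //; first by case: IH.
have PE : P (E K) = (fine (P (E K)))%:E by rewrite fineK// fin_num_measure.
by rewrite probability_setC// PE -EFinB lee_fin; lra.
Qed.

End repeated_trials.

Section pair_of_regions.
Variables (R : realType) (n : nat) (u : R).
Local Notation V := 'rV[R]_n.+1.
Local Notation lines := (line R n).
Variables (mu Lam : {measure set lines -> \bar R}).
Context (disp : measure_display) (T : measurableType disp) (P : probability T R).
Variable omega : T -> {measure set lines -> \bar R}.
Hypothesis u0 : 0 < u.
Hypothesis hmu : is_haar mu.
Hypothesis LamE : forall A, Lam A = (u%:E * mu A)%E.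
Hypothesis homega : is_poisson_process P Lam omega.
Local Notation eta := (eta R n).
Local Notation m := n.-1.
Variables (p1 p2 f1 f2 : V).
Hypothesis n2 : (2 <= n)%N.
Hypothesis p1_small : enorm p1 <= eta / (8 * n.+1%:R).
Hypothesis p2_small : enorm p2 <= eta / (8 * n.+1%:R).
Hypothesis f11 : dot f1 p1 = 1.
Hypothesis f12 : dot f1 p2 = 0.
Hypothesis f21 : dot f2 p1 = 0.
Hypothesis f22 : dot f2 p2 = 1.
Variables (x y x' y' : V).
Hypothesis v1 : `|dot (y - x) p1 - 1| <= eta / 32.
Hypothesis v2 : `|dot (y - x) p2 - 1| <= eta / 32.
Hypothesis v1' : `|dot (y' - x') p1 - n%:R| <= eta / 32.
Hypothesis v2' : `|dot (y' - x') p2 - n%:R ^+ 2| <= eta / 32.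

Local Notation U := (two_hit 1 x y : set lines).
Local Notation U' := (two_hit 1 x' y' : set lines).
Let A : R := 3 + enorm f1 + enorm f2 + enorm x + enorm y + enorm x' + enorm y'.
Let eta0 : 0 < eta := eta_gt0 R (ltnW n2).
Let mU (a b : V) : measurable (two_hit 1 a b : set lines).
Proof. exact (@two_hit_measurable _ _ 1 a b ler01). Qed.

Let A3 : 3 <= A.
Proof.
rewrite /A; have := enorm_ge0 f1; have := enorm_ge0 f2; have := enorm_ge0 x.
by have := enorm_ge0 y; have := enorm_ge0 x'; have := enorm_ge0 y'; lra.
Qed.

Definition mesh_size (N : nat) : nat := Num.bound (4 * A * N%:R * n.+1%:R).
(** Finitely many candidates for the ends of the segments. *)
Definition mesh (N : nat) : seq V :=
  [seq gridv n.+1%:R^-1 f | f : {ffun 'I_n.+1 -> 'I_((mesh_size N).*2.+1)}].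

Lemma mesh_approx (N : nat) (z : V) : enorm z <= 4 * A * N%:R ->
  exists2 p, p \in mesh N & enorm (p - z) <= 1.
Proof.
move=> zA; have [//|f [hf _]] := @grid_round R n.+1 n.+1 (mesh_size N) z (ltn0Sn n).
  move=> i; have h : `|z ord0 i| <= 4 * A * N%:R by apply: le_trans (coord_le_enorm _ _) zA.
  apply: le_trans (ler_wpM2r _ h) _ => //; rewrite ltW// archi_boundP// !mulr_ge0//.
  by rewrite (le_trans _ A3).
exists (gridv n.+1%:R^-1 f); first by apply/mapP; exists f; rewrite // mem_enum.
rewrite -[leRHS]invr1; apply: (@enorm_grid_round R n.+1 1) => // i.
by rewrite distrC muln1.
Qed.

(** The direction [g] joins points of [L] near [a] and [b]; the ends are mesh points near the points
    of [L] at parameters [N] and [N * (1 + slope)]. *)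
Lemma end_exists (N t : nat) (a b : V) (L : lines) : (1 <= N)%N ->
  enorm a <= A - 1 -> enorm b + enorm a <= A - 2 ->
  `|dot (b - a) p1 - t%:R| <= eta / 32 -> `|dot (b - a) p2 - t%:R ^+ 2| <= eta / 32 ->
  two_hit 1 a b L ->
  exists p q al g, [/\ p \in mesh N, q \in mesh N, good_end p1 p2 A N t p q al g,
    hit p 1 L & hit q 1 L].
Proof.
move=> N1 aA baA h1 h2 [[al Lal ala] [be Lbe beb]].
have NR : 1 <= N%:R :> R by rewrite ler1n.
pose g := be - al.
have alA : enorm al <= A.
  have -> : al = (al - a) + a by vring.
  by apply: le_trans (enormD _ _) _; lra.
have ge : enorm (g - (b - a)) <= 2.
  have -> : g - (b - a) = (be - b) - (al - a) by rewrite /g; vring.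
  by apply: le_trans (enormB _ _) _; lra.
have gA : enorm g <= A.
  have -> : g = (g - (b - a)) + (b - a) by vring.
  apply: le_trans (enormD _ _) _; apply: le_trans (lerD ge (enormB _ _)) _; lra.
have sl1 : 0 <= slope R n <= 1.
  have nn : 1 <= n%:R ^+ 2 :> R by rewrite exprn_ege1// ler1n ltnW.
  have eta32 := eta_le R (ltnW n2).
  rewrite /slope; apply/andP; split; first by rewrite divr_ge0 ?(ltW eta0)// mulr_ge0 ?exprn_ge0.
  rewrite ler_pdivrMr; first by lra.
  by rewrite mulr_gt0// (lt_le_trans _ nn).
have pt (s : R) : 0 <= s <= 2 -> enorm (al + (N%:R * s) *: g) <= 4 * A * N%:R.
  move=> /andP[s0 s2]; apply: le_trans (enormD _ _) _.
  rewrite enormZ ger0_norm; last by rewrite mulr_ge0.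
  have : N%:R * s * enorm g <= N%:R * 2 * A.
    apply: ler_pM => //; [by rewrite mulr_ge0|exact: enorm_ge0|by rewrite ler_wpM2l].
  by have := A3; nra.
have dotg (p : V) (e : R) : enorm p <= eta / (8 * n.+1%:R) -> `|dot (b - a) p - e| <= eta / 32 ->
    `|dot g p - e| <= eta / 8.
  move=> hp h; have -> : dot g p - e = dot (g - (b - a)) p + (dot (b - a) p - e).
    by rewrite !dotE; ring.
  apply: le_trans (ler_normD _ _) _.
  have eps0 : 0 <= eta / (8 * n.+1%:R) by rewrite divr_ge0 ?(ltW eta0).
  have := dot_abs_le (g - (b - a)) eps0 hp.
  (* From [n >= 2]; then [2 / 24 + 1 / 32 <= 1 / 8] gives the tolerance of [good_end]. *)
  have e24 : eta / (8 * n.+1%:R) <= eta / 24.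
    rewrite ler_wpM2l ?(ltW eta0)// lef_pV2 ?posrE//.
      by rewrite -(natrM R 8) ler_nat; move: n2; clear; lia.
  have e12 := ler_pM eps0 (enorm_ge0 _) e24 ge.
  move=> /le_trans/(_ e12) {e12}; have := eta0; lra.
have s1 : 0 <= (1 : R) <= 2 by apply/andP; split; lra.
have s2 : 0 <= 1 + slope R n <= 2 by move: sl1 => /andP[? ?]; apply/andP; split; lra.
have [p pM hp] := mesh_approx (pt _ s1); have [q qM hq] := mesh_approx (pt _ s2).
exists p, q, al, g; split => //.
- split; [by split|exact: dotg|exact: dotg| |].
    by rewrite mulr1 in hp.
  by [].
- exists (al + (N%:R * 1) *: g); first exact: line_affine.
  by rewrite enorm_distC.
- exists (al + (N%:R * (1 + slope R n)) *: g); first exact: line_affine.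
  by rewrite enorm_distC.
Qed.

Lemma scale_lines_origin r L z : 0 < r -> scale_lines p1 p2 r L -> line_set L z ->
  near_parabola p1 p2 r 0 z -> False.
Proof.
move=> r0 [s [t [/andP[s0 st] tn [zs [zt [hs ht Ls Lt]]]]]] Lz hz.
by apply: (no_three_regions (ltnW n2) r0 _ tn hz hs ht Lz Ls Lt); rewrite s0.
Qed.

(** Seen from the much larger scale [r'], the regions of scale [r] lie in the region of parameter 0,
    and no line meets three regions. *)
Lemma scale_lines_disjoint r r' : 0 < r -> (n%:R ^+ 2 + 1) * r <= eta * r' ->
  scale_lines p1 p2 r `&` scale_lines p1 p2 r' = set0.
Proof.
move=> r0 rr'; rewrite -subset0 => L [[s [t [/andP[s0 st] tn [zs [_ [[h1 h2] _ Ls _]]]]]] h'].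
have nn : 1 <= n%:R ^+ 2 :> R by rewrite exprn_ege1// ler1n ltnW.
have r'0 : 0 < r'.
  by rewrite -(pmulr_rgt0 _ eta0); apply: lt_le_trans rr'; rewrite mulr_gt0//; lra.
have eta32 := eta_le R (ltnW n2).
have le (e d : R) : 0 <= e <= n%:R ^+ 2 -> `|d - r * e| <= eta * r -> `|d| <= eta * r'.
  move=> /andP[e0 en] h; apply: le_trans rr'.
  have -> : d = (d - r * e) + r * e by ring.
  apply: le_trans (ler_normD _ _) _; have hre : `|r * e| <= r * n%:R ^+ 2.
    by rewrite ger0_norm ?mulr_ge0 ?(ltW r0)// ler_wpM2l// ltW.
  apply: le_trans (lerD h hre) _; rewrite mulrDl mul1r addrC mulrC lerD2l.
  by rewrite ler_piMl ?(ltW r0)//; lra.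
have sn : s%:R <= n%:R :> R by rewrite ler_nat; apply: leq_trans tn; exact: ltnW.
have n1 : 1 <= n%:R :> R by rewrite ler1n ltnW.
apply: (scale_lines_origin r'0 h' Ls); split; rewrite ?expr0n/= mulr0 subr0.
  by apply: le h1; rewrite ler0n/=; apply: le_trans sn _; rewrite expr2 ler_peMr.
by apply: le h2; rewrite exprn_ge0//= lerXn2r ?nnegrE.
Qed.

Lemma good_scales : exists (c : R) (N0 : nat), [/\ 0 < c, (1 <= N0)%N, 8 * A <= N0%:R &
  forall (N : nat) (p q a g p' q' a' g' : V), (N0 <= N)%N ->
    good_end p1 p2 A N 1 p q a g -> good_end p1 p2 A N n p' q' a' g' ->
    exists E, [/\ local_events omega (scale_lines p1 p2 N%:R) E, c <= fine (P E) &
    forall w (L L' : lines), E w -> hit p 1 L -> hit q 1 L -> hit p' 1 L' -> hit q' 1 L' ->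
    reach (support (omega w)) m L L']].
Proof.
have [c c0 cnu] := nu_lower hmu; have [C C0 Cnu] := nu_upper hmu.
have A1 : 1 <= A by have := A3; lra.
have fA : enorm f1 <= A /\ enorm f2 <= A.
  rewrite /A; have := enorm_ge0 f1; have := enorm_ge0 f2; have := enorm_ge0 x.
  by have := enorm_ge0 y; have := enorm_ge0 x'; have := enorm_ge0 y'; split; lra.
have sl0 : 0 < slope R n.
  by rewrite /slope; apply: divr_gt0 => //; apply: mulr_gt0 => //; rewrite exprn_gt0// ltr0n ltnW.
pose N0 := (n.+1 + Num.bound (8 * A) + Num.bound (80 * radius n A / slope R n))%N.
have N0A (N : nat) : (N0 <= N)%N -> 8 * A <= N%:R.
  move=> N0N; have a0 : 0 <= 8 * A by rewrite mulr_ge0// (le_trans _ A1).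
  apply: le_trans (ltW (archi_boundP a0)) _; rewrite ler_nat; apply: leq_trans N0N.
  by rewrite /N0 addnAC leq_addl.
exists (chain_bound n (low_rate n u A c) (high_rate n u A C)), N0; split.
- have /andP[l0 _] := low_rateP n u0 A1 c0.
  by apply: chain_bound_gt0 => //; exact: high_rate_gt0.
- by rewrite /N0 -addnA addSn.
- exact: N0A.
move=> N p q a g p' q' a' g' N0N e1 e2.
have rad0 : 0 <= 80 * radius n A / slope R n.
  rewrite divr_ge0 ?(ltW sl0)// mulr_ge0//.
  by rewrite /radius !addr_ge0 ?mulr_ge0 ?exprn_ge0 ?(le_trans _ A1).
apply: (scale_event u0 hmu LamE homega n2 p1_small p2_small f11 f12 f21 f22 A1 fA.1 fA.2 _ (N0A N N0N) _ e1 e2 c0 C0 cnu Cnu).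
- by apply: leq_trans N0N; rewrite /N0 -addnA leq_addr.
- rewrite -ler_pdivrMl// mulrC.
  apply: le_trans (ltW (archi_boundP rad0)) _; rewrite ler_nat; apply: leq_trans N0N.
  by rewrite /N0 leq_addl.
Qed.

(* The stations of scale [N k] depend on the lines to be joined through mesh points at
   distance of order [N k]; the cells split [U] and [U'] into finitely many sets of
   lines sharing these mesh points for all [k < K], and [K] independent scales remain
   for each pair of cells. *)
Lemma unreached_pairs (e : R) : 0 < e ->
  outer_le P [set w | exists L L' : lines, [/\ support (omega w) L, support (omega w) L',
    U L, U' L' & ~ reach (support (omega w)) m L L']] e.
Proof.
move=> e0; have [c0 [N0 [c0_gt0 N0_gt0 N0A good]]] := good_scales.
pose c := Num.min c0 1.
have c01 : 0 < c <= 1 by rewrite /c lt_min c0_gt0 ltr01 ge_min lexx orbT.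
have cc0 : c <= c0 by rewrite /c ge_min lexx.
have LU : (Lam U < +oo)%E by exact: (Lam_lty hmu LamE 1).
have LU' : (Lam U' < +oo)%E by exact: (Lam_lty hmu LamE 1).
(* Bounds the sum over all pairs of cells, however many there are; this allows [K] to be fixed
   before the cells, which depend on it. *)
pose M := fine (Lam U) + fine (Lam U) * fine (Lam U').
have [K hK] := geometric_small M c01 e0.
pose B := (Num.bound ((n%:R ^+ 2 + 1) / eta)).+1.
have hB : n%:R ^+ 2 + 1 <= eta * B%:R.
  rewrite -ler_pdivrMl// mulrC; have q0 : 0 <= (n%:R ^+ 2 + 1) / eta.
    by rewrite divr_ge0 ?(ltW eta0)// addr_ge0// exprn_ge0.
  by apply: le_trans (ltW (archi_boundP q0)) _; rewrite ler_nat.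
pose N k := (N0 * B ^ k)%N.
have N0N k : (N0 <= N k)%N by rewrite leq_pmulr// expn_gt0.
have Npos k : (1 <= N k)%N by exact: leq_trans N0_gt0 (N0N k).
have NR k : 0 < (N k)%:R :> R by rewrite ltr0n.
have NN j k : (j < k)%N -> (n%:R ^+ 2 + 1) * (N j)%:R <= eta * (N k)%:R.
  move=> jk; apply: le_trans (ler_wpM2r (ltW (NR j)) hB) _.
  rewrite -mulrA -natrM ler_wpM2l ?(ltW eta0)// ler_nat.
  by rewrite /N mulnCA leq_mul2l -expnS leq_pexp2l// orbT.
pose pts : seq V := flatten [seq mesh (N k) | k <- iota 0 K].
pose H j : set lines := hit (nth 0 pts j) 1.
have mH j : measurable (H j) by exact (@hit_measurable _ _ (nth 0 pts j) 1 ler01).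
pose J := size pts.
(* The unit balls around all mesh points are among the sets defining the cells, so lines of one cell
   hit the same balls. *)
have cellP (b : {ffun 'I_J -> bool}) L L0 p k : (k < K)%N -> p \in mesh (N k) ->
    cell H b L -> cell H b L0 -> hit p 1 L0 -> hit p 1 L.
  move=> kK pM bL bL0 pL0.
  have pP : p \in pts.
    by apply/flattenP; exists (mesh (N k)) => //; apply/mapP; exists k; rewrite // mem_iota.
  have jJ : (index p pts < J)%N by rewrite index_mem.
  have := congr1 (fun f : {ffun _ -> _} => f (Ordinal jJ)) (etrans bL0 (esym bL)).
  by rewrite !ffunE /H /= nth_index// => h; apply/asboolP; rewrite -h; apply/asboolP.
have mC (b : {ffun 'I_J -> bool}) : measurable (U `&` cell H b : set lines).
  by apply: measurableI => //; exact: cell_measurable.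
have mC' (b : {ffun 'I_J -> bool}) : measurable (U' `&` cell H b : set lines).
  by apply: measurableI => //; exact: cell_measurable.
have fC (b : {ffun 'I_J -> bool}) : (Lam (U `&` cell H b) < +oo)%E.
  by apply: le_lt_trans LU; apply: measure_mono => // L [].
have fC' (b : {ffun 'I_J -> bool}) : (Lam (U' `&` cell H b) < +oo)%E.
  by apply: le_lt_trans LU'; apply: measure_mono => // L [].
pose Y (i : {ffun 'I_J -> bool} * {ffun 'I_J -> bool}) : set T :=
  [set w | exists L L' : lines, [/\ support (omega w) L, support (omega w) L',
    (U `&` cell H i.1) L, (U' `&` cell H i.2) L' & ~ reach (support (omega w)) m L L']].
pose a (i : {ffun 'I_J -> bool} * {ffun 'I_J -> bool}) : R := fine (Lam ((U `&` cell H i.1) `&` (U' `&` cell H i.2))).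
pose a1 (b : {ffun 'I_J -> bool}) : R := fine (Lam (U `&` cell H b)).
pose a2 (b : {ffun 'I_J -> bool}) : R := fine (Lam (U' `&` cell H b)).
have aE i : Lam ((U `&` cell H i.1) `&` (U' `&` cell H i.2)) = (a i)%:E.
  rewrite fineK// ge0_fin_numE//; apply: le_lt_trans (fC i.1).
  by apply: measure_mono => //; exact: measurableI.
have a1E b : Lam (U `&` cell H b) = (a1 b)%:E by rewrite fineK// ge0_fin_numE.
have a2E b : Lam (U' `&` cell H b) = (a2 b)%:E by rewrite fineK// ge0_fin_numE.
have hY i : outer_le P (Y i) ((1 - c) ^+ K * (a i + a1 i.1 * a2 i.2)).
  have nn : 0 <= (1 - c) ^+ K * (a i + a1 i.1 * a2 i.2).
    rewrite mulr_ge0 ?exprn_ge0 ?subr_ge0 ?(andP c01).2//.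
    by rewrite addr_ge0 ?mulr_ge0// fine_ge0.
  (* A cell without lines contributes nothing; otherwise an arbitrary line in it, fixed once and for
     all, dictates the mesh points. *)
  have [[L0 [UL0 bL0]]|no] := pselect (exists L0, (U `&` cell H i.1) L0); last first.
    exists set0; split => //; last by rewrite measure0 lee_fin.
    by move=> w [L [L' [_ _ UL _ _]]]; apply: no; exists L.
  have [[L0' [UL0' bL0']]|no] := pselect (exists L0, (U' `&` cell H i.2) L0); last first.
    exists set0; split => //; last by rewrite measure0 lee_fin.
    by move=> w [L [L' [_ _ _ UL' _]]]; apply: no; exists L'.
  have [xA yA x'A y'A] : [/\ enorm x <= A - 1, enorm y + enorm x <= A - 2,
      enorm x' <= A - 1 & enorm y' + enorm x' <= A - 2].
    rewrite /A; have := enorm_ge0 f1; have := enorm_ge0 f2; have := enorm_ge0 x.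
    by have := enorm_ge0 y; have := enorm_ge0 x'; have := enorm_ge0 y'; split; lra.
  have /choice[E EP] k : exists E, (k < K)%N -> [/\
      local_events omega (scale_lines p1 p2 (N k)%:R) E, c <= fine (P E) &
      forall w (L L' : lines), E w -> (U `&` cell H i.1) L -> (U' `&` cell H i.2) L' ->
      reach (support (omega w)) m L L'].
    have [kK|kK] := ltnP k K; last by exists set0.
    have [|p [q [al [g [pM qM ge1 hp hq]]]]] :=
        @end_exists (N k) 1 x y L0 (Npos k) xA yA v1 _ UL0; first by rewrite expr1n.
    have [p' [q' [al' [g' [pM' qM' ge2 hp' hq']]]]] :=
        @end_exists (N k) n x' y' L0' (Npos k) x'A y'A v1' v2' UL0'.
    have [E [lE cE rE]] := good _ _ _ _ _ _ _ _ _ (N0N k) ge1 ge2.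
    exists E => _; split => //; first exact: le_trans cE.
    move=> w L L' Ew [_ bL] [_ bL']; apply: (rE w L L' Ew).
    - exact: cellP kK pM bL bL0 hp.
    - exact: cellP kK qM bL bL0 hq.
    - exact: cellP kK pM' bL' bL0' hp'.
    - exact: cellP kK qM' bL' bL0' hq'.
  pose F := occ omega (U `&` cell H i.1) `&` occ omega (U' `&` cell H i.2).
  have AF : local_events omega (U `|` U') F.
    refine (local_setI (local_occ (mC i.1) _) (local_occ (mC' i.2) _)).
      by move=> L [? _]; left.
    by move=> L [? _]; right.
  have N0k k : 8 * A <= (N k)%:R by apply: le_trans N0A _; rewrite ler_nat.
  (* Lines through the original balls meet the region of parameter 0 at every scale, so no scale
     uses them and the trials are independent of [F]. *)
  have orig k (b : V) (L : lines) : enorm b <= A - 1 -> hit b 1 L ->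
      ~ scale_lines p1 p2 (N k)%:R L.
    move=> bA [z Lz zb] sL; have zA : enorm z <= A.
      have -> : z = (z - b) + b by vring.
      by apply: le_trans (enormD _ _) _; lra.
    have A1 : 1 <= A by have := A3; lra.
    exact: (scale_lines_origin (NR k) sL Lz (near_origin n2 p1_small p2_small A1 (N0k k) zA)).
  have [mG PG] : measurable (failures E F K) /\
      (P (failures E F K) <= ((1 - c) ^+ K)%:E * P F)%E.
    apply: (failures_prob homega (andP c01).2 AF (D := fun k => scale_lines p1 p2 (N k)%:R)).
    move=> k kK; have [lE cE _] := EP k kK; split => //.
      rewrite -subset0 => L [[[xL _]|[xL _]] sL].
        exact: (orig k x L).
      exact: (orig k x' L).
    by move=> j jk; apply: scale_lines_disjoint; rewrite ?NN.
  exists (failures E F K); split => //.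
    move=> w [L [L' [SL SL' UL UL' nr]]]; apply/failuresP; split.
      by split; apply/(occP homega) => //; [exists L|exists L'].
    by move=> j jK Ej; apply: nr; have [_ _ h] := EP j jK; exact: h.
  apply: le_trans PG _; rewrite EFinM; apply: lee_wpmul2l.
    by rewrite lee_fin exprn_ge0// subr_ge0 (andP c01).2.
  apply: le_trans (occ2_prob_le homega (mC _) (mC' _)) _.
  by rewrite aE a1E a2E -EFinM -EFinD.
have := @outer_le_cover _ _ _ P _ (enum {: {ffun 'I_J -> bool} * {ffun 'I_J -> bool}}) _ Y _ _
  (fun i _ => hY i).
move=> /(_ [set w | exists L L' : lines, [/\ support (omega w) L, support (omega w) L',
    U L, U' L' & ~ reach (support (omega w)) m L L']]); move=> h.
apply: outer_le_sub (h _) => //.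
  rewrite -mulr_sumr; apply: le_trans hK.
  apply: ler_wpM2l; first by rewrite exprn_ge0// subr_ge0 (andP c01).2.
  rewrite big_enum/= big_split/=; apply: lerD.
    rewrite -lee_fin -sumEFin; under eq_bigr do rewrite -aE.
    rewrite fineK ?ge0_fin_numE// -[leRHS]mul1e.
    apply: (@measure_multiplicity _ _ _ Lam _ U _ 1) => //.
    - by move=> i; apply: measurableI.
    - by move=> i L [[]].
    - move=> L UL; apply/card_le1P => i; rewrite !inE => /set_mem[[_ h1] [U'L h2]].
      move=> j; rewrite !inE; apply/idP/eqP => [/set_mem[[_ h3] [_ h4]]|->].
        by apply/eqP; rewrite /eq_op/= -h1 -h2 -h3 -h4 !eqxx.
      by apply/mem_set; split; split.
  have sum1 W (aa : _ -> R) : measurable W -> (Lam W < +oo)%E ->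
      (forall b, Lam (W `&` cell H b) = (aa b)%:E) -> \sum_(b : {ffun 'I_J -> bool}) aa b <= fine (Lam W).
    move=> mW fW aaE; rewrite -lee_fin -sumEFin; under eq_bigr do rewrite -aaE.
    rewrite fineK ?ge0_fin_numE// -[leRHS]mul1e.
    apply: (@measure_multiplicity _ _ _ Lam _ W _ 1) => //.
    - by move=> b; apply: measurableI => //; exact: cell_measurable.
    - move=> L WL; apply/card_le1P => i; rewrite !inE => /set_mem[_ h1].
      move=> j; rewrite !inE; apply/idP/eqP => [/set_mem[_ h2]|->]; first by rewrite -h1 -h2.
      by apply/mem_set; split.
  have -> : \sum_(i : {ffun 'I_J -> bool} * {ffun 'I_J -> bool}) a1 i.1 * a2 i.2 =
      (\sum_b a1 b) * (\sum_b a2 b).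
    rewrite big_distrlr/= pair_big/=; by apply: eq_bigr => -[].
  apply: ler_pM; [by apply: sumr_ge0 => b _; exact: fine_ge0|
    by apply: sumr_ge0 => b _; exact: fine_ge0|exact: sum1|exact: sum1].
move=> w [L [L' [SL SL' UL UL' nr]]].
exists (signature H J L, signature H J L'); first by rewrite mem_enum.
by exists L, L'; split.
Qed.

End pair_of_regions.

Lemma negligible_countable (d : measure_display) (T : measurableType d) (R : realType)
    (m : {measure set T -> \bar R}) (I : countType) (X : I -> set T) :
  (forall i, m.-negligible (X i)) -> m.-negligible (\bigcup_i X i).
Proof.
move=> mX; apply: (@negligibleS _ _ _ _
    (\bigcup_k if choice.unpickle k is Some i then X i else set0)).
  by move=> w [i _ Xw]; exists (choice.pickle i); rewrite // choice.pickleK.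
by apply: negligible_bigcup => k; case: choice.unpickle => // ; exact: negligible_set0.
Qed.

(** * A countable separating family; dual vectors of two directions *)

Section base.
Variables (R : realType) (n : nat).
Local Notation V := 'rV[R]_n.+1.
Local Notation lines := (line R n).

Definition lat (j : nat) (z : 'rV[int]_n.+1) : V :=
  \row_i ((z ord0 i)%:~R / (n.+1 * j.+1)%:R).

Lemma lat_approx j (x : V) : exists z, enorm (x - lat j z) <= j.+1%:R^-1.
Proof.
exists (\row_i Num.floor (x ord0 i * (n.+1 * j.+1)%:R)).
by apply: enorm_grid_round => // i; rewrite !mxE coord_round.
Qed.

Definition base (c : nat * 'rV[int]_n.+1) : set lines := hit (lat c.1 c.2) c.1.+1%:R^-1.

Lemma base_measurable c : measurable (base c).
Proof. by apply: (@hit_measurable _ _ _ c.1.+1%:R^-1); rewrite invr_ge0. Qed.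

Lemma inv_small (e : R) : 0 < e -> exists j : nat, j.+1%:R^-1 <= e.
Proof.
move=> e0; exists (Num.bound e^-1); rewrite -[leRHS]invrK lef_pV2 ?posrE ?invr_gt0//.
apply: le_trans (ltW (archi_boundP _)) _; first by rewrite invr_ge0 ltW.
by rewrite ler_nat.
Qed.

Lemma base_separates (L L' : lines) : L <> L' -> exists c, base c L /\ ~ base c L'.
Proof.
move=> /line_separate[x [r [r0 Lx nL']]].
have [j hj] := inv_small (divr_gt0 r0 (ltr0n R 2)).
have [z hz] := lat_approx j x; exists (j, z); split; first by exists x.
move=> [p L'p pz]; apply: nL'; exists p => //.
have -> : p - x = (p - lat j z) - (x - lat j z) by vring.
have {}pz : enorm (p - lat j z) <= j.+1%:R^-1 := pz.
apply: le_trans (enormB _ _) _; rewrite [leRHS]splitr.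
by apply: lerD; [exact: le_trans pz hj|exact: le_trans hz hj].
Qed.

Definition base_nth (k : nat) : set lines := if choice.unpickle k is Some c then base c else set0.

Lemma base_nth_measurable k : measurable (base_nth k).
Proof. by rewrite /base_nth; case: choice.unpickle => // c; exact: base_measurable. Qed.

Lemma base_nth_separates (L L' : lines) : L <> L' ->
  exists k, base_nth k L /\ ~ base_nth k L'.
Proof.
by move=> /base_separates[c h]; exists (choice.pickle c); rewrite /base_nth choice.pickleK.
Qed.

Definition parallel (L L' : lines) : Prop := exists v : V, [/\ v != 0,
  forall p, line_set L p -> line_set L = line_through p v &
  forall p, line_set L' p -> line_set L' = line_through p v].

(** The dual basis given by the inverse of the Gram matrix; its determinant [D] vanishes only in the
    equality case of the Cauchy-Schwarz inequality. *)
Lemma not_parallel_dual (v v' : V) : v != 0 -> (forall c, v' != c *: v) ->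
  exists g g' : V, [/\ dot v g = 1, dot v' g = 0, dot v g' = 0 & dot v' g' = 1].
Proof.
move=> v0 vv'; pose D := dot v v * dot v' v' - dot v v' ^+ 2.
have dv := dot_gt0 v0.
have D0 : D != 0.
  apply: contraTneq (vv' (dot v v' / dot v v)) => D0; rewrite negbK -subr_eq0 -dot_eq0.
  rewrite !dotE (dotC v' v); apply/eqP.
  have -> : dot v' v' = dot v v' ^+ 2 / dot v v.
    apply: (mulfI (lt0r_neq0 dv)); rewrite mulrCA divff ?lt0r_neq0// mulr1.
    by apply/eqP; rewrite -subr_eq0 -/D D0.
  by field; rewrite lt0r_neq0.
exists (D^-1 *: (dot v' v' *: v - dot v v' *: v')), (D^-1 *: (dot v v *: v' - dot v v' *: v)).
split; rewrite !dotE ?(dotC v' v); first by rewrite -(mulVf D0) /D; ring.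
- by ring.
- by ring.
- by rewrite -(mulVf D0) /D; ring.
Qed.

End base.

(** * All pairs of lines are joined almost surely *)

Section almost_sure_reach.
Variables (R : realType) (n : nat) (u : R).
Local Notation V := 'rV[R]_n.+1.
Local Notation lines := (line R n).
Variables (mu Lam : {measure set lines -> \bar R}).
Context (disp : measure_display) (T : measurableType disp) (P : probability T R).
Variable omega : T -> {measure set lines -> \bar R}.
Hypothesis u0 : 0 < u.
Hypothesis hmu : is_haar mu.
Hypothesis LamE : forall A, Lam A = (u%:E * mu A)%E.
Hypothesis homega : is_poisson_process P Lam omega.
Hypothesis n2 : (2 <= n)%N.
Local Notation eta := (eta R n).
Local Notation m := n.-1.

(** Parallel lines near [a] and [b] also pass near [a + F i] and [b + F i] for a common face point
    [F i]. Each of the [O(N ^ n)] face points has probability of order [N ^ (- 2 n)], so the sum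
    tends to 0. *)
Lemma parallel_near (a b : V) : P.-negligible [set w | exists L L' : lines,
  [/\ support (omega w) L, support (omega w) L', L <> L' & parallel L L'] /\
  (hit a 1 L /\ hit b 1 L')].
Proof.
have [C C0 Cnu] := nu_upper hmu.
pose K : R := n.+1%:R * (n.+1 * 5)%:R ^+ n * (u * C) ^+ 2.
have K0 : 0 <= K by rewrite /K !mulr_ge0 ?exprn_ge0 ?mulr_ge0 ?ltW.
apply: outer_le_negligible => e e0; set X := (X in outer_le _ X _).
pose N := (Num.bound (K / e)).+1.
have NR : 0 < N%:R :> R by [].
have NK : K / N%:R ^+ n <= e.
  have KN : K / e <= N%:R.
    apply: le_trans (ltW (archi_boundP _)) _; first by rewrite divr_ge0// ltW.
    by rewrite ler_nat.
  rewrite ler_pdivrMr ?exprn_gt0// mulrC -ler_pdivrMr//; apply: le_trans KN _.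
  rewrite -[leLHS]expr1 ler_weXn2l// ?ler1n//; exact: ltnW.
pose I := ('I_n.+1 * {ffun 'I_n -> 'I_((n.+1 * 2 * N).*2.+1)})%type.
pose F (i : I) : V := @face_point R n N i.
pose B (i : I) (k : 'I_2) : set lines :=
  if k == ord0 then two_hit 2%:R a (a + F i) else two_hit 2%:R b (b + F i).
have mB i k : measurable (B i k).
  by rewrite /B; case: ifP => _; exact (@two_hit_measurable _ _ 2%:R _ _ (ler0n R 2)).
have fB i k : (Lam (B i k) < +oo)%E.
  by rewrite /B; case: ifP => _; exact: (Lam_lty hmu LamE 2).
have bound x i : fine (Lam (two_hit 2%:R x (x + F i))) <= u * C / N%:R ^+ n.
  rewrite (Lam_two_hit hmu LamE 2) -mulrA ler_wpM2l ?(ltW u0)//.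
  have nE : `|x - (x + F i)| = N%:R by rewrite opprD addrA subrr add0r normrN face_point_norm.
  rewrite ler_pdivlMr ?exprn_gt0//; have := Cnu x (x + F i); rewrite nE; apply.
  by rewrite ler1n.
pose Y (i : I) := [set w | exists Ls : 'I_2 -> lines, injective Ls /\
    forall k, support (omega w) (Ls k) /\ B i k (Ls k)].
have hY i : outer_le P (Y i) ((u * C / N%:R ^+ n) ^+ 2).
  apply: outer_le_sub (many_lines homega (mB i) (fB i) (@base_nth_measurable R n)
    (@base_nth_separates R n)) => //.
  rewrite !big_ord_recl big_ord0 mulr1 expr2; apply: ler_pM; rewrite ?fine_ge0//.
    exact: bound.
  exact: bound.
have := @outer_le_cover _ _ _ P _ (enum {: I}) _ Y _ _ (fun i _ => hY i).
move=> H; apply: outer_le_sub (H X _).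
- by [].
- rewrite big_enum/= sumr_const card_prod card_ffun !card_ord -[leLHS]mulr_natl.
  apply: le_trans NK; rewrite /K.
  have cc : (((n.+1 * 2 * N).*2.+1)%:R ^+ n : R) <= (n.+1 * 5)%:R ^+ n * N%:R ^+ n.
    rewrite -exprMn -natrM lerXn2r ?nnegrE// ler_nat.
    by have : (1 <= n.+1 * N)%N by []; move: (n.+1) (N) => x y; lia.
  have -> : n.+1%:R * (n.+1 * 5)%:R ^+ n * (u * C) ^+ 2 / N%:R ^+ n =
      n.+1%:R * ((n.+1 * 5)%:R ^+ n * N%:R ^+ n) * (u * C / N%:R ^+ n) ^+ 2.
    by field; rewrite expf_neq0// pnatr_eq0.
  rewrite natrM natrX; apply: ler_wpM2r; first exact: sqr_ge0.
  by rewrite ler_wpM2l.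
- move=> w [L [L' [[SL SL' LL' [v [v0 Lv L'v]]] [[q Lq qa] [q' L'q' q'b]]]]].
  have [t [i hi]] := face_point_direction N v0.
  have shift (M : lines) (p x : V) : line_set M p -> (forall p, line_set M p -> line_set M = line_through p v) ->
      enorm (p - x) <= 1 -> two_hit 2%:R x (x + F i) M.
    move=> Mp Mv px; split; first by exists p => //; apply: le_trans px _; rewrite ler1n.
    exists (p + t *: v); first by rewrite (Mv _ Mp); exists t.
    have -> : p + t *: v - (x + F i) = (p - x) + (t *: v - F i) by vring.
    by apply: le_trans (enormD _ _) _; move: hi; rewrite -/(F i); lra.
  exists i; first by rewrite mem_enum.
  exists (fun k : 'I_2 => if k == ord0 then L else L'); split.
    move=> k k' /=; case: ifPn => [/eqP->|k0]; case: ifPn => [/eqP->|k'0] // h.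
    - by case: LL'; rewrite h.
    apply: val_inj => /=; move: (ltn_ord k) (ltn_ord k') k0 k'0; rewrite -!val_eqE /=.
    by clear; lia.
  move=> k; rewrite /B; case: ifP => _; split => //;
    [exact: shift Lq Lv qa|exact: shift L'q' L'v q'b].
Qed.

Lemma parallel_negligible : P.-negligible [set w | exists L L' : lines,
  [/\ support (omega w) L, support (omega w) L', L <> L' & parallel L L']].
Proof.
apply: (@negligibleS _ _ _ _ (\bigcup_(i : 'rV[int]_n.+1 * 'rV[int]_n.+1)
  [set w | exists L L' : lines,
    [/\ support (omega w) L, support (omega w) L', L <> L' & parallel L L'] /\
    (hit (lat R 0 i.1) 1 L /\ hit (lat R 0 i.2) 1 L')])).
  move=> w [L [L' h]]; have [p Lp] := line_nonempty L; have [p' Lp'] := line_nonempty L'.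
  have [z hz] := lat_approx 0 p; have [z' hz'] := lat_approx 0 p'.
  rewrite invr1 in hz hz'.
  by exists (z, z') => //; exists L, L'; split => //; split; [exists p|exists p'].
by apply: negligible_countable => i; exact: parallel_near.
Qed.

(** What [unreached_pairs] asks of four points. Random lines are reached through the countably many
    quadruples of lattice points, with one negligible event for each. *)
Definition good_points (x y x' y' : V) : Prop := exists p1 p2 f1 f2 : V, [/\
  [/\ enorm p1 <= eta / (8 * n.+1%:R), enorm p2 <= eta / (8 * n.+1%:R),
      dot f1 p1 = 1 & dot f1 p2 = 0],
  dot f2 p1 = 0 /\ dot f2 p2 = 1,
  `|dot (y - x) p1 - 1| <= eta / 32 /\ `|dot (y - x) p2 - 1| <= eta / 32 &
  `|dot (y' - x') p1 - n%:R| <= eta / 32 /\ `|dot (y' - x') p2 - n%:R ^+ 2| <= eta / 32].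

(** [q1] and [q2] send the directions [v] and [v'] to [(1, 1)] and [(n, n ^+ 2)]. Dividing them by a
    large [S] makes them contract, while points at parameter distance [S] on the lines keep the
    products unchanged. *)
Lemma good_points_exist (L L' : lines) : ~ parallel L L' ->
  exists z1 z2 z3 z4 : 'rV[int]_n.+1, [/\
    good_points (lat R 0 z1) (lat R 0 z2) (lat R 0 z3) (lat R 0 z4),
    two_hit 1 (lat R 0 z1) (lat R 0 z2) L & two_hit 1 (lat R 0 z3) (lat R 0 z4) L'].
Proof.
move=> np; have eta0 := eta_gt0 R (ltnW n2).
have [v v0 Lv] := line_through_dir L; have [v' v'0 L'v'] := line_through_dir L'.
have vv' c : v' != c *: v.
  apply/eqP => v'E; apply: np; exists v'; split => // p Lp; rewrite (Lv _ Lp).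
  have c0 : c != 0 by apply: contraNneq v'0 => c0; rewrite v'E c0 scale0r.
  apply/seteqP; split => x /= [t _ <-].
    by exists (t / c) => //; rewrite v'E scalerA mulfVK.
  by exists (t * c) => //; rewrite v'E scalerA.
have [g [g' [vg v'g vg' v'g']]] := not_parallel_dual v0 vv'.
pose q1 := g + n%:R *: g'; pose q2 := g + n%:R ^+ 2 *: g'.
have nn : n%:R ^+ 2 - n%:R != 0 :> R.
  rewrite -natrX -natrB; last by rewrite expnS leq_pmulr// expn_gt0 ltnW.
  by rewrite pnatr_eq0 subn_eq0 -ltnNge -{1}[n]muln1 ltn_pmul2l// ltnW.
pose a := (n%:R ^+ 2 - n%:R : R)^-1.
(* Dual to [q1] and [q2]; [a] is the inverse of the determinant of the 2 by 2 system. *)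
pose h1 := (n%:R ^+ 2 * a) *: v - a *: v'; pose h2 := a *: v' - (n%:R * a) *: v.
have dq (w : V) : dot w q1 = dot w g + n%:R * dot w g' /\
    dot w q2 = dot w g + n%:R ^+ 2 * dot w g' by rewrite /q1 /q2 !dotE.
(* The summands [64 / eta] and [8 * n.+1 / eta] serve the rounding to lattice points and the
   smallness of [p1] and [p2]. *)
pose S : R := 1 + (enorm q1 + enorm q2) * (64 / eta + 8 * n.+1%:R / eta).
have qq0 : 0 <= enorm q1 + enorm q2 by rewrite addr_ge0 ?enorm_ge0.
have k1 : 0 <= 64 / eta by rewrite divr_ge0// ltW.
have k2 : 0 <= 8 * n.+1%:R / eta by rewrite divr_ge0 ?mulr_ge0// ltW.
have S1 : 1 <= S by rewrite /S lerDl mulr_ge0// addr_ge0.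
have S0 : 0 < S by lra.
have qS (q : V) : enorm q <= enorm q1 + enorm q2 ->
    enorm q / S <= eta / (8 * n.+1%:R) /\ 2 * enorm q / S <= eta / 32.
  move=> hq; have e0 := enorm_ge0 q.
  have hS k : 0 < k -> k / eta <= 64 / eta + 8 * n.+1%:R / eta -> enorm q / S <= eta / k.
    move=> k0 hk; rewrite ler_pdivrMr// mulrAC ler_pdivlMr//.
    rewrite -ler_pdivrMl// mulrC -mulrA; apply: (@le_trans _ _ ((enorm q1 + enorm q2) * (64 / eta + 8 * n.+1%:R / eta))).
      by apply: ler_pM => //; rewrite divr_ge0// ltW.
    by rewrite /S lerDr.
  split; first by apply: hS; [rewrite mulr_gt0|rewrite lerDr].
  have := hS 64 (ltr0n R 64); rewrite lerDl => /(_ k2) h.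
  by rewrite -mulrA; lra.
have e1 := qS q1; rewrite lerDl enorm_ge0 in e1; have {e1}[e1 d1] := e1 isT.
have e2 := qS q2; rewrite lerDr enorm_ge0 in e2; have {e2}[e2 d2] := e2 isT.
have [p Lp] := line_nonempty L; have [p' L'p'] := line_nonempty L'.
have [y1 hy1] := lat_approx 0 p; have [y2 hy2] := lat_approx 0 (p + S *: v).
have [y3 hy3] := lat_approx 0 p'; have [y4 hy4] := lat_approx 0 (p' + S *: v').
rewrite invr1 in hy1 hy2 hy3 hy4.
have near (w x y q b : V) (t : R) : enorm (b - x) <= 1 -> enorm (b + S *: w - y) <= 1 ->
    2 * enorm q / S <= eta / 32 -> dot w q = t -> `|dot (y - x) (S^-1 *: q) - t| <= eta / 32.
  move=> hx hy hq wq; apply: le_trans hq.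
  have -> : dot (y - x) (S^-1 *: q) - t = dot ((b - x) - (b + S *: w - y)) (S^-1 *: q).
    by rewrite !dotE wq; field; rewrite gt_eqF.
  apply: le_trans (dot_abs_le _ (enorm_ge0 _) (lexx _)) _.
  rewrite enormZ (ger0_norm (ltW _)) ?invr_gt0// mulrC -mulrA ler_pM ?enorm_ge0//.
    by rewrite mulr_ge0 ?enorm_ge0// invr_ge0 ltW.
  - by apply: le_trans (enormB _ _) _; lra.
  - by rewrite mulrC.
have S1' : `|S^-1| = S^-1 by rewrite ger0_norm// invr_ge0 ltW.
exists y1, y2, y3, y4; split.
- exists (S^-1 *: q1), (S^-1 *: q2), (S *: h1), (S *: h2); split.
  + split; first by rewrite enormZ S1' mulrC.
    * by rewrite enormZ S1' mulrC.
    * rewrite dotZl dotZr mulrA divff ?gt_eqF// mul1r (dq h1).1 /h1 !dotE vg v'g vg' v'g'.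
      by rewrite /a; field.
    * rewrite dotZl dotZr mulrA divff ?gt_eqF// mul1r (dq h1).2 /h1 !dotE vg v'g vg' v'g'.
      by ring.
  + split; rewrite dotZl dotZr mulrA divff ?gt_eqF// mul1r.
      by rewrite (dq h2).1 /h2 !dotE vg v'g vg' v'g'; ring.
    by rewrite (dq h2).2 /h2 !dotE vg v'g vg' v'g' /a; field.
  + split; apply: near hy1 hy2 _ _ => //.
      by rewrite (dq v).1 vg vg' mulr0 addr0.
    by rewrite (dq v).2 vg vg' mulr0 addr0.
  + split; apply: near hy3 hy4 _ _ => //.
      by rewrite (dq v').1 v'g v'g' mulr1 add0r.
    by rewrite (dq v').2 v'g v'g' mulr1 add0r.
- split; first by exists p.
  by exists (p + S *: v) => //; rewrite (Lv _ Lp); exists S.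
- split; first by exists p'.
  by exists (p' + S *: v') => //; rewrite (L'v' _ L'p'); exists S.
Qed.

Lemma all_reach_ae : P.-negligible [set w | ~ all_reach (support (omega w)) m].
Proof.
pose I := (('rV[int]_n.+1 * 'rV[int]_n.+1) * ('rV[int]_n.+1 * 'rV[int]_n.+1))%type.
pose l (z : 'rV[int]_n.+1) : V := lat R 0 z.
pose X (i : I) : set T := [set w | good_points (l i.1.1) (l i.1.2) (l i.2.1) (l i.2.2) /\
  exists L L' : lines, [/\ support (omega w) L, support (omega w) L',
    two_hit 1 (l i.1.1) (l i.1.2) L, two_hit 1 (l i.2.1) (l i.2.2) L' &
    ~ reach (support (omega w)) m L L']].
apply: (@negligibleS _ _ _ _ ((\bigcup_i X i) `|` [set w | exists L L' : lines,
  [/\ support (omega w) L, support (omega w) L', L <> L' & parallel L L']])).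
  move=> w /= /existsNP[L /existsNP[L' /not_implyP[SL /not_implyP[SL' nr]]]].
  have LL' : L <> L'.
    move=> e; apply: nr; rewrite e; apply: (@reach_le _ _ _ 0) => //; exact: touch_refl.
  have [par|np] := pselect (parallel L L'); [right|left]; first by exists L, L'.
  have [z1 [z2 [z3 [z4 [gp h1 h2]]]]] := good_points_exist np.
  by exists ((z1, z2), (z3, z4)) => //; split => //; exists L, L'.
apply: negligibleU; last exact: parallel_negligible.
apply: negligible_countable => i.
have [[p1 [p2 [f1 [f2 [[e1 e2 f11 f12] [f21 f22] [v1 v2] [v1' v2']]]]]]|no] :=
    pselect (good_points (l i.1.1) (l i.1.2) (l i.2.1) (l i.2.2)); last first.
  by apply: negligibleS (negligible_set0 P) => w [].
apply: outer_le_negligible => e e0.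
apply: outer_le_sub (unreached_pairs u0 hmu LamE homega n2 e1 e2 f11 f12 f21 f22 v1 v2 v1' v2' e0) => //.
by move=> w [].
Qed.

End almost_sure_reach.

(** * Sums over paths *)

Section path_sums.
Variables (R : realType) (V : eqType) (s : seq V) (b : V).
Variables (G : V -> V -> R) (far : V -> V -> bool) (kappa delta : R).
Hypothesis G0 : forall y z, 0 <= G y z.
Hypothesis delta0 : 0 <= delta.
Hypothesis kappa0 : 0 <= kappa.
Hypothesis row : forall y, \sum_(z <- s) G y z <= kappa.
Hypothesis col : forall z, \sum_(y <- s) G y z <= kappa.
Hypothesis far_le : forall y z, far y z -> G y z <= delta.

Fixpoint all_seqs (k : nat) : seq (seq V) :=
  if k is k'.+1 then [seq z :: t | z <- s, t <- all_seqs k'] else [:: [::]].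

Lemma all_seqsP k t : size t = k -> {subset t <= s} -> t \in all_seqs k.
Proof.
elim: k t => [|k IH] [|z t] //= [st] ts; apply: allpairs_f.
  by apply: ts; rewrite inE eqxx.
by apply: IH => // x xt; apply: ts; rewrite inE xt orbT.
Qed.

Fixpoint path_weight (y : V) (t : seq V) : R :=
  if t is z :: t' then G y z * path_weight z t' else G y b.

Fixpoint has_far (y : V) (t : seq V) : bool :=
  if t is z :: t' then far y z || has_far z t' else far y b.

Lemma path_weight_ge0 y t : 0 <= path_weight y t.
Proof. by elim: t y => [|z t IH] y //=; rewrite mulr_ge0. Qed.

(** Sums over the starting point first: each column sum costs [kappa], and the end [b] stays
    fixed. *)
Lemma sum_path_weight k : \sum_(y <- s) \sum_(t <- all_seqs k) path_weight y t <= kappa ^+ k.+1.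
Proof.
elim: k => [|k IH].
  by rewrite (eq_bigr (fun y => G y b)) ?col// => y _; rewrite big_seq1.
rewrite (eq_bigr (fun y => \sum_(z <- s) G y z * \sum_(t <- all_seqs k) path_weight z t)); last first.
  move=> y _; rewrite /= big_allpairs_dep/=; apply: eq_bigr => z _.
  by rewrite mulr_sumr.
rewrite exchange_big/=.
apply: (@le_trans _ _ (\sum_(z <- s) kappa * \sum_(t <- all_seqs k) path_weight z t)).
  apply: ler_sum => z _; rewrite -mulr_suml ler_wpM2r//.
  by apply: sumr_ge0 => t _; exact: path_weight_ge0.
by rewrite -mulr_sumr exprS ler_wpM2l.
Qed.

(* The far step contributes [delta]; the remaining steps are summed from both ends of
   the path, each intermediate point being used once. *)
Lemma sum_far_weight k y :
  \sum_(t <- all_seqs k | has_far y t) path_weight y t <= k.+1%:R * (delta * kappa ^+ k).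
Proof.
elim: k y => [|k IH] y.
  rewrite big_mkcond big_seq1/= expr0 mulr1 mul1r.
  by case: ifPn => // /far_le.
rewrite big_mkcond/= big_allpairs_dep/=.
apply: (@le_trans _ _ (\sum_(z <- s) (delta * (\sum_(t <- all_seqs k) path_weight z t)
   + G y z * (k.+1%:R * (delta * kappa ^+ k))))).
  apply: ler_sum => z _.
  apply: (@le_trans _ _ (\sum_(t <- all_seqs k) (delta * path_weight z t +
      G y z * (if has_far z t then path_weight z t else 0)))).
    apply: ler_sum => t _ /=; have pw := path_weight_ge0 z t.
    have [fyz|nf] /= := boolP (far y z).
      apply: (@le_trans _ _ (delta * path_weight z t)); first by rewrite ler_wpM2r// far_le.
      by rewrite lerDl mulr_ge0//; case: ifP.
    case: ifP => _; first by rewrite lerDr mulr_ge0.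
    by rewrite mulr0 addr0 mulr_ge0.
  rewrite big_split/= -!mulr_sumr lerD2l ler_wpM2l//.
  by rewrite -big_mkcond.
rewrite big_split/= -mulr_sumr -mulr_suml.
apply: (@le_trans _ _ (delta * kappa ^+ k.+1 + kappa * (k.+1%:R * (delta * kappa ^+ k)))).
  apply: lerD; first by rewrite ler_wpM2l// sum_path_weight.
  by rewrite ler_wpM2r// !mulr_ge0// exprn_ge0.
by rewrite -(natr1 k.+1) exprS le_eqVlt; apply/orP; left; apply/eqP; ring.
Qed.

End path_sums.

(** * From chains of lines to lattice points *)

Section few_lines.
Variables (R : realType) (n : nat).
Local Notation V := 'rV[R]_n.+1.
Local Notation lines := (line R n).

Lemma reach_path (S : set lines) k (L L' : lines) : S L' -> reach S k L L' ->
  exists p : seq lines, [/\ forall M, M \in p -> S M, size p = k.+1, last L p = L' &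
    path (fun L L' => `[< touch L L' >]) L p].
Proof.
elim: k L' => [|k IH] L' SL' /=.
  move=> LL'; exists [:: L']; split => //=; last by rewrite andbT; exact/asboolP.
  by move=> M; rewrite inE => /eqP ->.
move=> [M [SM /(IH _ SM)[p [Sp sp lp pp]] ML']]; exists (rcons p L'); split.
- by move=> N; rewrite mem_rcons inE => /orP[/eqP ->//|/Sp].
- by rewrite size_rcons sp.
- by rewrite last_rcons.
- by rewrite rcons_path pp lp; exact/asboolP.
Qed.

(** Loops are cut because [many_lines] bounds the probability of distinct lines only. *)
Lemma reach_uniq_path (S : set lines) k (L L' : lines) : S L' -> reach S k L L' ->
  exists p : seq lines, [/\ forall M, M \in p -> S M, (size p <= k.+1)%N, last L p = L',
    path (fun L L' => `[< touch L L' >]) L p & uniq (L :: p)].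
Proof.
move=> SL' /(reach_path SL')[p [Sp sp lp pp]].
case/shortenP: pp lp => p' pp' up' p'p lp; exists p'; split => //.
  by move=> M /p'p /Sp.
by rewrite -sp; apply: uniq_leq_size p'p; case/andP: up'.
Qed.

Definition lattice_seq (t : seq V) : Prop := forall y, y \in t -> exists z, y = lat R 0 z.

(** Contact points of consecutive cylinders are rounded to the lattice at a cost of 1, whence the
    radius 2. *)
Lemma path_points (L : lines) (p : seq lines) (y b : V) :
  path (fun L L' => `[< touch L L' >]) L p -> hit y 2 L -> hit b 2 (last L p) ->
  exists t : seq V, [/\ size t = size p, lattice_seq t &
    forall i, (i <= size p)%N ->
      two_hit 2 (nth 0 (y :: rcons t b) i) (nth 0 (rcons t b) i) (nth L (L :: p) i)].
Proof.
elim: p L y => [|M p IH] L y /=.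
  by move=> _ yL bL; exists [::]; split => // -[|i].
move=> /andP[/asboolP[z [zL zM]] pp] yL bL.
have [a ha] := lat_approx 0 z; rewrite invr1 in ha.
have near N : hit z 1 N -> hit (lat R 0 a) 2 N.
  move=> [x Nx xz]; exists x => //; have -> : x - lat R 0 a = (x - z) + (z - lat R 0 a) by vring.
  by apply: le_trans (enormD _ _) _; lra.
have [t [st lt ht]] := IH M (lat R 0 a) pp (near _ zM) bL.
exists (lat R 0 a :: t); split => /=; first by rewrite st.
  by move=> x; rewrite inE => /orP[/eqP ->|/lt//]; exists a.
case=> [|i] ip /=; first by split => //; exact: near.
by have := ht i ip; rewrite (set_nth_default L M)// ltnS.
Qed.

Definition box (M : nat) : seq V :=
  [seq gridv n.+1%:R^-1 f | f : {ffun 'I_n.+1 -> 'I_((n.+1 * M).*2.+1)}].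

Lemma lat_in_box (M : nat) z : enorm (lat R 0 z) <= M%:R -> lat R 0 z \in box M.
Proof.
move=> zM; pose K := (n.+1 * M)%N.
have zi i : (`|z ord0 i| <= K)%N.
  have : `|lat R 0 z ord0 i| <= M%:R by apply: le_trans (coord_le_enorm _ _) zM.
  rewrite mxE muln1 normrM normfV (ger0_norm (ler0n R n.+1)) ler_pdivrMr// -(natrM R M) mulnC -/K.
  by rewrite -intr_norm pmulrn ler_int -abszE lez_nat.
apply/mapP; exists [ffun i => inord (absz (z ord0 i + K%:Z)) : 'I_(K.*2.+1)].
  by rewrite mem_enum.
apply/rowP => i; rewrite !mxE ffunE muln1 mulrC; congr (_ * _).
rewrite inordK; last by have := zi i; rewrite -/K; clear; lia.
have z0 : 0 <= z ord0 i + K%:Z by have := zi i; clear; lia.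
by rewrite natr_absz ger0_norm// intrD addrK.
Qed.

(** Two such points with the same steepest coordinate [j] differ by at most 4 + 4 in every
    coordinate; [n.+1] is the inverse of the mesh. *)
Lemma line_box_count (M : nat) (L : lines) :
  (#|[pred f : {ffun 'I_n.+1 -> 'I_((n.+1 * M).*2.+1)} |
     `[< hit (gridv n.+1%:R^-1 f) 2 L >]]| <=
   (n.+1 * M).*2.+1 * (Num.bound (8 * n.+1%:R : R)).*2.+1 ^ n.+1)%N.
Proof.
have [v v0 Lv] := line_through_dir L; have [j vj] := norm_coordP v (ltn0Sn n).
apply: (@card_lattice_tube _ _ _ j) => f f' /asboolP[x Lx xf] /asboolP[x' Lx' x'f'] fj i.
have n0 : 0 < n.+1%:R :> R by [].
move: Lx'; rewrite (Lv _ Lx) => -[t _ x'E].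
set z := gridv _ f in xf; set z' := gridv _ f' in x'f'.
apply: (@leq_real_bound R); first by rewrite mulr_ge0.
have zE l : z ord0 l - z' ord0 l = n.+1%:R^-1 * ((f l)%:R - (f' l)%:R).
  by rewrite !mxE; ring.
have -> : (f i)%:R - (f' i)%:R = n.+1%:R * (z ord0 i - z' ord0 i) :> R.
  by rewrite zE mulVKf// gt_eqF.
rewrite normrM ger0_norm// mulrC ler_wpM2r//.
have dE l : z ord0 l - z' ord0 l = - t * v ord0 l - (x - z) ord0 l + (x' - z') ord0 l.
  by rewrite -x'E !mxE; ring.
have ex l : `|(x - z) ord0 l| <= 2 by apply: le_trans (coord_le_enorm _ _) xf.
have ex' l : `|(x' - z') ord0 l| <= 2 by apply: le_trans (coord_le_enorm _ _) x'f'.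
have tv l : `|t * v ord0 l| <= 4.
  apply: (@le_trans _ _ `|t * v ord0 j|).
    by rewrite !normrM ler_wpM2l// -vj coord_le_norm.
  have -> : t * v ord0 j = (x' - z') ord0 j - (x - z) ord0 j.
    have := dE j; rewrite zE fj subrr mulr0 => /eqP; rewrite eq_sym -addrA mulNr.
    by rewrite addrC subr_eq0 addrC => /eqP <-.
  by apply: le_trans (ler_normB _ _) _; have := ex j; have := ex' j; lra.
rewrite dE; apply: le_trans (ler_normD _ _) _; apply: le_trans (lerD (ler_normB _ _) (ex' i)) _.
by rewrite mulNr normrN; have := tv i; have := ex i; lra.
Qed.

End few_lines.

Lemma outer_le_exists (d : measure_display) (T : measurableType d) (R : realType)
    (P : probability T R) (I : eqType) (s : seq I) (Y : I -> set T) (b : I -> R) :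
  (forall i, i \in s -> outer_le P (Y i) (b i)) ->
  outer_le P [set w | exists2 i, i \in s & Y i w] (\sum_(i <- s) b i).
Proof. by move=> h; apply: outer_le_cover h. Qed.

(** * Distant balls are not joined by few lines *)

Section far_lines.
Variables (R : realType) (n : nat) (u : R).
Local Notation V := 'rV[R]_n.+1.
Local Notation lines := (line R n).
Variables (mu Lam : {measure set lines -> \bar R}).
Context (disp : measure_display) (T : measurableType disp) (P : probability T R).
Variable omega : T -> {measure set lines -> \bar R}.
Hypothesis u0 : 0 < u.
Hypothesis hmu : is_haar mu.
Hypothesis LamE : forall A, Lam A = (u%:E * mu A)%E.
Hypothesis homega : is_poisson_process P Lam omega.
Hypothesis n2 : (2 <= n)%N.

Let G (y z : V) : R := fine (Lam (two_hit 2%:R y z)).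
Let GE y z : Lam (two_hit 2%:R y z) = (G y z)%:E.
Proof. by rewrite fineK// ge0_fin_numE// (Lam_lty hmu LamE 2). Qed.
Let G0 y z : 0 <= G y z. Proof. exact: fine_ge0. Qed.
Let GC y z : G y z = G z y. Proof. by rewrite /G /two_hit setIC. Qed.
Let mtwo (y z : V) : measurable (two_hit 2%:R y z : set lines).
Proof. exact (@two_hit_measurable _ _ 2%:R y z (ler0n R 2)). Qed.

Let hit2 : R := fine (Lam (hit (0 : V) 2%:R)).
Let hit2E y : Lam (hit y 2%:R) = hit2%:E.
Proof.
rewrite /hit2 !LamE (hit_translate hmu y 0)// fineK// ge0_fin_numE.
  by apply: lte_mul_pinfty; rewrite ?lee_fin ?(ltW u0)//; exact: hit_lty.
by rewrite mule_ge0// lee_fin ltW.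
Qed.

(** Double counting instead of summing the kernel: each line through the ball at [y] hits [O(M)] of
    the balls of the box. *)
Lemma box_row_sum : exists2 c : R, 1 <= c & forall (M : nat) (y : V), (1 <= M)%N ->
  \sum_(z <- box R n M) G y z <= c * M%:R.
Proof.
pose D := ((Num.bound (8 * n.+1%:R : R)).*2.+1 ^ n.+1)%N.
have h0 : 0 <= hit2 by exact: fine_ge0.
exists (1 + (3 * n.+1 * D)%:R * hit2); first by rewrite lerDl mulr_ge0.
move=> M y M1; rewrite big_image/=.
have h : (\sum_(f : {ffun 'I_n.+1 -> 'I_((n.+1 * M).*2.+1)})
    Lam (two_hit 2%:R y (gridv n.+1%:R^-1 f)) <= ((n.+1 * M).*2.+1 * D)%N%:R%:E * Lam (hit y 2%:R))%E.
  apply: (@measure_multiplicity _ _ _ Lam _ (hit y 2%:R) (fun f => two_hit 2%:R y (gridv n.+1%:R^-1 f))).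
  - exact (@hit_measurable _ _ y 2%:R (ler0n R 2)).
  - by move=> f.
  - by move=> f L [].
  - move=> L _; apply: leq_trans (line_box_count M L); apply: subset_leq_card.
    by apply/fintype.subsetP => f; rewrite !inE => /set_mem[_ h]; exact/asboolP.
move: h; rewrite (eq_bigr (fun f => (G y (gridv n.+1%:R^-1 f))%:E)); last first.
  by move=> f _; exact: GE.
rewrite sumEFin hit2E -EFinM lee_fin => h; apply: le_trans h _.
rewrite mulrDl mul1r mulrAC; apply: ler_wpDl => //; apply: ler_wpM2r => //.
rewrite -natrM ler_nat; move: M1 D; clear; move=> M1 D.
have : ((n.+1 * M).*2.+1 <= 3 * n.+1 * M)%N by nia.
by move=> /(leq_mul)/(_ (leqnn D)); nia.
Qed.

Lemma far_small : exists2 c : R, 0 < c & forall (r : R) (y z : V), n.+1%:R <= r ->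
  r <= enorm (y - z) -> G y z <= c / r ^+ n.
Proof.
have [C C0 Cnu] := nu_upper hmu.
exists (u * C * n.+1%:R ^+ n); first by rewrite !mulr_gt0// exprn_gt0.
move=> r y z nr ryz; rewrite /G (Lam_two_hit hmu LamE 2).
have n0 : 0 < n.+1%:R :> R by [].
have r0 : 0 < r by apply: lt_le_trans nr.
have yz : r / n.+1%:R <= `|y - z|.
  rewrite ler_pdivrMr// mulrC; apply: le_trans ryz _; exact: enorm_le_norm.
have yz1 : 1 <= `|y - z| by apply: le_trans yz; rewrite ler_pdivlMr// mul1r.
rewrite ler_pdivlMr ?exprn_gt0// -!mulrA ler_wpM2l ?(ltW u0)//.
rewrite -ler_pdivrMr ?exprn_gt0// -mulrA -expr_div_n.
apply: le_trans (Cnu y z yz1); apply: ler_wpM2l; first exact: fine_ge0.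
by rewrite lerXn2r ?nnegrE// divr_ge0 ?ltW.
Qed.

Definition chain_through (y b : V) (t : seq V) : set T :=
  [set w | exists Ls : 'I_(size t).+1 -> lines, injective Ls /\
    forall i, support (omega w) (Ls i) /\
      two_hit 2%:R (nth 0 (y :: rcons t b) i) (nth 0 (rcons t b) i) (Ls i)].

Lemma chain_through_prob (y b : V) (t : seq V) :
  outer_le P (chain_through y b t) (path_weight b G y t).
Proof.
pose A (i : 'I_(size t).+1) : set lines :=
  two_hit 2%:R (nth 0 (y :: rcons t b) i) (nth 0 (rcons t b) i).
have mA i : measurable (A i) by exact: mtwo.
have fA i : (Lam (A i) < +oo)%E by exact: (Lam_lty hmu LamE 2).
apply: outer_le_sub (many_lines homega mA fA (@base_nth_measurable R n)
  (@base_nth_separates R n)) => //.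
rewrite le_eqVlt; apply/orP; left; apply/eqP; rewrite /A {mA fA A}.
elim: t y => [|z t IH] y /=; first by rewrite big_ord_recl big_ord0 mulr1.
by rewrite big_ord_recl/=; congr (_ * _); rewrite -IH; apply: eq_bigr.
Qed.

Lemma near_path (b : V) (rho : R) (y : V) (t : seq V) : 0 <= rho ->
  ~~ has_far b (fun x z => rho <= enorm (x - z)) y t ->
  forall z, z \in rcons t b -> enorm (z - y) <= (size t).+1%:R * rho.
Proof.
move=> r0; elim: t y => [|x t IH] y /=.
  by rewrite -ltNge mul1r => h z; rewrite inE => /eqP ->; rewrite enorm_distC ltW.
rewrite negb_or -ltNge => /andP[yx /IH h] z; rewrite inE => /orP[/eqP ->|/h zx].
  by rewrite enorm_distC; apply: le_trans (ltW yx) _; rewrite ler_peMl// ler1n.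
have -> : z - y = (z - x) - (y - x) by vring.
by apply: le_trans (enormB _ _) _; rewrite -(natr1 (size t).+1) mulrDl mul1r lerD// ltW.
Qed.

(** For the least dyadic radius [M] containing the chain, some point has norm at least [M / 2]. If
    all the steps, at most [n], were shorter than [M / (4 n)], all points would lie within [M / 4]
    of [y]; applied to [b] this gives [enorm y < M / 4], so all norms would be below [M / 2]. *)
Lemma dyadic_scale (M0 : nat) (y b : V) (t : seq V) : (1 <= M0)%N ->
  M0%:R <= enorm b -> 2 * enorm y < enorm b -> ((size t).+1 <= n)%N ->
  exists j, let M := (M0 * 2 ^ j)%N in
    (forall z, z \in t -> enorm z <= M%:R) /\
    has_far b (fun x z => M%:R / (4 * n%:R) <= enorm (x - z)) y t.
Proof.
move=> M1 M0b yb tn; pose Q j := all (fun z => enorm z <= (M0 * 2 ^ j)%N%:R) (rcons t b).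
have exQ : exists j, Q j.
  have [K hK] : exists K, forall z, z \in rcons t b -> (Num.bound (enorm z) <= K)%N.
    elim: (rcons t b) => [|x l [K hK]]; first by exists 0%N.
    exists (maxn (Num.bound (enorm x)) K) => z; rewrite inE.
    by move=> /orP[/eqP ->|/hK h]; rewrite leq_max ?leqnn ?h ?orbT.
  exists K; apply/allP => z zt.
  apply: le_trans (ltW (archi_boundP (enorm_ge0 z))) _; rewrite ler_nat.
  apply: leq_trans (hK z zt) _; apply: leq_trans (ltnW (ltn_expl _ (ltnSn 1))) _.
  exact: leq_pmull.
case: (ex_minnP exQ) => j Qj jmin; exists j => /=; split.
  by move=> z zt; apply: (allP Qj); rewrite mem_rcons inE zt orbT.
set M := (M0 * 2 ^ j)%N.
have n0 : 0 < n%:R :> R by rewrite ltr0n ltnW.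
have [z zt Mz] : exists2 z, z \in rcons t b & M%:R <= 2 * enorm z.
  case: j Qj jmin @M => [|j] Qj jmin M.
    exists b; first by rewrite mem_rcons inE eqxx.
    by rewrite /M expn0 muln1; have := enorm_ge0 b; lra.
  have : ~~ Q j by apply/negP => /jmin; rewrite ltnn.
  rewrite -has_predC => /hasP[z zt /=]; rewrite -ltNge => h; exists z => //.
  by rewrite /M expnS mulnCA natrM ler_wpM2l// ltW.
apply: contraT => /near_path H.
have {}H z' : z' \in rcons t b -> enorm (z' - y) <= M%:R / 4.
  move=> z't; apply: le_trans (H _ _ z't) _; first by rewrite divr_ge0// mulr_ge0.
  have -> : (size t).+1%:R * (M%:R / (4 * n%:R)) = M%:R / 4 * ((size t).+1%:R / n%:R) :> R.
    by field; rewrite gt_eqF.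
  by rewrite ler_piMr ?divr_ge0// ler_pdivrMr// mul1r ler_nat.
have E z' : enorm z' <= enorm (z' - y) + enorm y.
  by rewrite -{1}(subrK y z'); exact: enormD.
have h1 := E z; have h2 := H _ zt.
have bt : b \in rcons t b by rewrite mem_rcons inE eqxx.
by have h3 := E b; have h4 := H _ bt; lra.
Qed.

(** The chain has at most [n] lines, hence at most [n - 1] intermediate points. At dyadic radius [M]
    the far step costs [O(M ^ (- n))] and each intermediate point gives a factor [O(M)], so the
    total is [O(1 / M)], summable over the radii. *)
Lemma reach_far_prob : exists2 c : R, 0 <= c & forall (M0 : nat) (a b : V),
  (4 * n * n.+1 <= M0)%N -> M0%:R <= enorm b -> 2 * enorm a < enorm b ->
  outer_le P [set w | exists L L' : lines, [/\ support (omega w) L, support (omega w) L',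
    hit a 1 L, hit b 1 L' & reach (support (omega w)) n.-2 L L']] (c / M0%:R).
Proof.
have [c1 c1_1 hrow] := box_row_sum; have [c2 c2_0 hfar] := far_small.
have n0 : 0 < n%:R :> R by rewrite ltr0n ltnW.
pose c3 : R := n%:R * n%:R * (c2 * (4 * n%:R) ^+ n) * c1 ^+ n.
have c3_0 : 0 <= c3.
  by rewrite /c3 !mulr_ge0 ?exprn_ge0 ?(ltW c2_0) ?mulr_ge0//; lra.
exists (2 * c3) => [|M0 a b M0n M0b ab]; first by rewrite mulr_ge0.
have M0_1 : (1 <= M0)%N by apply: leq_trans M0n; rewrite !muln_gt0/= ltnW.
pose M j := (M0 * 2 ^ j)%N.
have Mn j : (4 * n * n.+1 <= M j)%N by apply: leq_trans M0n _; rewrite leq_pmulr// expn_gt0.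
have M_1 j : (1 <= M j)%N by apply: leq_trans M0_1 _; rewrite leq_pmulr// expn_gt0.
pose far j (x z : V) : bool := (M j)%:R / (4 * n%:R) <= enorm (x - z).
pose X j : set T := [set w | exists2 k, k \in iota 0 n & exists2 t,
  t \in [seq t <- all_seqs (box R n (M j)) k | has_far b (far j) a t] & chain_through a b t w].
have hX j : outer_le P (X j) (c3 / M0%:R / 2 ^+ j).
  have MR : 1 <= (M j)%:R :> R by rewrite ler1n.
  have MR0 : 0 < (M j)%:R :> R by lra.
  have rho : n.+1%:R <= (M j)%:R / (4 * n%:R) :> R.
    rewrite ler_pdivlMr ?mulr_gt0// -(natrM R 4) -natrM ler_nat mulnC; exact: Mn.
  pose delta : R := c2 / ((M j)%:R / (4 * n%:R)) ^+ n.
  have delta0 : 0 <= delta.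
    by rewrite divr_ge0 ?(ltW c2_0)// exprn_ge0// divr_ge0// mulr_ge0.
  have hX' k : k \in iota 0 n -> outer_le P [set w | exists2 t,
      t \in [seq t <- all_seqs (box R n (M j)) k | has_far b (far j) a t] & chain_through a b t w]
      (k.+1%:R * (delta * (c1 * (M j)%:R) ^+ k)).
    move=> _; set ts := [seq t <- _ | _].
    apply: outer_le_sub (outer_le_exists (fun t (_ : t \in ts) => chain_through_prob a b t)) => //.
    rewrite big_filter; apply: sum_far_weight => //.
    - by rewrite mulr_ge0// (le_trans _ c1_1).
    - by move=> y; exact: hrow.
    - by move=> z; under eq_bigr do rewrite GC; exact: hrow.
    - by move=> y z /hfar; apply.
  apply: outer_le_sub (outer_le_exists hX') => //.
  apply: (@le_trans _ _ (\sum_(k <- iota 0 n) (c3 / n%:R / (M j)%:R))).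
    rewrite big_seq [leRHS]big_seq; apply: ler_sum => k; rewrite mem_iota => /andP[_ kn].
    have -> : c3 / n%:R / (M j)%:R = n%:R * (delta * (c1 ^+ n * (M j)%:R ^+ n.-1)).
      have qn : (M j)%:R ^+ n = (M j)%:R * (M j)%:R ^+ n.-1 :> R.
        by rewrite -exprS prednK// ltnW.
      have n_neq0 : n%:R != 0 :> R by rewrite gt_eqF.
      have M_neq0 : (M j)%:R != 0 :> R by rewrite gt_eqF.
      rewrite /c3 /delta expr_div_n qn; field.
      by rewrite M_neq0 n_neq0 !expf_neq0// mulf_neq0// pnatr_eq0.
    apply: ler_pM => //; first by rewrite mulr_ge0// exprn_ge0// mulr_ge0//; lra.
      by rewrite ler_nat.
    rewrite ler_wpM2l// exprMn; apply: ler_pM; rewrite ?exprn_ge0//; first lra.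
      by rewrite ler_weXn2l//; exact: ltnW.
    by rewrite ler_weXn2l// -ltnS prednK// ltnW.
  rewrite big_const_seq count_predT size_iota iter_addr_0 -[leLHS]mulr_natl.
  have n_neq0 : n%:R != 0 :> R by rewrite gt_eqF.
  have -> : n%:R * (c3 / n%:R / (M j)%:R) = c3 / (M j)%:R by field; rewrite n_neq0 gt_eqF.
  by rewrite /M natrM natrX invfM mulrA.
have := outer_le_geometric (divr_ge0 c3_0 (ler0n R M0)) hX.
rewrite mulrA; apply: outer_le_sub => // w [L [L' [SL SL' aL bL' rLL']]].
have [p [Sp sp lp pp up]] := reach_uniq_path SL' rLL'.
have aL2 : hit a 2 L by apply: hit_le aL; lra.
have bL2 : hit b 2 (last L p) by rewrite lp; apply: hit_le bL'; lra.
have [t [st lt ht]] := path_points pp aL2 bL2.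
have tn : ((size t).+1 <= n)%N by rewrite st; move: sp n2; clear; lia.
have [j [jM jfar]] := dyadic_scale M0_1 M0b ab tn.
exists j => //; exists (size t); first by rewrite mem_iota.
exists t; first rewrite mem_filter jfar/=.
  apply: all_seqsP => // z zt; have [z' zE] := lt _ zt.
  by rewrite zE; apply: lat_in_box; rewrite -zE; exact: jM.
exists (fun i => nth L (L :: p) i); split.
  move=> i i' /eqP; rewrite nth_uniq//; first by move=> /eqP/val_inj.
    by rewrite /= -st.
  by rewrite /= -st.
move=> i; split; last by apply: ht; rewrite -st -ltnS.
have : nth L (L :: p) i \in L :: p by apply: mem_nth; rewrite /= -st.
by rewrite inE => /orP[/eqP ->|/Sp].
Qed.

Let H (y : V) : set lines := hit y 1.
Let mH y : measurable (H y). Proof. exact (@hit_measurable _ _ y 1 ler01). Qed.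
Let lam : R := fine (Lam (H 0)).
Let LamH y : Lam (H y) = lam%:E.
Proof.
rewrite /lam /H !LamE (hit_translate hmu y 0)// fineK// ge0_fin_numE.
  by apply: lte_mul_pinfty; rewrite ?lee_fin ?(ltW u0)//; exact: (hit_lty hmu 0 1).
by rewrite mule_ge0// lee_fin ltW.
Qed.
Let lam0 : 0 < lam.
Proof.
rewrite -lte_fin -(LamH 0) LamE mule_gt0 ?lte_fin//.
by have /andP[] := hit_unit hmu (0 : V).
Qed.

Definition axis_point (s : R) : V := s *: delta_mx ord0 ord0.

Lemma enorm_axis_point s : enorm (axis_point s) = `|s|.
Proof.
rewrite /axis_point enormZ -[RHS]mulr1; congr (_ * _).
rewrite /enorm big_ord_recl big1 ?addr0 => [|i _]; rewrite !mxE ?eqxx ?expr1n ?sqrtr1//.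
by rewrite expr0n.
Qed.

Lemma axis_pointB s t : axis_point s - axis_point t = axis_point (s - t).
Proof. by rewrite /axis_point scalerBl. Qed.

Section spaced_points.
Variables (pt : nat -> V).

Fixpoint hits (J : nat) : set lines := if J is j.+1 then hits j `|` H (pt j) else set0.

Lemma hitsP J L : hits J L <-> exists2 j, (j < J)%N & hit (pt j) 1 L.
Proof.
elim: J => [|J IH] /=; first by split => // -[].
split=> [[/IH[j jJ h]|h]|[j]].
- by exists j => //; exact: ltnW.
- by exists J.
- by rewrite ltnS leq_eqVlt => /orP[/eqP -> h|jJ h]; [right|left; apply/IH; exists j].
Qed.

Lemma hits_measurable J : measurable (hits J).
Proof. by elim: J => [|J IH] //=; exact: measurableU. Qed.

Lemma hits_lty J : (Lam (hits J) < +oo)%E.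
Proof.
elim: J => [|J IH] /=; first by rewrite measure0.
apply: le_lt_trans (measureU2 _ (hits_measurable J) (mH _)) _.
have hJ : (Lam (H (pt J)) < +oo)%E by rewrite LamH ltry.
exact: lte_add_pinfty.
Qed.

Lemma hits_measure_ge (K J : nat) : (J <= K)%N -> (forall i j : nat, (i < j < K)%N ->
    K%:R * G (pt i) (pt j) <= lam / 2) ->
  J%:R * (lam / 2) <= fine (Lam (hits J)).
Proof.
move=> JK h; elim: J JK => [|J IH] JK; first by rewrite mul0r fine_ge0.
have mW := hits_measurable J; have mD : measurable (H (pt J) `\` hits J) by exact: measurableD.
have hI : (Lam (H (pt J) `&` hits J) <= (lam / 2)%:E)%E.
  have hc := @measure_cover _ _ _ Lam _ (iota 0 J) (H (pt J) `&` hits J)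
    (fun j => two_hit 2%:R (pt j) (pt J)).
  apply: le_trans (hc _ _ _) _.
  - exact: measurableI.
  - by move=> j.
  - move=> L [hJ /hitsP[j jJ hj]]; exists j; first by rewrite mem_iota.
    by split; [apply: hit_le hj|apply: hit_le hJ]; rewrite ler1n.
  rewrite (eq_bigr (fun j => (G (pt j) (pt J))%:E)); last by move=> j _; exact: GE.
  rewrite sumEFin lee_fin.
  have K0 : 0 < K%:R :> R by rewrite ltr0n; apply: leq_trans JK.
  apply: (@le_trans _ _ (\sum_(j <- iota 0 J) (lam / 2 / K%:R))).
    rewrite big_seq [leRHS]big_seq; apply: ler_sum => j; rewrite mem_iota => /andP[_ jJ].
    by rewrite ler_pdivlMr// mulrC; apply: h; rewrite jJ.
  rewrite big_const_seq count_predT size_iota iter_addr_0 -[leLHS]mulr_natl mulrCA.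
  rewrite ler_piMr//; first by rewrite divr_ge0// ltW.
  by rewrite ler_pdivrMr// mul1r ler_nat ltnW.
have E : Lam (hits J.+1) = (Lam (hits J) + Lam (H (pt J) `\` hits J))%E.
  have dis : hits J `&` (H (pt J) `\` hits J) = set0 by rewrite -subset0 => L [? []].
  rewrite -(measureU Lam mW mD dis); congr (Lam _); apply/seteqP; split => L /=.
    by move=> [|hL]; [left|have [|nh] := pselect (hits J L); [left|right]].
  by move=> [|[]]; [left|right].
have h2 : (lam%:E <= (lam / 2)%:E + Lam (H (pt J) `\` hits J))%E.
  rewrite -(LamH (pt J)) -[X in (Lam X <= _)%E](setUIDK (H (pt J)) (hits J)).
  apply: le_trans (measureU2 _ _ mD) _; first exact: measurableI.
  by apply: leeD.
have fD : (Lam (H (pt J) `\` hits J) < +oo)%E.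
  apply: (@le_lt_trans _ _ (Lam (H (pt J)))); last by rewrite LamH ltry.
  by apply: measure_mono => // L [].
have fW := hits_lty J.
move: h2 E; rewrite -(@fineK _ (Lam (H (pt J) `\` hits J))) ?ge0_fin_numE//.
rewrite -(@fineK _ (Lam (hits J))) ?ge0_fin_numE// -EFinD lee_fin => h2 ->.
rewrite -EFinD /=; have := IH (ltnW JK); rewrite -(natr1 J) mulrDl mul1r; lra.
Qed.

(** The measure [x] of [hits pt K] is at least [K * lam / 2 >= e^-1], and [expR (- x) <= x^-1]. *)
Lemma hits_void (K : nat) (e : R) : 0 < e -> 2 / (lam * e) <= K%:R ->
  (forall i j : nat, (i < j < K)%N -> K%:R * G (pt i) (pt j) <= lam / 2) ->
  outer_le P (~` occ omega (hits K)) e.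
Proof.
move=> e0 hK h; exists (~` occ omega (hits K)); split => //.
  by apply: measurableC; apply: (occ_measurable homega); exact: hits_measurable.
rewrite (void_prob homega (hits_measurable K) (hits_lty K)) lee_fin.
have := hits_measure_ge (leqnn K) h; set x := fine _ => hx.
have e1 : e^-1 <= x.
  apply: le_trans hx; rewrite -ler_pdivrMr ?divr_gt0//.
  by apply: le_trans hK; rewrite le_eqVlt; apply/orP; left; apply/eqP; field; rewrite !gt_eqF.
rewrite expRN -[leRHS]invrK lef_pV2 ?posrE ?expR_gt0 ?invr_gt0//.
by apply: le_trans e1 (le_trans _ (expR_ge1Dx x)); rewrite lerDr.
Qed.

End spaced_points.

Lemma spaced_axis (K : nat) : exists D : R, 0 <= D /\ forall (s : R) (i j : nat), (i < j)%N ->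
  K%:R * G (axis_point (s + i%:R * D)) (axis_point (s + j%:R * D)) <= lam / 2.
Proof.
have [c2 c2_0 hfar] := far_small.
pose D := n.+1%:R + 2 * K%:R * c2 / lam.
have q0 : 0 <= 2 * K%:R * c2 / lam by rewrite divr_ge0 ?(ltW lam0)// !mulr_ge0// ltW.
have D1 : 1 <= D by rewrite /D ler_wpDr// ler1n.
have nD : n.+1%:R <= D by rewrite /D lerDl.
exists D; split => [|s i j ij]; first by lra.
have dist : D <= enorm (axis_point (s + i%:R * D) - axis_point (s + j%:R * D)).
  rewrite axis_pointB enorm_axis_point.
  have -> : s + i%:R * D - (s + j%:R * D) = - ((j%:R - i%:R) * D) by ring.
  rewrite normrN normrM [X in _ <= _ * X]ger0_norm; last by lra.
  rewrite ler_peMl//; first by lra.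
  by rewrite -natrB ?(ltnW ij)// normr_nat ler1n subn_gt0.
apply: le_trans (ler_wpM2l (ler0n R K) (hfar _ _ _ nD dist)) _.
have Dn : D <= D ^+ n by rewrite -[leLHS]expr1 ler_weXn2l// ltnW.
rewrite mulrA ler_pdivrMr; last by apply: lt_le_trans Dn; lra.
apply: (@le_trans _ _ (lam / 2 * D)); last by rewrite ler_wpM2l// divr_ge0// ltW.
have l2 : 0 <= lam / 2 * n.+1%:R by rewrite mulr_ge0// divr_ge0// ltW.
have E : lam / 2 * (2 * K%:R * c2 / lam) = K%:R * c2 by field; rewrite gt_eqF.
by rewrite /D mulrDr E lerDr.
Qed.

Lemma all_reach_outer (e : R) : 0 < e ->
  outer_le P [set w | all_reach (support (omega w)) n.-2] e.
Proof.
move=> e0; have [c c0 hfar] := reach_far_prob.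
have e4 : 0 < e / 4 by rewrite divr_gt0.
pose K := Num.bound (2 / (lam * (e / 4))).
have hK : 2 / (lam * (e / 4)) <= K%:R.
  by rewrite ltW// archi_boundP// divr_ge0// mulr_ge0// ltW.
have [D [D0 hD]] := spaced_axis K.
pose M0 := (4 * n * n.+1 + Num.bound (K%:R ^+ 2 * c / (e / 4)))%N.
have hM0 : K%:R ^+ 2 * c / (e / 4) <= M0%:R.
  have q0 : 0 <= K%:R ^+ 2 * c / (e / 4) by rewrite divr_ge0 ?(ltW e4)// mulr_ge0// exprn_ge0.
  by apply: le_trans (ltW (archi_boundP q0)) _; rewrite ler_nat leq_addl.
pose B := K%:R * D; have B0 : 0 <= B by rewrite mulr_ge0.
(* The far group starts beyond [M0] and beyond twice the extent [B] of the near group, as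
   [reach_far_prob] requires. *)
pose s : R := M0%:R + 2 * B + 1.
pose pa (i : nat) := axis_point (0 + i%:R * D).
pose pb (i : nat) := axis_point (s + i%:R * D).
have va := @hits_void pa K _ e4 hK (fun i j ij => hD 0 i j (andP ij).1).
have vb := @hits_void pb K _ e4 hK (fun i j ij => hD s i j (andP ij).1).
pose Y (ij : nat * nat) := [set w | exists L L' : lines, [/\ support (omega w) L,
  support (omega w) L', hit (pa ij.1) 1 L, hit (pb ij.2) 1 L' &
  reach (support (omega w)) n.-2 L L']].
pose ijs := [seq (i, j) | i <- iota 0 K, j <- iota 0 K].
have hY ij : ij \in ijs -> outer_le P (Y ij) (c / M0%:R).
  case/allpairsP => -[i j] [iK jK ->].
  have {}iK : (i < K)%N by move: iK; rewrite mem_iota.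
  change (outer_le P (Y (i, j)) (c / M0%:R)); apply: hfar => /=.
  - exact: leq_addr.
  - rewrite enorm_axis_point ger0_norm; first by rewrite /s; have := mulr_ge0 (ler0n R j) D0; lra.
    by rewrite addr_ge0 ?mulr_ge0// /s !addr_ge0// mulr_ge0.
  - rewrite !enorm_axis_point add0r ger0_norm ?mulr_ge0//.
    rewrite ger0_norm; last by rewrite addr_ge0 ?mulr_ge0// /s !addr_ge0// mulr_ge0.
    have : i%:R * D <= B.
      by rewrite ler_wpM2r// ler_nat ltnW.
    by rewrite /s; have := mulr_ge0 (ler0n R j) D0; have := ler0n R M0; lra.
have hall := outer_le_exists hY.
pose Z (k : nat) : set T := if k == 0%N then ~` occ omega (hits pa K) else
  if k == 1%N then ~` occ omega (hits pb K) else [set w | exists2 i, i \in ijs & Y i w].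
pose z (k : nat) : R := if k == 0%N then e / 4 else if k == 1%N then e / 4 else
  \sum_(i <- ijs) (c / M0%:R).
have hZ k : k \in iota 0 3 -> outer_le P (Z k) (z k).
  by case: k => [|[|k]] _ //.
apply: outer_le_sub (outer_le_exists hZ).
  move=> w hw.
  have [oa|/contrapT noa] := pselect (~ occ omega (hits pa K) w); first by exists 0%N.
  have [ob|/contrapT nob] := pselect (~ occ omega (hits pb K) w); first by exists 1%N.
  exists 2%N => //; move: noa nob.
  move=> /(occP homega _ (hits_measurable _ _))[L SL /hitsP[i iK iL]].
  move=> /(occP homega _ (hits_measurable _ _))[L' SL' /hitsP[j jK jL']].
  exists (i, j); first by apply/allpairsP; exists (i, j); split; rewrite ?mem_iota.
  by exists L, L'; split => //; exact: hw.
rewrite /= !big_cons big_nil /z /= addr0.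
have : \sum_(i <- ijs) (c / M0%:R) <= e / 4.
  rewrite big_const_seq count_predT size_allpairs !size_iota iter_addr_0 -[leLHS]mulr_natl natrM -expr2.
  have M00 : 0 < M0%:R :> R by rewrite ltr0n /M0 addn_gt0 !muln_gt0/= ltnW.
  by rewrite mulrA ler_pdivrMr// [leRHS]mulrC -ler_pdivrMr.
by lra.
Qed.

End far_lines.

(** * Contact of cylinders as a countable condition *)

Section touching.
Variables (R : realType) (n : nat).
Local Notation V := 'rV[R]_n.+1.
Local Notation lines := (line R n).

Lemma hit_limit (x : V) (L : lines) : (forall j : nat, hit x (1 + j.+1%:R^-1) L) -> hit x 1 L.
Proof.
move=> h; have [p [v [v0 Lpv]]] := line_setP L.
apply/(hit_disc x ler01 v0 Lpv); rewrite expr1n mul1r leNgt; apply/negP => lt.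
have D0 := dot_gt0 v0; pose e := (disc p v x - dot v v) / (4 * dot v v).
have e0 : 0 < e by rewrite divr_gt0 ?subr_gt0 ?mulr_gt0.
have [j hj] := inv_small e0.
have j0 : 0 < j.+1%:R^-1 :> R by rewrite invr_gt0.
have j1 : j.+1%:R^-1 <= 1 :> R by rewrite invf_le1// ler1n.
have r0 : 0 <= 1 + j.+1%:R^-1 :> R by rewrite addr_ge0// ltW.
move: (h j) => /(hit_disc x r0 v0 Lpv); apply/negP; rewrite -ltNge.
have : 4 * dot v v * j.+1%:R^-1 <= disc p v x - dot v v.
  by rewrite mulrC -ler_pdivlMr// mulr_gt0.
by move: (j.+1%:R^-1) j0 j1 D0 => d d0 d1 D0; nra.
Qed.

(** The bound [M], uniform in [j], gives the approximate contact points a cluster point, which is a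
    contact point since hitting is a closed condition. *)
Lemma touch_approx (L L' : lines) : touch L L' <-> exists M : nat, forall j : nat,
  exists z, [/\ enorm (lat R j z) <= M%:R, hit (lat R j z) (1 + j.+1%:R^-1) L &
    hit (lat R j z) (1 + j.+1%:R^-1) L'].
Proof.
split.
  move=> [x [xL xL']]; exists (Num.bound (enorm x + 1)) => j.
  have [z hz] := lat_approx j x; exists z.
  have j1 : j.+1%:R^-1 <= 1 :> R by rewrite invf_le1// ler1n.
  have near M : hit x 1 M -> hit (lat R j z) (1 + j.+1%:R^-1) M.
    move=> [y My yx]; exists y => //; have -> : y - lat R j z = (y - x) + (x - lat R j z) by vring.
    by apply: le_trans (enormD _ _) _; rewrite lerD.
  split; [|exact: near|exact: near].
  apply: (@le_trans _ _ (enorm x + 1)); last first.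
    by rewrite ltW// archi_boundP// addr_ge0// enorm_ge0.
  have -> : lat R j z = x - (x - lat R j z) by vring.
  by apply: le_trans (enormB _ _) _; rewrite lerD2l (le_trans hz).
move=> [M /choice[z hz]]; pose y j := lat R j (z j).
have [x [_ clx]] : [set x : V | (enorm (x - 0) <= M%:R)%R] `&` cluster (y @ \oo) !=set0.
  apply: (@ball_compact R n 0 M%:R).
  by exists 0%N => // j _ /=; rewrite subr0; case: (hz j).
have lim N : (forall j, hit (y j) (1 + j.+1%:R^-1) N) -> hit x 1 N.
  move=> hN; apply: hit_limit => j.
  have r0 : 0 <= 1 + j.+1%:R^-1 :> R by rewrite addr_ge0// invr_ge0.
  have /closure_id cl := @hit_closed R n _ N r0; rewrite -[_ N]/([set x | hit x _ N] x) cl.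
  move=> B /clx; apply; exists j => // i /= ji; apply: hit_le (hN i).
  by rewrite lerD2l lef_pV2 ?posrE// ler_nat.
by exists x; split; apply: lim => j; case: (hz j).
Qed.

End touching.

(** * Measurability *)

Section all_reach_measurable.
Variables (R : realType) (n : nat).
Local Notation V := 'rV[R]_n.+1.
Local Notation lines := (line R n).
Variables (Lam : {measure set lines -> \bar R}).
Context (disp : measure_display) (T : measurableType disp) (P : probability T R).
Variable omega : T -> {measure set lines -> \bar R}.
Hypothesis homega : is_poisson_process P Lam omega.
Local Notation S w := (support (omega w)).

Lemma measurable_exists (I : countType) (E : I -> set T) :
  (forall i, measurable (E i)) -> measurable [set w | exists i, E i w].
Proof.
move=> mE; have -> : [set w | exists i, E i w] =
    \bigcup_k (if choice.unpickle k is Some i then E i else set0).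
  apply/seteqP; split => w /=.
    by move=> [i Eiw]; exists (choice.pickle i); rewrite // choice.pickleK.
  by move=> [k _]; case: choice.unpickle => // i; exists i.
by apply: bigcupT_measurable => k; case: choice.unpickle.
Qed.

Lemma measurable_forall (I : countType) (E : I -> set T) :
  (forall i, measurable (E i)) -> measurable [set w | forall i, E i w].
Proof.
move=> mE; have -> : [set w | forall i, E i w] = ~` [set w | exists i, (~` E i) w].
  apply/seteqP; split => w /=; first by move=> h [i /(_ (h i))].
  by move=> h i; apply: contrapT => nE; apply: h; exists i.
by apply: measurableC; apply: measurable_exists => i; exact: measurableC.
Qed.

(** A cell coded by a word of any length, so that the blocks of all depths form one countable
    family. *)
Definition block (b : seq bool) : set lines :=
  cell (@base_nth R n) [ffun j : 'I_(size b) => nth false b j].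

Lemma block_measurable b : measurable (block b).
Proof. by apply: cell_measurable; exact: base_nth_measurable. Qed.

Lemma blockP b L : block b L <->
  forall j, (j < size b)%N -> `[< base_nth j L >] = nth false b j.
Proof.
split => [/ffunP h j jb|h]; first by have := h (Ordinal jb); rewrite !ffunE.
by apply/ffunP => j; rewrite !ffunE; exact: h.
Qed.

(* Quantifying over the countably many blocks that contain exactly one line of the
   process amounts to quantifying over the lines of the process. *)
Definition isolates (w : T) (b : seq bool) (L : lines) : Prop :=
  [/\ S w L, block b L & forall L', S w L' -> block b L' -> L' = L].

(** By local finiteness only finitely many lines of the process hit a unit ball near [L]; the word
    records this ball and one separating set for each of them. *)
Lemma isolated (w : T) (L : lines) : S w L -> exists b, isolates w b L.
Proof.
move=> SL; have [pm _ _ _ _] := homega.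
have [p Lp] := line_nonempty L; have [z hz] := lat_approx 0 p.
have hL : hit (lat R 0 z) 1 L by exists p => //; rewrite invr1 in hz.
have /finite_seqP[s sE] := support_hit_finite (pm w) (lat R 0 z) ler01.
have /choice[f hf] : forall L', exists k, L' <> L -> base_nth k L /\ ~ base_nth k L'.
  move=> L'; have [->|LL'] := pselect (L' = L); first by exists 0%N.
  by have [k hk] := @base_nth_separates R n L L' (nesym LL'); exists k.
(* Index of the ball itself: its entry in the word rules out all lines that miss the ball. *)
pose k0 := choice.pickle (0%N, z).
have k0E M : base_nth k0 M <-> hit (lat R 0 z) 1 M.
  by rewrite /base_nth choice.pickleK /base/= invr1.
have [J [Jk0 Js]] : exists J, (k0 < J)%N /\ forall L', L' \in s -> (f L' < J)%N.
  elim: s {sE} => [|L' s [J [h1 h2]]]; first by exists k0.+1.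
  exists (maxn J (f L').+1); split; first by rewrite leq_max h1.
  by move=> M; rewrite inE leq_max => /orP[/eqP ->|/h2 ->//]; rewrite ltnSn orbT.
pose b := [seq `[< base_nth j L >] | j <- iota 0 J].
have sb : size b = J by rewrite size_map size_iota.
have nb j : (j < J)%N -> nth false b j = `[< base_nth j L >].
  by move=> jJ; rewrite (nth_map 0%N) ?size_iota// nth_iota.
exists b; split => //; first by apply/blockP => j; rewrite sb => /nb.
move=> L' SL' /blockP bL'; apply: contrapT => LL'.
have hL' : hit (lat R 0 z) 1 L'.
  by apply/k0E/asboolP; rewrite bL' ?sb// nb//; exact/asboolP/k0E.
have L's : L' \in s.
  have : [set` s] L' by rewrite -sE; split.
  by [].
have [h1 h2] := hf L' LL'; apply: h2; apply/asboolP.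
by rewrite bL' ?sb ?Js// nb ?Js//; exact/asboolP.
Qed.

Let mocc (A : set lines) : measurable A -> measurable (occ omega A) :=
  occ_measurable homega (A := A).

Definition isolated_event (b : seq bool) : set T := [set w | exists L, isolates w b L].

(** A block contains exactly one line when it is occupied and no set of the separating family splits
    it into two occupied parts. *)
Lemma isolated_event_measurable b : measurable (isolated_event b).
Proof.
have mb := block_measurable b.
have -> : isolated_event b = occ omega (block b) `&` [set w | forall k,
    (~` (occ omega (block b `&` @base_nth R n k) `&` occ omega (block b `\` @base_nth R n k))) w].
  have mI k : measurable (block b `&` @base_nth R n k).
    by apply: measurableI => //; exact: base_nth_measurable.
  have mD k : measurable (block b `\` @base_nth R n k).
    by apply: measurableD => //; exact: base_nth_measurable.
  apply/seteqP; split => w /=.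
    move=> [L [SL bL uL]]; split; first by apply/(occP homega _ mb); exists L.
    move=> k [/(occP homega _ (mI k))[L1 S1 [b1 h1]] /(occP homega _ (mD k))[L2 S2 [b2 h2]]].
    by apply: h2; rewrite (uL _ S2 b2) -(uL _ S1 b1).
  move=> [/(occP homega _ mb)[L SL bL] h]; exists L; split => // L' SL' bL'.
  apply: contrapT => LL'; have [k [h1 h2]] := @base_nth_separates R n L L' (nesym LL').
  apply: (h k); split; [apply/(occP homega _ (mI k))|apply/(occP homega _ (mD k))].
    by exists L.
  by exists L'.
apply: measurableI; first exact: mocc.
apply: measurable_forall => k; apply: measurableC; apply: measurableI; apply: mocc.
  by apply: measurableI => //; exact: base_nth_measurable.
by apply: measurableD => //; exact: base_nth_measurable.
Qed.

Definition touch_event (b b' : seq bool) : set T :=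
  [set w | exists M : nat, forall j : nat, exists z : 'rV[int]_n.+1,
    ([set _ | enorm (lat R j z) <= M%:R] `&`
     (occ omega (block b `&` hit (lat R j z) (1 + j.+1%:R^-1)) `&`
      occ omega (block b' `&` hit (lat R j z) (1 + j.+1%:R^-1)))) w].

Let mbh b j z : measurable (block b `&` hit (lat R j z) (1 + j.+1%:R^-1)).
Proof.
have r0 : 0 <= 1 + j.+1%:R^-1 :> R by rewrite addr_ge0// invr_ge0.
by apply: measurableI; [exact: block_measurable|exact: hit_measurable].
Qed.

Lemma touch_event_measurable b b' : measurable (touch_event b b').
Proof.
apply: (@measurable_exists nat) => M; apply: (@measurable_forall nat) => j.
apply: (@measurable_exists 'rV[int]_n.+1) => z.
apply: measurableI; last by apply: measurableI; exact: mocc.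
have [h|h] := boolP (enorm (lat R j z) <= M%:R).
  by rewrite (_ : [set _ | _] = setT)//; apply/seteqP; split.
by rewrite (_ : [set _ | _] = set0)//; apply/seteqP; split.
Qed.

Lemma touch_eventP w b b' L L' : isolates w b L -> isolates w b' L' ->
  touch_event b b' w <-> touch L L'.
Proof.
move=> [SL bL uL] [SL' b'L' uL']; rewrite touch_approx; split.
  move=> [M h]; exists M => j; have [z [zM [q1 q2]]] := h j; exists z.
  move: q1 q2 => /(occP homega _ (mbh _ _ _))[L1 S1 [b1 h1]].
  move=> /(occP homega _ (mbh _ _ _))[L2 S2 [b2 h2]].
  by rewrite -(uL _ S1 b1) -(uL' _ S2 b2).
move=> [M h]; exists M => j; have [z [zM h1 h2]] := h j; exists z; split => //.
by split; apply/(occP homega _ (mbh _ _ _)); [exists L|exists L'].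
Qed.

(** The choice of an intermediate line becomes a countable union over words that isolate it. *)
Fixpoint reach_event (k : nat) (b b' : seq bool) : set T :=
  if k is k'.+1 then [set w | exists b'', (isolated_event b'' `&` reach_event k' b b'' `&`
    touch_event b'' b') w]
  else touch_event b b'.

Lemma reach_event_measurable k b b' : measurable (reach_event k b b').
Proof.
elim: k b' => [|k IH] b' /=; first exact: touch_event_measurable.
apply: (@measurable_exists (seq bool)) => b''.
apply: measurableI; last exact: touch_event_measurable.
by apply: measurableI => //; exact: isolated_event_measurable.
Qed.

Lemma reach_eventP k w b b' L L' : isolates w b L -> isolates w b' L' ->
  reach_event k b b' w <-> reach (S w) k L L'.
Proof.
move=> bL; elim: k b' L' => [|k IH] b' L' b'L' /=; first exact: touch_eventP.
split.
  move=> [b'' [[[L'' b''L''] r] t]]; exists L''; split; first by case: b''L''.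
    exact/(IH _ _ b''L'').
  exact/(touch_eventP b''L'' b'L').
move=> [L'' [SL'' r t]]; have [b'' b''L''] := isolated SL''.
exists b''; split; first split; first by exists L''.
  exact/(IH _ _ b''L'').
exact/(touch_eventP b''L'' b'L').
Qed.

Lemma all_reach_measurable k : measurable [set w | all_reach (S w) k].
Proof.
have -> : [set w | all_reach (S w) k] = [set w | forall bb : seq bool * seq bool,
    (~` (isolated_event bb.1 `&` isolated_event bb.2) `|` reach_event k bb.1 bb.2) w].
  apply/seteqP; split => w /=.
    move=> h [b b'] /=; have [[[L bL] [L' b'L']]|no] :=
      pselect ((isolated_event b `&` isolated_event b') w); last by left.
    right; apply/(reach_eventP k bL b'L'); apply: h; first by case: bL.
    by case: b'L'.
  move=> h L L' SL SL'; have [b bL] := isolated SL; have [b' b'L'] := isolated SL'.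
  apply/(reach_eventP k bL b'L'); case: (h (b, b')) => //= no; exfalso; apply: no.
  by split; [exists L|exists L'].
apply: (@measurable_forall (seq bool * seq bool)%type) => bb.
apply: measurableU; last exact: reach_event_measurable.
by apply: measurableC; apply: measurableI; exact: isolated_event_measurable.
Qed.

End all_reach_measurable.

Local Open Scope ereal_scope.

(* The dimension is d = n.+1, and d - 2 is written n.+1%:R - 2. *)
Theorem theorem1p1 (R : realType) (n : nat) (u : R)
    (mu : {measure set (line R n) -> \bar R})
    (disp : measure_display) (T : measurableType disp) (P : probability T R)
    (omega : T -> {measure set (line R n) -> \bar R}) :
  (3 <= n.+1)%N -> (0 < u)%R ->
  is_haar mu ->
  is_poisson_process P (fun A => u%:E * mu A) omega ->
  P [set w | cylinder_diam (omega w) = (n.+1%:R - 2)%:E] = 1.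
Proof.
move=> n2 u0 hmu homega0.
pose Lam : {measure set (line R n) -> \bar R} := mscale (NngNum (ltW u0)) mu.
have LamE A : Lam A = u%:E * mu A by [].
have homega : is_poisson_process P Lam omega by exact: homega0.
have -> : [set w | cylinder_diam (omega w) = (n.+1%:R - 2)%:E] =
    [set w | all_reach (support (omega w)) n.-1] `\`
    [set w | all_reach (support (omega w)) n.-2].
  (* [cylinder_diam_eq] concerns a successor, which [n.-1] is because [n >= 2]. *)
  have nE : n.-1 = n.-2.+1 by move: n2; clear; case: n => [|[]].
  have -> : (n.+1%:R - 2 = n.-2.+1%:R :> R)%R.
    by rewrite (_ : n.+1 = n.-2.+1 + 2)%N ?natrD ?addrK//; move: n2; clear; lia.
  apply/seteqP; split => w /=; first by move/(cylinder_diam_eq (omega w) n.-2); rewrite nE.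
  by rewrite nE => h; apply/(cylinder_diam_eq (omega w) n.-2).
set A := [set w | all_reach _ n.-1]; set B := [set w | all_reach _ n.-2].
have mA : measurable A by exact: (all_reach_measurable homega).
have mB : measurable B by exact: (all_reach_measurable homega).
have nB : P.-negligible B.
  by apply: outer_le_negligible => e; exact: (all_reach_outer u0 hmu LamE homega n2).
have mAB : measurable (A `\` B) by exact: measurableD.
have AB0 : P (~` (A `\` B)) = 0.
  apply/negligibleP; first exact: measurableC.
  by rewrite setCD; apply: negligibleU nB; exact: (all_reach_ae u0 hmu LamE homega n2).
by rewrite -[A `\` B]setCK probability_setC ?AB0 ?sube0//; exact: measurableC.
Qed.
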